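(* Let $\gamma>0$ be such that $\sigma\left(A\otimes I+I\otimes A+\frac{1}{\gamma^2}\sum_{k=1}^m N_k\otimes N_k\right)\subset\mathbb C_-$. Let $y$ be the output of the system $$\dot x(t)=Ax(t)+Bu(t)+\sum_{k=1}^m N_kx(t)u_k(t),\quad x(0)=X_0v_0,\qquad y(t)=Cx(t),\quad t\ge 0,$$ and define the reduced output $\tilde y=\tilde y_{x_0}+\tilde y_B$, where $\tilde y_{x_0}$ is the output of the reduced homogeneous system of dimension $r_{x_0}$ and $\tilde y_B$ is the output of the reduced inhomogeneous system of dimension $r_B$ (both defined in the context). Assume that the reduced homogeneous system is obtained either by BT or by SPA with $\Theta_1>0$, where, in the case of SPA, it is assumed that the reduced Gramian $\tilde P$ exists, and that the reduced inhomogeneous system is obtained either by BT or by SPA (the two choices being independent of each other). Then, with the matrix $\mathcal W_{x_0}$ defined in the context, $$\|y-\tilde y\|_{L^2}\le\left[\left(\operatorname{tr}(\Theta_2\mathcal W_{x_0})\right)^{\frac12}\|v_0\|_2+\left(2\sum_{i=r_B+1}^n\sigma_i\right)\|u\|_{L^2}\right]\exp\left\{0.5\,\|\gamma u^0\|_{L^2}^2\right\},$$ where $\Theta_2=\operatorname{diag}(\theta_{r_{x_0}+1},\ldots,\theta_n)$ and $\theta_{r_{x_0}+1},\ldots,\theta_n$ and $\sigma_{r_B+1},\ldots,\sigma_n$ are the truncated Hankel singular values of the homogeneous and of the inhomogeneous subsystem, respectively.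
   Context: Setting. $A,N_1,\ldots,N_m\in\mathbb R^{n\times n}$, $B\in\mathbb R^{n\times m}$, $C\in\mathbb R^{p\times n}$, $X_0\in\mathbb R^{n\times q}$, $v_0\in\mathbb R^q$; $A$ is Hurwitz, i.e. $\sigma(A)\subset\mathbb C_-=\{z\in\mathbb C:\Re(z)<0\}$ ($\sigma(\cdot)$ is the spectrum). The control $u=(u_1,\ldots,u_m)^\top:[0,\infty)\to\mathbb R^m$ lies in $L^2$, with $\|f\|_{L^2}^2=\int_0^\infty\|f(s)\|_2^2\,ds$. The function $u^0=(u_1^0,\ldots,u_m^0)^\top$ is given by $u_k^0\equiv 0$ if $N_k=0$ and $u_k^0=u_k$ otherwise. For symmetric matrices, $M_1\le M_2$ means $M_2-M_1$ is positive semidefinite, and $M>0$ means positive definite. Gramians (for the fixed $\gamma$). $P_0$ and $Q$ are the solutions of $AP_0+P_0A^\top+\frac1{\gamma^2}\sum_kN_kP_0N_k^\top=-X_0X_0^\top$ and $A^\top Q+QA+\frac1{\gamma^2}\sum_kN_k^\top QN_k=-C^\top C$ (unique under the spectral condition in the claim). $P_B$ is a positive definite matrix satisfying $A^\top P_B^{-1}+P_B^{-1}A+\frac1{\gamma^2}\sum_kN_k^\top P_B^{-1}N_k\le-P_B^{-1}BB^\top P_B^{-1}$. Balancing. It is assumed that there are invertible matrices $\mathcal S,S\in\mathbb R^{n\times n}$ with $\mathcal SP_0\mathcal S^\top=\mathcal S^{-\top}Q\mathcal S^{-1}=\Theta=\operatorname{diag}(\theta_1,\ldots,\theta_n)=\begin{bmatrix}\Theta_1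 & 0 \\ 0 & \Theta_2\end{bmatrix}$ and $SP_BS^\top=S^{-\top}QS^{-1}=\Sigma=\operatorname{diag}(\sigma_1,\ldots,\sigma_n)$, where $\Theta_1\in\mathbb R^{r_{x_0}\times r_{x_0}}$, $\theta_i$, $\sigma_i$ are the square roots of the eigenvalues of $P_0Q$, $P_BQ$ (Hankel singular values of the homogeneous and inhomogeneous subsystem, respectively), $\theta_{r_{x_0}+1},\ldots,\theta_n$ are the $n-r_{x_0}$ smallest of the $\theta_i$, and $\sigma_{r_B+1},\ldots,\sigma_n$ are the $n-r_B$ smallest of the $\sigma_i$. Partition $\mathcal SA\mathcal S^{-1}=\begin{bmatrix}\mathcal A_{11} & \mathcal A_{12} \\ \mathcal A_{21} & \mathcal A_{22}\end{bmatrix}$, $\mathcal SX_0=\begin{bmatrix}X_{0,1} \\ X_{0,2}\end{bmatrix}$, $C\mathcal S^{-1}=[\mathcal C_1\ \mathcal C_2]$, $\mathcal SN_k\mathcal S^{-1}=\begin{bmatrix}\mathcal N_{k,11} & \mathcal N_{k,12} \\ \mathcal N_{k,21} & \mathcal N_{k,22}\end{bmatrix}$ with first block of size $r_{x_0}$, and $SAS^{-1}=\begin{bmatrix}A_{11} & A_{12} \\ A_{21} & A_{22}\end{bmatrix}$, $SB=\begin{bmatrix}B_1 \\ B_2\end{bmatrix}$, $CS^{-1}=[C_1\ C_2]$, $SN_kS^{-1}=\begin{bmatrix}N_{k,11} & N_{k,12} \\ N_{k,21} & N_{k,22}\end{bmatrix}$ with first block of size $r_B$. Reduced homogeneous system: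 $\dot{\tilde x}_{x_0}=\tilde A_{x_0}\tilde x_{x_0}+\sum_k\tilde N_{x_0,k}\tilde x_{x_0}u_k$, $\tilde x_{x_0}(0)=\tilde X_0v_0$, $\tilde y_{x_0}=\tilde C_{x_0}\tilde x_{x_0}$, with - BT (balanced truncation): $(\tilde A_{x_0},\tilde X_0,\tilde C_{x_0},\tilde N_{x_0,k})=(\mathcal A_{11},X_{0,1},\mathcal C_1,\mathcal N_{k,11})$; - SPA (singular perturbation approximation; $\mathcal A_{22}$ invertible): $(\tilde A_{x_0},\tilde X_0,\tilde C_{x_0},\tilde N_{x_0,k})=(\mathcal A_{11}-\mathcal A_{12}\mathcal A_{22}^{-1}\mathcal A_{21},\,X_{0,1},\,\mathcal C_1-\mathcal C_2\mathcal A_{22}^{-1}\mathcal A_{21},\,\mathcal N_{k,11}-\mathcal N_{k,12}\mathcal A_{22}^{-1}\mathcal A_{21})$. Reduced inhomogeneous system: $\dot{\tilde x}_B=\tilde A_B\tilde x_B+\tilde Bu+\sum_k(\tilde N_{B,k}\tilde x_B+\tilde E_ku)u_k$, $\tilde x_B(0)=0$, $\tilde y_B=\tilde C_B\tilde x_B+\tilde Du$, with - BT: $(\tilde A_B,\tilde B,\tilde C_B,\tilde D,\tilde E_k,\tilde N_{B,k})=(A_{11},B_1,C_1,0,0,N_{k,11})$; - SPA ($A_{22}$ invertible): $\tilde A_B=A_{11}-A_{12}A_{22}^{-1}A_{21}$, $\tilde B=B_1-A_{12}A_{22}^{-1}B_2$, $\tilde C_B=C_1-C_2A_{22}^{-1}A_{21}$,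 $\tilde D=-C_2A_{22}^{-1}B_2$, $\tilde E_k=-N_{k,12}A_{22}^{-1}B_2$, $\tilde N_{B,k}=N_{k,11}-N_{k,12}A_{22}^{-1}A_{21}$. Reduced Gramian: $\tilde P=\int_0^\infty\tilde Z_\gamma(s)\,ds$ (it ''exists'' if the integral converges), where $\dot{\tilde Z}_\gamma=\tilde A_{x_0}\tilde Z_\gamma+\tilde Z_\gamma\tilde A_{x_0}^\top+\frac1{\gamma^2}\sum_k\tilde N_{x_0,k}\tilde Z_\gamma\tilde N_{x_0,k}^\top$, $\tilde Z_\gamma(0)=\tilde X_0\tilde X_0^\top$. The weight: let $Y=\begin{bmatrix}Y_1 \\ Y_2\end{bmatrix}\in\mathbb R^{n\times r_{x_0}}$ ($Y_1$ having $r_{x_0}$ rows) be the unique solution of $\mathcal SA\mathcal S^{-1}Y+Y\tilde A_{x_0}^\top+\frac1{\gamma^2}\sum_k\mathcal SN_k\mathcal S^{-1}Y\tilde N_{x_0,k}^\top=-\mathcal SX_0X_{0,1}^\top$. Then $$\mathcal W_{x_0}=X_{0,2}X_{0,2}^\top+2Y_2\mathbf A_{21}^\top+2[\mathcal A_{21}\ \mathcal A_{22}]Y\bar{\mathbf A}_{21}^\top+\frac1{\gamma^2}\sum_{k=1}^m\left(2[\mathcal N_{k,21}\ \mathcal N_{k,22}]Y\mathbf N_{k,21}^\top-\mathbf N_{k,21}\tilde P\mathbf N_{k,21}^\top\right),$$ with $(\mathbf A_{21},\bar{\mathbf A}_{21},\mathbf N_{k,21})=(\mathcal A_{21},0,\mathcal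 N_{k,21})$ if the homogeneous part is reduced by BT and $(\mathbf A_{21},\bar{\mathbf A}_{21},\mathbf N_{k,21})=(0,-\mathcal A_{22}^{-1}\mathcal A_{21},\mathcal N_{k,21}-\mathcal N_{k,22}\mathcal A_{22}^{-1}\mathcal A_{21})$ if it is reduced by SPA. *)

(* Defs.v *)
From HB Require Import structures.
From mathcomp Require Import all_boot all_order all_algebra.
From mathcomp Require Import all_classical all_reals all_analysis.
From mathcomp.real_closed Require Import complex mxtens.

Set Implicit Arguments.
Unset Strict Implicit.
Unset Printing Implicit Defensive.

Import Order.TTheory GRing.Theory Num.Theory.
Import numFieldNormedType.Exports.

Local Open Scope classical_set_scope.
Local Open Scope ring_scope.

Section LinearAlgebra.
Context {R : realType}.

(* The spectrum of a real matrix is the set of its complex eigenvalues. *)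
Definition spectrum n (M : 'M[R]_n) : set R[i] :=
  [set z | eigenvalue (map_mx (real_complex R) M) z].

Definition open_left_half_plane : set R[i] := [set z | complex.Re z < 0].

Definition hurwitz n (M : 'M[R]_n) : Prop :=
  spectrum M `<=` open_left_half_plane.

Definition psd n (M : 'M[R]_n) : Prop :=
  M^T = M /\ forall v : 'cV[R]_n, 0 <= (v^T *m M *m v) ord0 ord0.

Definition posdef n (M : 'M[R]_n) : Prop :=
  M^T = M /\ forall v : 'cV[R]_n, v != 0 -> 0 < (v^T *m M *m v) ord0 ord0.

Definition loewner_le n (M1 M2 : 'M[R]_n) : Prop := psd (M2 - M1).

Definition norm2 n (v : 'cV[R]_n) : R := Num.sqrt (\sum_i v i ord0 ^+ 2).

(* Splitting an index range of size n into its first r and last n - r indices;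
   the blocks are then obtained with usubmx, lsubmx, ulsubmx, etc. *)
Definition split_rows n q r (hr : (r <= n)%N) (M : 'M[R]_(n, q)) :
  'M[R]_(r + (n - r), q) := castmx (esym (subnKC hr), erefl q) M.

Definition split_cols n p r (hr : (r <= n)%N) (M : 'M[R]_(p, n)) :
  'M[R]_(p, r + (n - r)) := castmx (erefl p, esym (subnKC hr)) M.

Definition split_sq n r (hr : (r <= n)%N) (M : 'M[R]_n) :
  'M[R]_(r + (n - r)) := castmx (esym (subnKC hr), esym (subnKC hr)) M.

(* s lists the Hankel singular values of the pair (P, Q): the square roots of
   the eigenvalues of P Q, counted with algebraic multiplicity. *)
Definition hankel_singular_values n (P Q : 'M[R]_n) (s : 'rV[R]_n) : Prop :=
  (forall i, 0 <= s ord0 i) /\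
  char_poly (P *m Q) = \prod_i ('X - (s ord0 i ^+ 2)%:P).

Definition balancing n (T P Q : 'M[R]_n) (s : 'rV[R]_n) : Prop :=
  [/\ T \in unitmx,
      T *m P *m T^T = diag_mx s,
      (invmx T)^T *m Q *m invmx T = diag_mx s
    & hankel_singular_values P Q s].

Definition trailing_smallest n (r : nat) (s : 'rV[R]_n) : Prop :=
  forall i j : 'I_n, (i < r)%N -> (r <= j)%N -> s ord0 j <= s ord0 i.

End LinearAlgebra.

Section Systems.
Context {R : realType}.
Local Notation mu := (@lebesgue_measure R).

(* Caratheodory solution of dX/dt = f(t, X), X(0) = X0, on [0, +oo):
   the integrated equation holds entrywise, in the Lebesgue sense.  In
   particular X is locally absolutely continuous on [0, +oo). *)
Definition is_solution a b (f : R -> 'M[R]_(a, b) -> 'M[R]_(a, b))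
    (X0 : 'M[R]_(a, b)) (X : R -> 'M[R]_(a, b)) : Prop :=
  forall t : R, 0 <= t -> forall i j,
    mu.-integrable `[0, t] (fun s => (f s (X s) i j)%:E) /\
    X t i j = X0 i j + \int[mu]_(s in `[0, t]) f s (X s) i j.

Definition L2norm n (f : R -> 'cV[R]_n) : \bar R :=
  ((\int[mu]_(s in `[0%R, +oo[) (norm2 (f s) ^+ 2)%:E) `^ 2^-1)%E.

Definition in_L2 n (f : R -> 'cV[R]_n) : Prop :=
  (forall i,
     @measurable_fun _ _ R R `[0, +oo[ (fun t => f t i ord0)) /\
  (L2norm f < +oo)%E.

Definition control0 n m (N : 'I_m -> 'M[R]_n) (u : R -> 'cV[R]_m) :
  R -> 'cV[R]_m :=
  fun t => \col_k (if N k == 0 then 0 else u t k ord0).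

Definition bilinear_output n m p (A : 'M[R]_n) (B : 'M[R]_(n, m))
    (C : 'M[R]_(p, n)) (N : 'I_m -> 'M[R]_n) (x0 : 'cV[R]_n)
    (u : R -> 'cV[R]_m) (y : R -> 'cV[R]_p) : Prop :=
  exists x : R -> 'cV[R]_n,
    is_solution (fun t x => A *m x + B *m u t
                            + \sum_k u t k ord0 *: (N k *m x)) x0 x
    /\ forall t, 0 <= t -> y t = C *m x t.

Definition homogeneous_output n m p (A : 'M[R]_n) (C : 'M[R]_(p, n))
    (N : 'I_m -> 'M[R]_n) (x0 : 'cV[R]_n)
    (u : R -> 'cV[R]_m) (y : R -> 'cV[R]_p) : Prop :=
  exists x : R -> 'cV[R]_n,
    is_solution (fun t x => A *m x + \sum_k u t k ord0 *: (N k *m x)) x0 x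
    /\ forall t, 0 <= t -> y t = C *m x t.

Definition inhomogeneous_output n m p (A : 'M[R]_n) (B : 'M[R]_(n, m))
    (C : 'M[R]_(p, n)) (D : 'M[R]_(p, m)) (E : 'I_m -> 'M[R]_(n, m))
    (N : 'I_m -> 'M[R]_n) (u : R -> 'cV[R]_m) (y : R -> 'cV[R]_p) : Prop :=
  exists x : R -> 'cV[R]_n,
    is_solution (fun t x => A *m x + B *m u t
                  + \sum_k u t k ord0 *: (N k *m x + E k *m u t)) 0 x
    /\ forall t, 0 <= t -> y t = C *m x t + D *m u t.

(* X |-> A1 X + X A2^T + gamma^-2 sum_k N1_k X N2_k^T *)
Definition lyap_op a b m (gamma : R) (A1 : 'M[R]_a) (A2 : 'M[R]_b)
    (N1 : 'I_m -> 'M[R]_a) (N2 : 'I_m -> 'M[R]_b) (X : 'M[R]_(a, b)) :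
  'M[R]_(a, b) :=
  A1 *m X + X *m A2^T + (gamma ^+ 2)^-1 *: \sum_k N1 k *m X *m (N2 k)^T.

Definition kron_op n m (gamma : R) (A : 'M[R]_n) (N : 'I_m -> 'M[R]_n) :
  'M[R]_(n * n) :=
  tensmx A 1%:M + tensmx 1%:M A
  + (gamma ^+ 2)^-1 *: \sum_k tensmx (N k) (N k).

Definition is_Z n m q (gamma : R) (A : 'M[R]_n) (N : 'I_m -> 'M[R]_n)
    (X0 : 'M[R]_(n, q)) (Z : R -> 'M[R]_n) : Prop :=
  is_solution (fun _ => lyap_op gamma A A N N) (X0 *m X0^T) Z.

Definition gramian n (Z : R -> 'M[R]_n) : 'M[R]_n :=
  \matrix_(i, j) \int[mu]_(s in `[0, +oo[) Z s i j.

(* Z takes positive semidefinite values, so convergence of the improper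
   integral and Lebesgue integrability coincide. *)
Definition gramian_exists n (Z : R -> 'M[R]_n) : Prop :=
  forall i j, mu.-integrable `[0, +oo[ (fun s => (Z s i j)%:E).

End Systems.

Inductive method := BT | SPA.

Section Reduction.
Context {R : realType}.

Definition admissible (mth : method) r s (A : 'M[R]_(r + s)) : Prop :=
  if mth is SPA then drsubmx A \in unitmx else True.

Definition red_A (mth : method) r s (A : 'M[R]_(r + s)) : 'M[R]_r :=
  match mth with
  | BT => ulsubmx A
  | SPA => ulsubmx A - ursubmx A *m invmx (drsubmx A) *m dlsubmx A
  end.

Definition red_N (mth : method) r s (A N : 'M[R]_(r + s)) : 'M[R]_r :=
  match mth with
  | BT => ulsubmx N
  | SPA => ulsubmx N - ursubmx N *m invmx (drsubmx A) *m dlsubmx A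
  end.

Definition red_C (mth : method) r s p (A : 'M[R]_(r + s))
    (C : 'M[R]_(p, r + s)) : 'M[R]_(p, r) :=
  match mth with
  | BT => lsubmx C
  | SPA => lsubmx C - rsubmx C *m invmx (drsubmx A) *m dlsubmx A
  end.

Definition red_B (mth : method) r s m (A : 'M[R]_(r + s))
    (B : 'M[R]_(r + s, m)) : 'M[R]_(r, m) :=
  match mth with
  | BT => usubmx B
  | SPA => usubmx B - ursubmx A *m invmx (drsubmx A) *m dsubmx B
  end.

Definition red_D (mth : method) r s m p (A : 'M[R]_(r + s))
    (B : 'M[R]_(r + s, m)) (C : 'M[R]_(p, r + s)) : 'M[R]_(p, m) :=
  match mth with
  | BT => 0
  | SPA => - (rsubmx C *m invmx (drsubmx A) *m dsubmx B)
  end.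

Definition red_E (mth : method) r s m (A N : 'M[R]_(r + s))
    (B : 'M[R]_(r + s, m)) : 'M[R]_(r, m) :=
  match mth with
  | BT => 0
  | SPA => - (ursubmx N *m invmx (drsubmx A) *m dsubmx B)
  end.

Definition bold_A21 (mth : method) r s (A : 'M[R]_(r + s)) : 'M[R]_(s, r) :=
  if mth is BT then dlsubmx A else 0.

Definition bold_bar_A21 (mth : method) r s (A : 'M[R]_(r + s)) :
  'M[R]_(s, r) :=
  if mth is BT then 0 else - (invmx (drsubmx A) *m dlsubmx A).

Definition bold_N21 (mth : method) r s (A N : 'M[R]_(r + s)) :
  'M[R]_(s, r) :=
  match mth with
  | BT => dlsubmx N
  | SPA => dlsubmx N - drsubmx N *m invmx (drsubmx A) *m dlsubmx A
  end.

Definition weight (mth : method) (gamma : R) r s m q (A : 'M[R]_(r + s))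
    (N : 'I_m -> 'M[R]_(r + s)) (X0 : 'M[R]_(r + s, q))
    (Y : 'M[R]_(r + s, r)) (Pt : 'M[R]_r) : 'M[R]_s :=
  dsubmx X0 *m (dsubmx X0)^T
  + 2 *: (dsubmx Y *m (bold_A21 mth A)^T)
  + 2 *: (dsubmx A *m Y *m (bold_bar_A21 mth A)^T)
  + (gamma ^+ 2)^-1 *: \sum_k
      (2 *: (dsubmx (N k) *m Y *m (bold_N21 mth A (N k))^T)
       - bold_N21 mth A (N k) *m Pt *m (bold_N21 mth A (N k))^T).

End Reduction.

(* Main.v *)
(* The spectral condition yields H > 0 with a strictly negative image under the
   dual Lyapunov operator, whence a maximum principle and solvability for this
   operator.  By linearity y splits into a homogeneous and an inhomogeneous part.

   Homogeneous part: in balanced coordinates Theta_1 satisfies the reduced dual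
   Lyapunov inequality, so that for every eps > 0 the error system, damped by
   eps, has an observability Gramian Q_e.  Young's inequality applied to the
   terms u_k x^T Q_e N_k x and Gronwall's lemma bound the output error by
   tr(X_e^T Q_e X_e), which is at most tr(Theta_2 W) + O(eps).

   Inhomogeneous part: the values of sigma are removed one level at a time.
   If xi and eta are the trajectories before and after removal of the level s,
   the energy x_-^T Sigma x_- + s^2 x_+^T Sigma^-1 x_+, with x_- and x_+ the
   difference and the sum of their dynamic components, gives the L2 bound
   2 s |u| for this step; the steps are added by Minkowski's inequality.
   The singular perturbation approximation exists at each intermediate step
   because A_JJ is invertible whenever sigma separates J from its complement. *)

Require Import Defs.
From HB Require Import structures.
From mathcomp Require Import all_boot all_order all_algebra.
From mathcomp Require Import all_classical all_reals all_analysis.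
From mathcomp.real_closed Require Import complex mxtens.
From mathcomp Require Import measurable_realfun ring lra.

Set Implicit Arguments.
Unset Strict Implicit.
Unset Printing Implicit Defensive.

Import Order.TTheory GRing.Theory Num.Theory.
Import numFieldNormedType.Exports.

Local Open Scope classical_set_scope.
Local Open Scope ring_scope.

(** * Quadratic forms *)

Section QuadraticForms.
Context {R : realType}.

(** The limit eps -> 0 is taken on a fixed interval [0, T], and only then does T grow, so that a
    factor exp(eps T) is harmless. The weight in Young's inequality is dictated by the factor
    gamma^-2 of the Lyapunov operator and leaves gamma^2 |u|^2 to Gronwall; the exponent 1/2 comes
    from the final square root. Components of u with N_k = 0 drop out of the bilinear terms, whence
    u^0. For the inhomogeneous part all reduced states are kept in coordinates of size n, with a set
    J of eliminated indices. Under SPA the eliminated components depend directly on the control and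
    need not be absolutely continuous; hence the energy sees only the dynamic components, while the
    Lyapunov relations are evaluated at the full difference and sum. *)

Definition bf n (M : 'M[R]_n) (v w : 'cV[R]_n) : R :=
  (v^T *m M *m w) ord0 ord0.

Definition sqn n (v : 'cV[R]_n) : R := \sum_i v i ord0 ^+ 2.

Definition norm1 a b (X : 'M[R]_(a, b)) := \sum_i \sum_j `|X i j|.

Lemma norm1_ge0 a b (X : 'M[R]_(a, b)) : 0 <= norm1 X.
Proof. by apply: sumr_ge0 => i _; apply: sumr_ge0. Qed.

Section Forms.
Context {n : nat}.
Implicit Types (M : 'M[R]_n) (v w : 'cV[R]_n).

Lemma bfE M v w : bf M v w = \sum_i \sum_j v i ord0 * M i j * w j ord0.
Proof.
rewrite /bf mxE exchange_big /=; apply: eq_bigr => j _.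
by rewrite mxE big_distrl /=; apply: eq_bigr => i _; rewrite !mxE.
Qed.

Lemma bfDl M v v' w : bf M (v + v') w = bf M v w + bf M v' w.
Proof. by rewrite /bf raddfD /= !mulmxDl mxE. Qed.

Lemma bfDr M v w w' : bf M v (w + w') = bf M v w + bf M v w'.
Proof. by rewrite /bf mulmxDr mxE. Qed.

Lemma bfZl M a v w : bf M (a *: v) w = a * bf M v w.
Proof. by rewrite /bf linearZ /= -!scalemxAl mxE. Qed.

Lemma bfZr M a v w : bf M v (a *: w) = a * bf M v w.
Proof. by rewrite /bf -scalemxAr mxE. Qed.

Lemma bfNl M v w : bf M (- v) w = - bf M v w.
Proof. by rewrite -scaleN1r bfZl mulN1r. Qed.

Lemma bfNr M v w : bf M v (- w) = - bf M v w.
Proof. by rewrite -scaleN1r bfZr mulN1r. Qed.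

Lemma bf0l M w : bf M 0 w = 0.
Proof. by rewrite /bf trmx0 !mul0mx mxE. Qed.

Lemma bf0r M v : bf M v 0 = 0.
Proof. by rewrite /bf mulmx0 mxE. Qed.

Lemma bf_sumr I (s : seq I) (P : pred I) M v (w : I -> 'cV[R]_n) :
  bf M v (\sum_(i <- s | P i) w i) = \sum_(i <- s | P i) bf M v (w i).
Proof. by apply: (big_morph (bf M v)) => [x y|]; rewrite ?bfDr ?bf0r. Qed.

Lemma bfDm M M' v w : bf (M + M') v w = bf M v w + bf M' v w.
Proof. by rewrite /bf mulmxDr mulmxDl mxE. Qed.

Lemma bfZm a M v w : bf (a *: M) v w = a * bf M v w.
Proof. by rewrite /bf -scalemxAr -scalemxAl mxE. Qed.

Lemma bfNm M v w : bf (- M) v w = - bf M v w.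
Proof. by rewrite -scaleN1r bfZm mulN1r. Qed.

Lemma bf0m v w : bf (0 : 'M[R]_n) v w = 0.
Proof. by rewrite /bf mulmx0 mul0mx mxE. Qed.

Lemma bf_summ I (s : seq I) (P : pred I) (M : I -> 'M[R]_n) v w :
  bf (\sum_(i <- s | P i) M i) v w = \sum_(i <- s | P i) bf (M i) v w.
Proof.
by apply: (big_morph (fun M => bf M v w)) => [x y|]; rewrite ?bfDm ?bf0m.
Qed.

Lemma bf_mulr M (A : 'M[R]_n) v w : bf (M *m A) v w = bf M v (A *m w).
Proof. by rewrite /bf !mulmxA. Qed.

Lemma bf_mull M (A : 'M[R]_n) v w : bf (A^T *m M) v w = bf M (A *m v) w.
Proof. by rewrite /bf trmx_mul !mulmxA. Qed.

Lemma bf_sym M v w : M^T = M -> bf M v w = bf M w v.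
Proof.
move=> sM; rewrite !bfE exchange_big /=; apply: eq_bigr => i _.
apply: eq_bigr => j _; rewrite -{1}sM mxE; ring.
Qed.

Lemma bf1 v : bf 1%:M v v = sqn v.
Proof. by rewrite /bf mulmx1 mxE; apply: eq_bigr => i _; rewrite !mxE -expr2. Qed.

Lemma bf_diag (d : 'rV[R]_n) v w :
  bf (diag_mx d) v w = \sum_i d ord0 i * v i ord0 * w i ord0.
Proof.
rewrite bfE; apply: eq_bigr => i _.
rewrite (bigD1 i) //= big1 ?addr0 => [|j ji]; rewrite mxE ?eqxx.
  by rewrite mulr1n; ring.
by rewrite eq_sym (negbTE ji) mulr0n mulr0 mul0r.
Qed.

Lemma sqn_ge0 v : 0 <= sqn v.
Proof. by apply: sumr_ge0 => i _; exact: sqr_ge0. Qed.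

Lemma sqn_eq0 v : (sqn v == 0) = (v == 0).
Proof.
apply/idP/eqP => [|->]; last by rewrite /sqn big1 // => i _; rewrite mxE expr0n.
rewrite psumr_eq0 => [|i _]; last exact: sqr_ge0.
move=> /allP h; apply/matrixP => i j; rewrite ord1 mxE.
by have := h i (mem_index_enum _); rewrite /= sqrf_eq0 => /eqP.
Qed.

Lemma sqn_gt0 v : v != 0 -> 0 < sqn v.
Proof. by move=> v0; rewrite lt_def sqn_eq0 v0 sqn_ge0. Qed.

Lemma bf_delta M i j : bf M (delta_mx i ord0) (delta_mx j ord0) = M i j.
Proof.
rewrite bfE (bigD1 i) //= (bigD1 j) //= !big1 ?addr0.
- by rewrite !mxE !eqxx mul1r mulr1.
- by move=> k ki; rewrite big1 // => l _; rewrite !mxE (negbTE ki) !mul0r.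
- by move=> k kj; rewrite !mxE (negbTE kj) mulr0.
Qed.

Lemma sym_bf_eq0 M : M^T = M -> (forall v, bf M v v = 0) -> M = 0.
Proof.
move=> sM h; apply/matrixP => i j; rewrite mxE -bf_delta.
set v := delta_mx i ord0; set w := delta_mx j ord0.
have := h (v + w); rewrite bfDl !bfDr !h (bf_sym w v sM) add0r addr0; lra.
Qed.

Lemma psd_bf M v : psd M -> 0 <= bf M v v.
Proof. by case=> _; exact. Qed.

Lemma posdef_psd M : posdef M -> psd M.
Proof.
case=> sM h; split=> // v; have [->|/h/ltW//] := eqVneq v 0.
by rewrite mulmx0 mxE.
Qed.

Lemma psd0 : psd (0 : 'M[R]_n).
Proof. by split=> [|v]; rewrite ?trmx0 // -/(bf _ _ _) bf0m. Qed.

Lemma psdD M M' : psd M -> psd M' -> psd (M + M').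
Proof.
move=> [sM h] [sM' h']; split=> [|v]; first by rewrite raddfD /= sM sM'.
by rewrite -/(bf _ _ _) bfDm addr_ge0 //; [exact: h|exact: h'].
Qed.

Lemma psdZ a M : 0 <= a -> psd M -> psd (a *: M).
Proof.
move=> a0 [sM h]; split=> [|v]; first by rewrite linearZ /= sM.
by rewrite -/(bf _ _ _) bfZm mulr_ge0 //; exact: h.
Qed.

Lemma psd_sum I (s : seq I) (P : pred I) (M : I -> 'M[R]_n) :
  (forall i, P i -> psd (M i)) -> psd (\sum_(i <- s | P i) M i).
Proof. by move=> h; apply: big_ind => //; [exact: psd0|exact: psdD]. Qed.

Lemma posdefD M M' : posdef M -> psd M' -> posdef (M + M').
Proof.
move=> [sM h] [sM' h']; split=> [|v v0]; first by rewrite raddfD /= sM sM'.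
by rewrite -/(bf _ _ _) bfDm ltr_wpDr //; [exact: h'|exact: h].
Qed.

Lemma posdefZ a M : 0 < a -> posdef M -> posdef (a *: M).
Proof.
move=> a0 [sM h]; split=> [|v v0]; first by rewrite linearZ /= sM.
by rewrite -/(bf _ _ _) bfZm mulr_gt0 //; exact: h.
Qed.

Lemma posdef1 : posdef (1%:M : 'M[R]_n).
Proof.
by split=> [|v v0]; rewrite ?trmx1 // -/(bf _ _ _) bf1 sqn_gt0.
Qed.

(** Discriminant argument for the polynomial t -> bf M (v + t w) (v + t w), which is nonnegative.
    The case of a vanishing leading coefficient is separate because [M] is only semidefinite. *)
Lemma psd_cauchy_schwarz M v w :
  psd M -> bf M v w ^+ 2 <= bf M v v * bf M w w.
Proof.
move=> pM; have sM := pM.1.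
set a := bf M v v; set b := bf M v w; set c := bf M w w.
have a0 : 0 <= a := psd_bf v pM.
have c0 : 0 <= c := psd_bf w pM.
have q t : 0 <= a + 2 * t * b + t ^+ 2 * c.
  have := psd_bf (v + t *: w) pM.
  rewrite bfDl !bfDr !bfZl !bfZr (bf_sym w v sM) -/a -/b -/c.
  by congr (_ <= _); ring.
have [c_eq|c_neq] := eqVneq c 0.
  have [->|b0] := eqVneq b 0; first by rewrite expr0n mulr_ge0.
  (* With c = 0 the polynomial is affine in t, and this t gives it the value -1. *)
  have := q (- (a + 1) / (2 * b)); rewrite c_eq mulr0 addr0.
  have -> : 2 * (- (a + 1) / (2 * b)) * b = - (a + 1) by field.
  by rewrite opprD addrA subrr add0r oppr_ge0 ler10.
have cpos : 0 < c by rewrite lt_def c_neq.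
have := q (- b / c).
have -> : a + 2 * (- b / c) * b + (- b / c) ^+ 2 * c = a - b ^+ 2 / c by field.
by rewrite subr_ge0 ler_pdivrMr.
Qed.

(** Cauchy-Schwarz against each basis vector makes every entry of M v vanish. *)
Lemma psd_kernel M v : psd M -> bf M v v = 0 -> M *m v = 0.
Proof.
move=> pM h; apply/matrixP => i j; rewrite ord1 mxE.
have := psd_cauchy_schwarz (delta_mx i ord0) v pM.
rewrite h mulr0 => le0; have /eqP : bf M (delta_mx i ord0) v == 0.
  by rewrite -sqrf_eq0 eq_le le0 sqr_ge0.
rewrite mxE => h0; apply: (etrans _ h0); rewrite bfE [RHS](bigD1 i) //=.
rewrite [X in _ = _ + X]big1 ?addr0.
  by apply: eq_bigr => k _; rewrite mxE !eqxx mul1r.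
by move=> k ki; rewrite big1 // => l _; rewrite mxE (negbTE ki) !mul0r.
Qed.

Lemma bf_le_norm1 M v : `|bf M v v| <= norm1 M * sqn v.
Proof.
have vb i : `|v i ord0| ^+ 2 <= sqn v.
  rewrite real_normK ?num_real // /sqn (bigD1 i) //= lerDl.
  by apply: sumr_ge0 => *; exact: sqr_ge0.
rewrite bfE big_distrl /=; apply: le_trans (ler_norm_sum _ _ _) _.
apply: ler_sum => i _; rewrite big_distrl /=.
apply: le_trans (ler_norm_sum _ _ _) _; apply: ler_sum => j _.
have -> : `|v i ord0 * M i j * v j ord0|
          = `|M i j| * (`|v i ord0| * `|v j ord0|) by rewrite !normrM; ring.
apply: ler_wpM2l => //; have := vb i; have := vb j.
have := sqr_ge0 (`|v i ord0| - `|v j ord0|); nra.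
Qed.

Lemma bf_bound M : exists2 K, 0 <= K & forall v, `|bf M v v| <= K * sqn v.
Proof. by exists (norm1 M); [exact: norm1_ge0|exact: bf_le_norm1]. Qed.

Lemma inj_unitmx M : (forall v : 'cV[R]_n, M *m v = 0 -> v = 0) -> M \in unitmx.
Proof.
move=> h; rewrite -unitmx_tr -row_free_unit -kermx_eq0.
apply/eqP/row_matrixP => i; rewrite row0.
have kv : M *m (row i (kermx M^T))^T = 0.
  by rewrite -[X in X *m _]trmxK -trmx_mul -row_mul mulmx_ker row0 trmx0.
by apply: trmx_inj; rewrite (h _ kv) trmx0.
Qed.

Lemma posdef_unit M : posdef M -> M \in unitmx.
Proof.
move=> [sM h]; apply: inj_unitmx => v Mv; apply/eqP; apply: contraT => /h.
by rewrite -mulmxA Mv mulmx0 mxE ltxx.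
Qed.

Lemma posdef_inv M : posdef M -> posdef (invmx M).
Proof.
move=> pM; have [sM h] := pM; have uM := posdef_unit pM.
split=> [|v v0]; first by rewrite trmx_inv sM.
have w0 : invmx M *m v != 0.
  apply: contraNneq v0 => e.
  by rewrite -[v]mul1mx -(mulmxV uM) -mulmxA e mulmx0.
have := h _ w0; rewrite trmx_mul trmx_inv sM -mulmxA.
by rewrite (mulmxA M) (mulmxV uM) mul1mx.
Qed.

(* Cauchy-Schwarz for M, applied to v and M^-1 v. *)
Lemma posdef_coercive M :
  posdef M -> exists2 c, 0 < c & forall v, c * sqn v <= bf M v v.
Proof.
move=> pM; have uM := posdef_unit pM; have pI := posdef_inv pM.
have [K K0 hK] := bf_bound (invmx M).
exists (K + 1)^-1; first by rewrite invr_gt0; lra.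
move=> v; have [->|v0] := eqVneq v 0.
  by rewrite bf0l /sqn big1 ?mulr0 // => i _; rewrite mxE expr0n.
have sv := sqn_gt0 v0.
have cs := psd_cauchy_schwarz v (invmx M *m v) (posdef_psd pM).
have e1 : bf M v (invmx M *m v) = sqn v.
  by rewrite -bf_mulr mulmxV // bf1.
have e2 : bf M (invmx M *m v) (invmx M *m v) = bf (invmx M) v v.
  by rewrite -bf_mulr mulmxV // /bf trmx_mul pI.1 mulmx1.
rewrite e1 e2 in cs; rewrite mulrC ler_pdivrMr; last by lra.
have b0 := psd_bf v (posdef_psd pM).
have hv := le_trans (ler_norm _) (hK v).
rewrite -(ler_pM2r sv) -expr2; apply: le_trans cs _; nra.
Qed.

(** Coercivity of [M] against the entrywise bound on [X]; it plays the part of compactness of the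
    unit sphere in [lyapd_max]. *)
Lemma posdef_dominates M X :
  posdef M -> exists2 K, 0 < K & forall v, bf X v v <= K * bf M v v.
Proof.
move=> pM; have [c c0 hc] := posdef_coercive pM.
have [K K0 hK] := bf_bound X; exists ((K + 1) / c); first by rewrite divr_gt0 //; lra.
move=> v; apply: le_trans (ler_norm _) _; apply: le_trans (hK v) _.
have := sqn_ge0 v => s0; rewrite mulrAC ler_pdivlMr //.
have := hc v; have := psd_bf v (posdef_psd pM); nra.
Qed.

End Forms.

Lemma psd_congr n k (M : 'M[R]_n) (T : 'M[R]_(n, k)) :
  psd M -> psd (T^T *m M *m T).
Proof.
move=> [sM h]; split=> [|v]; first by rewrite !trmx_mul trmxK sM mulmxA.
by have := h (T *m v); rewrite trmx_mul !mulmxA.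
Qed.

Lemma posdef_congr n (M T : 'M[R]_n) :
  T \in unitmx -> posdef M -> posdef (T^T *m M *m T).
Proof.
move=> uT [sM h]; split=> [|v v0]; first by rewrite !trmx_mul trmxK sM mulmxA.
have := h (T *m v); rewrite trmx_mul !mulmxA; apply.
by apply: contraNneq v0 => e; rewrite -[v]mul1mx -(mulVmx uT) -mulmxA e mulmx0.
Qed.

Lemma psd_gram n p (C : 'M[R]_(p, n)) : psd (C^T *m C).
Proof. by have := psd_congr C (posdef_psd posdef1); rewrite mulmx1. Qed.

Lemma bf_gram n p (C : 'M[R]_(p, n)) (v : 'cV[R]_n) :
  bf (C^T *m C) v v = sqn (C *m v).
Proof. by rewrite -bf1 /bf trmx_mul !mulmxA mulmx1. Qed.

End QuadraticForms.

(** * Lyapunov operators *)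

(** Turns uniqueness for a Lyapunov equation into solvability: through [mxvec] the operator is a
    square matrix with trivial kernel. *)
Lemma linear_inj_surj (R : fieldType) a b (f : 'M[R]_(a, b) -> 'M[R]_(a, b)) :
  linear f -> (forall X, f X = 0 -> X = 0) -> forall M, exists X, f X = M.
Proof.
move=> fL inj M.
pose F : {linear 'M[R]_(a, b) -> 'M[R]_(a, b)} :=
  HB.pack f (GRing.isLinear.Build _ _ _ _ f fL).
have fF X : mxvec (f X) = mxvec X *m lin_mx F by rewrite (mul_vec_lin F).
have uF : lin_mx F \in unitmx.
  rewrite -row_free_unit -kermx_eq0; apply/eqP/row_matrixP => i; rewrite row0.
  set v := row i _; have kv : v *m lin_mx F = 0.
    by rewrite -row_mul mulmx_ker row0.
  have : f (vec_mx v) = 0.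
    by apply: (can_inj mxvecK); rewrite fF vec_mxK kv linear0.
  by move=> /inj e; rewrite -(vec_mxK v) e linear0.
exists (vec_mx (mxvec M *m invmx (lin_mx F))).
by apply: (can_inj mxvecK); rewrite fF vec_mxK mulmxKV.
Qed.

Section DualLyapunov.
Context {R : realType}.

(* g plays the role of gamma^-2. *)
Definition lyapd n m (g : R) (A : 'M[R]_n) (N : 'I_m -> 'M[R]_n) (X : 'M[R]_n) :
  'M[R]_n :=
  A^T *m X + X *m A + g *: \sum_k (N k)^T *m X *m N k.

Section Operator.
Context {n m : nat} (g : R) (A : 'M[R]_n) (N : 'I_m -> 'M[R]_n).
Local Notation L := (lyapd g A N).

Lemma lyapdD X Y : L (X + Y) = L X + L Y.
Proof.
rewrite /lyapd mulmxDr mulmxDl.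
have -> : \sum_k (N k)^T *m (X + Y) *m N k =
          \sum_k (N k)^T *m X *m N k + \sum_k (N k)^T *m Y *m N k.
  by rewrite -big_split; apply: eq_bigr => k _; rewrite /= mulmxDr mulmxDl.
by rewrite scalerDr (addrACA (A^T *m X)) [RHS]addrACA.
Qed.

Lemma lyapdZ a X : L (a *: X) = a *: L X.
Proof.
rewrite /lyapd -scalemxAr -scalemxAl !scalerDr; congr (_ + _).
rewrite scalerA mulrC -scalerA; congr (_ *: _); rewrite scaler_sumr.
by apply: eq_bigr => k _; rewrite -scalemxAr -scalemxAl.
Qed.

Lemma lyapdN X : L (- X) = - L X.
Proof. by rewrite -scaleN1r lyapdZ scaleN1r. Qed.

Lemma lyapd_tr X : (L X)^T = L X^T.
Proof.
rewrite /lyapd !raddfD /= !trmx_mul trmxK [X in X + _]addrC; congr (_ + _).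
rewrite linearZ /= linear_sum; congr (_ *: _); apply: eq_bigr => k _.
by rewrite /= !trmx_mul trmxK mulmxA.
Qed.

Lemma bf_lyapd X v : X^T = X ->
  bf (L X) v v = 2 * bf X v (A *m v) + g * \sum_k bf X (N k *m v) (N k *m v).
Proof.
move=> sX; rewrite !bfDm bfZm bf_summ bf_mull bf_mulr bf_sym //.
rewrite mulr2n mulrDl !mul1r; congr (_ + _ * _).
by apply: eq_bigr => k _; rewrite bf_mulr bf_mull.
Qed.

Hypothesis g0 : 0 <= g.

(** On a kernel vector of X the drift terms vanish and only the nonnegative N_k terms remain. This
    positivity drives the maximum principle, the stability criterion and the first-contact
    argument. *)
Lemma lyapd_kernel_ge0 X v : psd X -> X *m v = 0 -> 0 <= bf (L X) v v.
Proof.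
move=> pX kX; rewrite bf_lyapd ?pX.1 // bf_sym ?pX.1 // {1}/bf -mulmxA kX.
rewrite mulmx0 mxE mulr0 add0r mulr_ge0 // sumr_ge0 // => k _.
exact: psd_bf.
Qed.

(* At the smallest t >= 0 for which X + t H is positive semidefinite, a
   kernel vector of X + t H contradicts the strict inequality. *)
Lemma lyapd_max H X : posdef H -> posdef (- L H) ->
  X^T = X -> psd (- L X) -> psd X.
Proof.
move=> pH pLH sX pLX; have psH := posdef_psd pH; have sH := pH.1.
pose S := [set t | 0 <= t /\ forall v, 0 <= bf X v v + t * bf H v v].
have [K K0 hK] := posdef_dominates (- X) pH.
have SK : S K by split=> [|v]; [exact: ltW|have := hK v; rewrite bfNm; lra].
have lbS : lbound S 0 by move=> t [].
have iS : has_inf S by split; [exists K|exists 0].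
set t0 := inf S.
have t00 : 0 <= t0 by apply: lb_le_inf => //; exists K.
have St0 : S t0.
  split=> // v; have [h0|h0] := eqVneq (bf H v v) 0.
    by have := SK.2 v; rewrite h0 !mulr0.
  have hpos : 0 < bf H v v by rewrite lt_def h0 psd_bf.
  suff : - bf X v v / bf H v v <= t0 by rewrite ler_pdivrMr //; lra.
  apply: lb_le_inf; first by exists K.
  by move=> t [_ /(_ v)]; rewrite ler_pdivrMr //; lra.
have [t0_eq|t0_neq] := eqVneq t0 0.
  by split=> // v; have := St0.2 v; rewrite t0_eq mul0r addr0.
have t0_gt : 0 < t0 by rewrite lt_def t0_neq.
pose M := X + t0 *: H.
have sM : M^T = M by rewrite raddfD /= linearZ /= sX sH.
have pM : psd M by split=> // v; have := St0.2 v; rewrite -bfZm -bfDm.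
have pdM : posdef M.
  split=> // v v0; rewrite lt_def psd_bf // andbT; apply/eqP => bM.
  have kM := psd_kernel pM bM.
  have := lyapd_kernel_ge0 pM kM.
  rewrite lyapdD lyapdZ bfDm bfZm.
  have := psd_bf v pLX; have : 0 < bf (- L H) v v by exact: pLH.2.
  rewrite !bfNm => hH hX; have := mulr_gt0 t0_gt hH; lra.
have [K' K'0 hK'] := posdef_dominates H pdM.
(* Since [M] is positive definite and t0 > 0, t0 can still be lowered: d K' <= 1 keeps M - d H
   semidefinite. *)
pose d := Num.min K'^-1 t0.
have d0 : 0 < d by rewrite lt_min invr_gt0 K'0.
have dK : d * K' <= 1 by rewrite -ler_pdivlMr // div1r ge_min lexx.
have dt : d <= t0 by rewrite ge_min lexx orbT.
have : S (t0 - d).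
  split=> [|v]; first by rewrite subr_ge0.
  have := hK' v; have := psd_bf v pM; have := psd_bf v psH.
  rewrite bfDm bfZm; nra.
by move=> /(ge_inf iS.2); rewrite -/t0; lra.
Qed.

(** The maximum principle for X and for -X. *)
Lemma lyapd_inj H X : posdef H -> posdef (- L H) -> X^T = X -> L X = 0 -> X = 0.
Proof.
move=> pH pLH sX LX; have p1 : psd X.
  by apply: (lyapd_max pH) => //; rewrite LX oppr0; exact: psd0.
have p2 : psd (- X).
  apply: (lyapd_max pH) => //; first by rewrite raddfN /= sX.
  by rewrite lyapdN LX !oppr0; exact: psd0.
apply: sym_bf_eq0 => // v; apply/eqP; rewrite eq_le psd_bf // andbT.
by have := psd_bf v p2; rewrite bfNm; lra.
Qed.

Lemma lyapd_solve H M : posdef H -> posdef (- L H) -> psd M ->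
  exists2 X, psd X & L X = - M.
Proof.
move=> pH pLH pM.
(* [lyapd_inj] covers symmetric matrices only. Adding X - X^T to the value at the symmetric part
   gives an operator injective on all matrices, and its symmetric part is still given by [L]. *)
pose f (X : 'M[R]_n) := L (2^-1 *: (X + X^T)) + (X - X^T).
have fL : linear f.
  move=> a X Y; rewrite /f.
  have -> : 2^-1 *: (a *: X + Y + (a *: X + Y)^T) =
            a *: (2^-1 *: (X + X^T)) + 2^-1 *: (Y + Y^T).
    by apply/matrixP => i j; rewrite !mxE; ring.
  rewrite lyapdD lyapdZ; move: (L _) (L _) => U V.
  by apply/matrixP => i j; rewrite !mxE; ring.
have s2 (X : 'M[R]_n) : (2^-1 *: (X + X^T))^T = 2^-1 *: (X + X^T).
  by rewrite linearZ /= raddfD /= trmxK addrC.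
have sf (X : 'M[R]_n) : (f X + (f X)^T) = 2 *: L (2^-1 *: (X + X^T)).
  rewrite /f [(L _ + _)^T]raddfD /= lyapd_tr s2 raddfB /= trmxK.
  by move: (L _) => U; apply/matrixP => i j; rewrite !mxE; ring.
have half (U V : 'M[R]_n) : U + U = 2 *: V -> V = U.
  move=> e; apply/matrixP => i j; move/matrixP/(_ i j): e.
  by rewrite !mxE; lra.
have finj (X : 'M[R]_n) : f X = 0 -> X = 0.
  move=> fX; have := sf X; rewrite fX trmx0 => /half LX.
  have S0 := lyapd_inj pH pLH (s2 X) LX.
  have := fX; rewrite /f LX add0r => D0.
  apply/matrixP => i j; move/matrixP/(_ i j): S0; move/matrixP/(_ i j): D0.
  by rewrite !mxE; lra.
have [X fX] := linear_inj_surj fL finj (- M).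
have LX : L (2^-1 *: (X + X^T)) = - M.
  by apply: half; rewrite -sf fX raddfN /= pM.1.
exists (2^-1 *: (X + X^T)) => //.
by apply: (lyapd_max pH) => //; rewrite LX opprK.
Qed.

End Operator.

(** Damping A by s/2 shifts the operator by -s, so the results on [lyapd] apply to its resolvent. *)
Lemma lyapd_shift n m (g s : R) (A : 'M[R]_n) (N : 'I_m -> 'M[R]_n) X :
  lyapd g (A - (s / 2)%:M) N X = lyapd g A N X - s *: X.
Proof.
rewrite /lyapd [RHS]addrAC; congr (_ + _).
rewrite [(_ - _)^T]raddfB /= tr_scalar_mx mulmxBl.
rewrite mulmxBr mul_scalar_mx mul_mx_scalar.
by apply/matrixP => i j; rewrite !mxE; lra.
Qed.

(** Acting on row vectors, the Kronecker matrix is the dual operator, and [eigenvalue] refers to row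
    eigenvectors; the spectral condition thus reaches [lyapd] without a transposition. *)
Lemma kron_op_vec n m (gamma : R) (A X : 'M[R]_n) (N : 'I_m -> 'M[R]_n) i j :
  \sum_k \sum_l X k l * kron_op gamma A N (mxtens_index (k, l)) (mxtens_index (i, j))
  = lyapd (gamma ^+ 2)^-1 A N X i j.
Proof.
have tE (U V : 'M[R]_n) : \sum_k \sum_l X k l * tensmx U V (mxtens_index (k, l))
    (mxtens_index (i, j)) = (U^T *m X *m V) i j.
  rewrite mxE exchange_big /=; apply: eq_bigr => l _.
  rewrite mxE big_distrl /=; apply: eq_bigr => k _.
  by rewrite tensmxE mxE; ring.
have e k l : X k l * kron_op gamma A N (mxtens_index (k, l)) (mxtens_index (i, j)) =
   X k l * tensmx A 1%:M (mxtens_index (k, l)) (mxtens_index (i, j)) +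
   X k l * tensmx 1%:M A (mxtens_index (k, l)) (mxtens_index (i, j)) +
   (gamma ^+ 2)^-1 * \sum_h X k l * tensmx (N h) (N h) (mxtens_index (k, l)) (mxtens_index (i, j)).
  rewrite /kron_op !mxE summxE !mulrDr -mulr_sumr; ring.
under eq_bigr => k _ do (under eq_bigr => l _ do rewrite e; rewrite !big_split -mulr_sumr /=).
rewrite !big_split -mulr_sumr /= !tE trmx1 mul1mx mulmx1.
rewrite /lyapd !mxE; congr (_ + _ * _); rewrite summxE.
under eq_bigr => k _ do rewrite exchange_big /=.
by rewrite exchange_big /=; apply: eq_bigr => h _; rewrite tE.
Qed.

(** A nonzero X, vectorised, would be an eigenvector for the real number s >= 0, outside the open
    left half-plane. *)
Lemma kron_no_nonneg_eigenvalue n m (gamma s : R) (A X : 'M[R]_n) (N : 'I_m -> 'M[R]_n) :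
  spectrum (kron_op gamma A N) `<=` open_left_half_plane -> 0 <= s ->
  lyapd (gamma ^+ 2)^-1 A N X = s *: X -> X = 0.
Proof.
move=> sp s0 e; apply/eqP; apply: contraT => X0.
pose v : 'rV[R]_(n * n) := \row_c X (mxtens_unindex c).1 (mxtens_unindex c).2.
have ve : v *m kron_op gamma A N = s *: v.
  apply/matrixP => i0 c; case: (mxtens_indexP c) => i j.
  rewrite !mxE mxtens_indexK /=.
  have -> : s * X i j = (s *: X) i j by rewrite mxE.
  rewrite -e -kron_op_vec pair_big /=.
  rewrite (reindex (@mxtens_unindex n n)) /=; last first.
    by exists (@mxtens_index n n) => x _; rewrite ?mxtens_unindexK ?mxtens_indexK.
  by apply: eq_bigr => d _; rewrite mxE mxtens_unindexK.
have v0 : v != 0.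
  apply: contraNneq X0 => v0; apply/eqP/matrixP => i j.
  by move/matrixP/(_ ord0 (mxtens_index (i, j))): v0; rewrite !mxE mxtens_indexK.
have : spectrum (kron_op gamma A N) (real_complex R s).
  apply/eigenvalueP; exists (map_mx (real_complex R) v).
    by rewrite -map_mxM ve map_mxZ.
  by rewrite map_mx_eq0.
by move=> /sp; rewrite /open_left_half_plane /= ltNge s0.
Qed.

(* The set of s >= 0 for which some H > 0 has lyapd H < s H is nonempty and
   closed, and open to the left because the resolvent is continuous. *)
Lemma kron_stable n m (gamma : R) (A : 'M[R]_n) (N : 'I_m -> 'M[R]_n) :
  spectrum (kron_op gamma A N) `<=` open_left_half_plane ->
  exists2 H, posdef H & lyapd (gamma ^+ 2)^-1 A N H = - 1%:M.
Proof.
move=> sp; set g := (gamma ^+ 2)^-1; pose L := lyapd g A N.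
have g0 : 0 <= g by rewrite invr_ge0 sqr_ge0.
pose S := [set s | 0 <= s /\ exists2 H, posdef H & posdef (- (L H - s *: H))].
have res s : 0 <= s -> exists2 X, X^T = X & L X - s *: X = - 1%:M.
  move=> s0; pose f (X : 'M[R]_n) := L X - s *: X.
  have fL : linear f.
    move=> a X Y; rewrite /f /L lyapdD lyapdZ; move: (lyapd _ _ _ _) (lyapd _ _ _ _) => U V.
    by apply/matrixP => i j; rewrite !mxE; ring.
  have finj (X : 'M[R]_n) : f X = 0 -> X = 0.
    by move=> /eqP; rewrite subr_eq0 => /eqP; exact: kron_no_nonneg_eigenvalue.
  have [X fX] := linear_inj_surj fL finj (- 1%:M); exists X => //.
  (* X^T solves the same equation, so symmetry of X follows from injectivity. *)
  apply/eqP; rewrite -subr_eq0; apply/eqP/finj.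
  rewrite /f /L lyapdD lyapdN -lyapd_tr.
  have := congr1 trmx fX; rewrite /f raddfB /= linearZ /= raddfN /= trmx1 -fX /f.
  rewrite /L; move: (lyapd _ _ _ _) => U /eqP; rewrite -subr_eq0 => /eqP eU.
  by rewrite -[RHS]eU; apply/matrixP => i j; rewrite !mxE; ring.
(* A certificate at s forces every symmetric solution of the strict inequality at the same s to be
   positive definite. It is applied to the resolvent solution taken at the infimum [s0], with a
   nearby s of [S]. *)
have pos s X : 0 <= s -> S s -> X^T = X -> posdef (- (L X - s *: X)) -> posdef X.
  move=> s0 [_ [H pH pLH]] sX pLX.
  rewrite -!lyapd_shift in pLH pLX.
  have pX := lyapd_max g0 pH pLH sX (posdef_psd pLX).
  split=> // v v0; rewrite lt_def psd_bf // andbT; apply/eqP => bX.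
  have := lyapd_kernel_ge0 (A - (s / 2)%:M) N g0 pX (psd_kernel pX bX).
  by have := pLX.2 v v0; rewrite -/(bf _ _ _) bfNm; lra.
have [K K0 hK] := bf_bound (L 1%:M).
have SK : S (K + 1).
  split; first lra.
  exists 1%:M; first exact: posdef1.
  split=> [|v v0]; first by rewrite raddfN raddfB /= lyapd_tr linearZ /= trmx1.
  rewrite -/(bf _ _ _) bfNm bfDm bfNm bfZm bf1.
  by have := hK v; have := sqn_gt0 v0; have := ler_norm (bf (L 1%:M) v v); nra.
have iS : has_inf S by split; [exists (K + 1)|exists 0 => t []].
have [s0 s0E] : {s0 | s0 = inf S} by exists (inf S).
have s00 : 0 <= s0 by rewrite s0E; apply: lb_le_inf; [exists (K + 1)|move=> t []].
have [X sX eX] := res _ s00.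
have [K' K'0 hK'] := bf_bound X.
have near_pos s : 0 <= s -> `|s - s0| * (K' + 1) < 1 ->
    posdef (- (L X - s *: X)).
  move=> s_ge0 hs; have -> : L X - s *: X = - 1%:M - (s - s0) *: X.
    rewrite -eX; move: (L X) => U; apply/matrixP => i j; rewrite !mxE; ring.
  rewrite opprD !opprK; split=> [|v v0].
    by rewrite raddfD /= trmx1 linearZ /= sX.
  rewrite -/(bf _ _ _) bfDm bfZm bf1.
  have : `|(s - s0) * bf X v v| <= `|s - s0| * (K' * sqn v).
    by rewrite normrM ler_wpM2l.
  have := ler_norm (- ((s - s0) * bf X v v)); rewrite normrN.
  have sv := sqn_gt0 v0; move: hs; rewrite -(ltr_pM2r sv) mul1r.
  have := mulr_ge0 (normr_ge0 (s - s0)) (ltW sv). nra.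
have e0 : 0 < (K' + 1)^-1 / 2 by rewrite divr_gt0 // invr_gt0; lra.
have eK : (K' + 1)^-1 / 2 * (K' + 1) = 2^-1 by field; rewrite gt_eqF //; lra.
have [s Ss ls] := inf_adherent e0 iS; rewrite -s0E in ls.
have ges : s0 <= s by rewrite s0E; apply: ge_inf => //; exact: iS.2.
have pX : posdef X.
  apply: (pos s) => //; first exact: Ss.1.
  apply: near_pos; first exact: Ss.1.
  rewrite ger0_norm ?subr_ge0 //; nra.
have [z|nz] := eqVneq s0 0.
  by exists X => //; rewrite -eX z scale0r subr0.
have s0_gt : 0 < s0 by rewrite lt_def nz.
(* The same X remains a strict certificate slightly below [s0], so a positive infimum is
   impossible. *)
pose d := Num.min ((K' + 1)^-1 / 2) s0.
have d0 : 0 < d by rewrite lt_min e0 s0_gt.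
have dle : d <= (K' + 1)^-1 / 2 by rewrite ge_min lexx.
have dt : d <= s0 by rewrite ge_min lexx orbT.
have : S (s0 - d).
  split; first by rewrite subr_ge0.
  exists X => //; apply: near_pos; first by rewrite subr_ge0.
  have -> : s0 - d - s0 = - d by ring.
  rewrite normrN gtr0_norm //; nra.
by move=> /(ge_inf iS.2); rewrite -s0E; lra.
Qed.

End DualLyapunov.

(** * Algebra of the reduced systems *)

Section ReducedAlgebra.
Context {R : realType}.

Lemma lyap_op_dual n m (gamma : R) (A : 'M[R]_n) (N : 'I_m -> 'M[R]_n) X :
  lyap_op gamma A^T A^T (fun k => (N k)^T) (fun k => (N k)^T) X
  = lyapd (gamma ^+ 2)^-1 A N X.
Proof.
rewrite /lyap_op /lyapd trmxK; congr (_ + _ *: _).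
by apply: eq_bigr => k _; rewrite trmxK.
Qed.

(** Adjointness for the trace pairing. The rectangular form with two coefficient families is what
    the mixed equations for [Y] and for the off-diagonal block of the error Gramian require. *)
Lemma lyap_op_pairing a b m (gamma : R) (A1 : 'M[R]_a) (A2 : 'M[R]_b)
    (N1 : 'I_m -> 'M[R]_a) (N2 : 'I_m -> 'M[R]_b) (Q Y : 'M[R]_(a, b)) :
  \tr (Q^T *m lyap_op gamma A1 A2 N1 N2 Y) =
  \tr ((A1^T *m Q + Q *m A2
        + (gamma ^+ 2)^-1 *: \sum_k (N1 k)^T *m Q *m N2 k)^T *m Y).
Proof.
rewrite /lyap_op !mulmxDr [(_ + _)^T]raddfD /= [(A1^T *m Q + _)^T]raddfD /= !mulmxDl.
rewrite !mxtraceD !trmx_mul trmxK; congr (_ + _ + _).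
- by rewrite mulmxA.
- by rewrite mulmxA mxtrace_mulC mulmxA.
rewrite [(_ *: _)^T]linearZ /= -scalemxAr -scalemxAl !mxtraceZ; congr (_ * _).
rewrite mulmx_sumr [(\sum_k _)^T]linear_sum /= mulmx_suml !linear_sum /=.
apply: eq_bigr => k _; rewrite !trmx_mul trmxK !mulmxA.
by rewrite [LHS]mxtrace_mulC !mulmxA.
Qed.

Lemma trace_congr a b (M : 'M[R]_a) (U : 'M[R]_(a, b)) :
  \tr (U^T *m M *m U) = \tr (M *m (U *m U^T)).
Proof. by rewrite -mulmxA mxtrace_mulC mulmxA. Qed.

Section Blocks.
Context {r s m p q : nat} (mth : method) (A : 'M[R]_(r + s)).
Context (N : 'I_m -> 'M[R]_(r + s)) (C : 'M[R]_(p, r + s)).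
Hypothesis adm : admissible mth A.

Local Notation bar := (bold_bar_A21 mth A).
Local Notation T := (col_mx 1%:M bar : 'M[R]_(r + s, r)).

(** [T] embeds a reduced state as (x1, bar x1): the plane x2 = 0 for BT, the graph of the static
    equation for SPA. Both reductions are the upper block of a restriction to this subspace. *)
Lemma red_A_lift : A *m T = col_mx (red_A mth A) (bold_A21 mth A).
Proof.
rewrite -{1}[A]submxK mul_block_col !mulmx1.
case: mth adm => /= [_|uA]; first by rewrite !mulmx0 !addr0.
by rewrite !mulmxN !mulmxA mulmxV // mul1mx subrr.
Qed.

Lemma red_N_lift k : N k *m T = col_mx (red_N mth A (N k)) (bold_N21 mth A (N k)).
Proof.
rewrite -{1}[N k]submxK mul_block_col !mulmx1.
by case: mth => /=; rewrite ?mulmx0 ?addr0 // !mulmxN !mulmxA.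
Qed.

Lemma red_C_lift : C *m T = red_C mth A C.
Proof.
rewrite -{1}[C]hsubmxK mul_row_col mulmx1.
by case: mth => /=; rewrite ?mulmx0 ?addr0 // !mulmxN !mulmxA.
Qed.

(** One of the two factors is zero for either method; this allows a single computation for BT and
    SPA. *)
Lemma bold_A21_bar (M : 'M[R]_s) : bar^T *m M *m bold_A21 mth A = 0.
Proof. by case: mth; rewrite /= ?mulmx0 // trmx0 !mul0mx. Qed.

Context (gamma : R) (Th1 : 'M[R]_r) (Th2 : 'M[R]_s).
Local Notation g := ((gamma ^+ 2)^-1).
Local Notation D := (block_mx Th1 0 0 Th2).
Local Notation At := (red_A mth A).
Local Notation Nt := (fun k => red_N mth A (N k)).
Local Notation Ct := (red_C mth A C).
Local Notation N21 k := (bold_N21 mth A (N k)).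
Hypotheses (sTh1 : Th1^T = Th1) (sTh2 : Th2^T = Th2).
Hypothesis eqD : lyapd g A N D = - (C^T *m C).

Lemma block_form_pair (a b : nat) (U1 : 'M[R]_(r, a)) (U2 : 'M[R]_(s, a))
    (V1 : 'M[R]_(r, b)) (V2 : 'M[R]_(s, b)) :
  (col_mx U1 U2)^T *m D *m col_mx V1 V2
  = U1^T *m Th1 *m V1 + U2^T *m Th2 *m V2.
Proof.
by rewrite tr_col_mx mul_row_block mul_row_col !mulmx0 add0r addr0.
Qed.

(** Compression of the equation for [D] by [T]: the drift terms through [Th2] vanish by
    [bold_A21_bar], and the N_k terms leave a defect in [Th2] alone, of a definite sign once [Th2]
    is semidefinite. *)
Lemma lyapd_reduced :
  lyapd g At Nt Th1 = - (Ct^T *m Ct) - g *: \sum_k (N21 k)^T *m Th2 *m N21 k.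
Proof.
have e : T^T *m lyapd g A N D *m T = - (Ct^T *m Ct).
  by rewrite eqD mulmxN mulNmx -red_C_lift trmx_mul !mulmxA.
rewrite -e /lyapd !mulmxDr !mulmxDl -scalemxAr -scalemxAl.
rewrite [T^T *m (A^T *m D)]mulmxA -trmx_mul red_A_lift block_form_pair mulmx1.
rewrite -[T^T *m (D *m A) *m T]mulmxA -[D *m A *m T]mulmxA red_A_lift.
rewrite [T^T *m (D *m _)]mulmxA block_form_pair trmx1 mul1mx bold_A21_bar addr0.
have -> : (bold_A21 mth A)^T *m Th2 *m bar = 0.
  by apply: trmx_inj; rewrite !trmx_mul trmxK sTh2 mulmxA bold_A21_bar trmx0.
rewrite addr0 -[RHS]addrA -scalerBr; congr (_ + _ *: _).
rewrite mulmx_sumr mulmx_suml -sumrB; apply: eq_bigr => k _.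
have -> : T^T *m ((N k)^T *m D *m N k) *m T = (N k *m T)^T *m D *m (N k *m T).
  by rewrite trmx_mul !mulmxA.
rewrite red_N_lift block_form_pair.
by rewrite addrK.
Qed.

Lemma trace_block_row (U : 'M[R]_(r + s, r)) (V : 'M[R]_(r + s, s)) :
  \tr (D *m row_mx U V) = \tr (Th1 *m usubmx U) + \tr (Th2 *m dsubmx V).
Proof.
rewrite -[U in LHS]vsubmxK -[V in LHS]vsubmxK -block_mxEh mulmx_block mxtrace_block.
by rewrite !mul0mx addr0 add0r.
Qed.

Lemma usubmx_mul (a b : nat) (U : 'M[R]_(r + s, a)) (V : 'M[R]_(a, b)) :
  usubmx (U *m V) = usubmx U *m V.
Proof. by rewrite -{1}[U]vsubmxK mul_col_mx col_mxKu. Qed.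

Lemma dsubmx_mul (a b : nat) (U : 'M[R]_(r + s, a)) (V : 'M[R]_(a, b)) :
  dsubmx (U *m V) = dsubmx U *m V.
Proof. by rewrite -{1}[U]vsubmxK mul_col_mx col_mxKd. Qed.

Context (X0 : 'M[R]_(r + s, q)) (Y : 'M[R]_(r + s, r)) (Pt : 'M[R]_r).
Local Notation Xt := (usubmx X0).
Hypothesis eqY : lyap_op gamma A At N Nt Y = - (X0 *m Xt^T).
Hypothesis eqPt : lyap_op gamma At At Nt Nt Pt = - (Xt *m Xt^T).

(** Since [Ct] is C T, this is the pairing of C^T C with V T^T; the equation for [D] and adjointness
    move the operator onto V T^T. *)
Lemma trace_output_pair (V : 'M[R]_(r + s, r)) :
  \tr (C *m V *m Ct^T) = - \tr (D *m lyap_op gamma A A N N (V *m T^T)).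
Proof.
have sD : D^T = D by rewrite tr_block_mx sTh1 sTh2 !trmx0.
rewrite -[X in X *m lyap_op _ _ _ _ _ _]sD lyap_op_pairing -/(lyapd g A N D).
rewrite eqD [(- _)^T]raddfN /= mulNmx raddfN opprK /= -red_C_lift !trmx_mul trmxK. 
by rewrite mulmxA mxtrace_mulC !mulmxA.
Qed.

(** The first block column is the mixed operator at V, known for V = Y from its equation; the second
    one produces the terms of the weight. *)
Lemma lyap_op_lift (V : 'M[R]_(r + s, r)) :
  lyap_op gamma A A N N (V *m T^T) =
  row_mx (lyap_op gamma A At N Nt V)
    (A *m V *m bar^T + V *m (bold_A21 mth A)^T
     + g *: \sum_k N k *m V *m (N21 k)^T).
Proof.
rewrite /lyap_op -!mulmxA -!trmx_mul red_A_lift.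
have -> : \sum_k N k *m (V *m T^T) *m (N k)^T =
   row_mx (\sum_k N k *m V *m (Nt k)^T) (\sum_k N k *m V *m (N21 k)^T).
  rewrite (eq_bigr (fun k => row_mx (N k *m V *m (Nt k)^T) (N k *m V *m (N21 k)^T))).
    by elim/big_rec3: _ => [|k a b c _ ->]; rewrite ?row_mx0 // add_row_mx.
  move=> k _; rewrite -!mulmxA -trmx_mul red_N_lift tr_col_mx.
  by rewrite !mul_mx_row.
rewrite !tr_col_mx trmx1 !mul_mx_row mulmx1 scale_row_mx !add_row_mx.
by rewrite !mulmxA.
Qed.

(** The left-hand side is the formal squared output error expressed through the full, mixed and
    reduced Gramians. The trace of Th1 Xt Xt^T enters with coefficients 1, -2 and 1 and cancels, so
    only [Th2] survives. *)
Lemma weight_trace :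
  \tr (X0^T *m D *m X0) - 2 * \tr (C *m Y *m Ct^T) + \tr (Ct *m Pt *m Ct^T)
  = \tr (Th2 *m weight mth gamma A N X0 Y Pt).
Proof.
rewrite trace_output_pair lyap_op_lift eqY.
have -> : \tr (Ct *m Pt *m Ct^T) = \tr (C *m (T *m Pt) *m Ct^T).
  by rewrite mulmxA red_C_lift.
rewrite trace_output_pair lyap_op_lift !trace_block_row.
have eU : usubmx (lyap_op gamma A At N Nt (T *m Pt)) = - (Xt *m Xt^T).
  rewrite -eqPt /lyap_op mulmxA red_A_lift.
  rewrite (eq_bigr (fun k => col_mx (Nt k *m Pt *m (Nt k)^T)
                                    (N21 k *m Pt *m (Nt k)^T))); last first.
    by move=> k _; rewrite mulmxA red_N_lift !mul_col_mx.
  rewrite !linearD linearZ /= linear_sum /= !mul_col_mx !col_mxKu mul1mx.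
  by congr (_ + _ *: _); apply: eq_bigr => k _; rewrite col_mxKu.
have eV : dsubmx (A *m (T *m Pt) *m bar^T + T *m Pt *m (bold_A21 mth A)^T
                  + g *: \sum_k N k *m (T *m Pt) *m (N21 k)^T)
          = g *: \sum_k N21 k *m Pt *m (N21 k)^T.
  rewrite mulmxA red_A_lift.
  rewrite (eq_bigr (fun k => col_mx (Nt k *m Pt *m (N21 k)^T)
                                    (N21 k *m Pt *m (N21 k)^T))); last first.
    by move=> k _; rewrite mulmxA red_N_lift !mul_col_mx.
  rewrite !linearD linearZ /= linear_sum /= !mul_col_mx !col_mxKd.
  have -> : bold_A21 mth A *m Pt *m bar^T = 0.
    by case: mth; rewrite /= ?trmx0 ?mulmx0 // !mul0mx.
  have -> : bar *m Pt *m (bold_A21 mth A)^T = 0.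
    by case: mth; rewrite /= ?trmx0 ?mulmx0 // !mul0mx.
  rewrite !add0r; congr (_ *: _); apply: eq_bigr => k _.
  by rewrite col_mxKd.
have eX : \tr (X0^T *m D *m X0) =
    \tr (Th1 *m (Xt *m Xt^T)) + \tr (Th2 *m (dsubmx X0 *m (dsubmx X0)^T)).
  rewrite -{1 2}[X0]vsubmxK block_form_pair mxtraceD.
  by rewrite !trace_congr.
have eK : dsubmx (A *m Y *m bar^T + Y *m (bold_A21 mth A)^T
                  + g *: \sum_k N k *m Y *m (N21 k)^T)
   = dsubmx A *m Y *m bar^T + dsubmx Y *m (bold_A21 mth A)^T
     + g *: \sum_k dsubmx (N k) *m Y *m (N21 k)^T.
  rewrite !linearD linearZ /= linear_sum /= !dsubmx_mul; congr (_ + _ *: _).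
  by apply: eq_bigr => k _; rewrite !dsubmx_mul.
have eU' : usubmx (- (X0 *m Xt^T)) = - (Xt *m Xt^T).
  by rewrite linearN /= usubmx_mul.
have trN n (M : 'M[R]_n) : \tr (- M) = - \tr M by exact: raddfN.
rewrite eU eU' eV eX eK !mulmxN !trN /weight sumrB scalerBr -scaler_sumr.
rewrite !mulmxDr mulmxN !mxtraceD trN -!scalemxAr !mxtraceZ.
ring.
Qed.

End Blocks.
End ReducedAlgebra.

(** * The error system *)

Section BlockForms.
Context {R : realType}.

Lemma bf_block n k (M11 : 'M[R]_n) (M12 : 'M[R]_(n, k)) (M21 : 'M[R]_(k, n))
    (M22 : 'M[R]_k) (v : 'cV[R]_(n + k)) :
  bf (block_mx M11 M12 M21 M22) v v =
  bf M11 (usubmx v) (usubmx v) + ((usubmx v)^T *m M12 *m dsubmx v) ord0 ord0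
  + (((dsubmx v)^T *m M21 *m usubmx v) ord0 ord0 + bf M22 (dsubmx v) (dsubmx v)).
Proof.
rewrite {1}/bf -[v in LHS]vsubmxK tr_col_mx mul_row_block mul_row_col !mulmxDl !mxE.
rewrite /bf !mxE; ring.
Qed.

Lemma bf_block_diag n k (M : 'M[R]_n) (M' : 'M[R]_k) v :
  bf (block_mx M 0 0 M') v v =
  bf M (usubmx v) (usubmx v) + bf M' (dsubmx v) (dsubmx v).
Proof. by rewrite bf_block !mulmx0 !mul0mx !mxE addr0 add0r. Qed.

Lemma psd_block_diag n k (M : 'M[R]_n) (M' : 'M[R]_k) :
  psd M -> psd M' -> psd (block_mx M 0 0 M').
Proof.
move=> pM pM'; split=> [|v]; first by rewrite tr_block_mx pM.1 pM'.1 !trmx0.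
by rewrite -/(bf _ _ _) bf_block_diag addr_ge0 // psd_bf.
Qed.

Lemma posdef_block_diag n k (M : 'M[R]_n) (M' : 'M[R]_k) :
  posdef M -> posdef M' -> posdef (block_mx M 0 0 M').
Proof.
move=> pM pM'; split=> [|v v0]; first by rewrite tr_block_mx pM.1 pM'.1 !trmx0.
rewrite -/(bf _ _ _) bf_block_diag.
have [u0|u0] := eqVneq (usubmx v) 0.
  have d0 : dsubmx v != 0.
    by apply: contraNneq v0 => d0; rewrite -[v]vsubmxK u0 d0 col_mx0.
  rewrite ltr_wpDl //; [by apply: psd_bf; exact: posdef_psd|exact: pM'.2].
rewrite ltr_wpDr //; [by apply: psd_bf; exact: posdef_psd|exact: pM.2].
Qed.

Lemma psd_diag_ge0 n (M : 'M[R]_n) i : psd M -> 0 <= M i i.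
Proof. by move=> pM; rewrite -bf_delta psd_bf. Qed.

Lemma psd_trace_ge0 n (M : 'M[R]_n) : psd M -> 0 <= \tr M.
Proof. by move=> pM; apply: sumr_ge0 => i _; exact: psd_diag_ge0. Qed.

Lemma psd_ulsubmx n k (M : 'M[R]_(n + k)) : psd M -> psd (ulsubmx M).
Proof.
move=> pM; have := psd_congr (col_mx 1%:M 0) pM.
rewrite -{1}[M]submxK tr_col_mx trmx1 trmx0 mul_row_block mul_row_col.
by rewrite !mul1mx !mul0mx !mulmx0 !mulmx1 !addr0.
Qed.

Lemma psd_drsubmx n k (M : 'M[R]_(n + k)) : psd M -> psd (drsubmx M).
Proof.
move=> pM; have := psd_congr (col_mx 0 1%:M) pM.
rewrite -{1}[M]submxK tr_col_mx trmx1 trmx0 mul_row_block mul_row_col.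
by rewrite !mul1mx !mul0mx !mulmx0 !mulmx1 !add0r.
Qed.

(** Test vectors e_i + e_j and e_i - e_j. Control of the diagonal thus suffices, both for the blocks
    of the error Gramian and for integrability of Z. *)
Lemma psd_entry_bound n (M : 'M[R]_n) i j : psd M -> `|M i j| <= M i i + M j j.
Proof.
move=> pM; have sM : M j i = M i j by rewrite -{1}pM.1 mxE.
have h (e : R) := psd_bf (delta_mx i ord0 + e *: delta_mx j ord0) pM.
have := h 1; have := h (-1); have := psd_diag_ge0 i pM; have := psd_diag_ge0 j pM.
rewrite !bfDl !bfDr !bfZl !bfZr !bf_delta sM ler_norml => *.
by apply/andP; split; lra.
Qed.

Lemma psd_diag_le n (M : 'M[R]_n) i : psd M -> M i i <= \tr M.
Proof.
move=> pM; rewrite /mxtrace (bigD1 i) //= lerDl; apply: sumr_ge0 => j _.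
exact: psd_diag_ge0.
Qed.

Lemma trace_pair_bound a b (c : R) (Q Y : 'M[R]_(a, b)) :
  (forall i j, `|Q i j| <= c) ->
  `|\tr (Q^T *m Y)| <= c * \sum_i \sum_j `|Y i j|.
Proof.
move=> h; rewrite /mxtrace exchange_big mulr_sumr /=.
apply: le_trans (ler_norm_sum _ _ _) _; apply: ler_sum => j _.
rewrite mxE mulr_sumr; apply: le_trans (ler_norm_sum _ _ _) _.
by apply: ler_sum => i _; rewrite mxE normrM ler_wpM2r.
Qed.

End BlockForms.

(** * Observability certificate of the damped error system *)

Section ErrorCertificate.
Context {R : realType} {r s m p q : nat} (mth : method) (A : 'M[R]_(r + s)).
Context (N : 'I_m -> 'M[R]_(r + s)) (C : 'M[R]_(p, r + s)).
Context (gamma : R) (Th1 : 'M[R]_r) (Th2 : 'M[R]_s) (H : 'M[R]_(r + s)).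
Context (X0 : 'M[R]_(r + s, q)) (Y : 'M[R]_(r + s, r)) (Pt : 'M[R]_r).
Local Notation g := ((gamma ^+ 2)^-1).
Local Notation D := (block_mx Th1 0 0 Th2).
Local Notation At := (red_A mth A).
Local Notation Nt := (fun k => red_N mth A (N k)).
Local Notation Ct := (red_C mth A C).
Local Notation Xt := (usubmx X0).
Local Notation W := (weight mth gamma A N X0 Y Pt).

Definition error_A : 'M[R]_((r + s) + r) := block_mx A 0 0 At.
Definition error_N k : 'M[R]_((r + s) + r) := block_mx (N k) 0 0 (red_N mth A (N k)).
Definition error_C : 'M[R]_(p, (r + s) + r) := row_mx C (- Ct).

Lemma lyapd_error Q11 Q12 Q21 Q22 :
  lyapd g error_A error_N (block_mx Q11 Q12 Q21 Q22) =
  block_mx (lyapd g A N Q11)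
    (A^T *m Q12 + Q12 *m At + g *: \sum_k (N k)^T *m Q12 *m Nt k)
    (At^T *m Q21 + Q21 *m A + g *: \sum_k (Nt k)^T *m Q21 *m N k)
    (lyapd g At Nt Q22).
Proof.
rewrite /lyapd /error_A.
rewrite (eq_bigr (fun k => block_mx ((N k)^T *m Q11 *m N k)
  ((N k)^T *m Q12 *m Nt k) ((Nt k)^T *m Q21 *m N k) ((Nt k)^T *m Q22 *m Nt k))).
  have -> (F1 : 'I_m -> 'M[R]_(r + s)) F2 F3 F4 :
     \sum_k block_mx (F1 k) (F2 k) (F3 k) (F4 k : 'M[R]_r) =
     block_mx (\sum_k F1 k) (\sum_k F2 k) (\sum_k F3 k) (\sum_k F4 k).
    elim: (index_enum _) => [|k l IH].
      by rewrite !big_nil /block_mx !row_mx0 col_mx0.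
    by rewrite !big_cons IH add_block_mx.
  rewrite tr_block_mx !trmx0 !mulmx_block !mul0mx !mulmx0 !addr0 !add0r.
  by rewrite scale_block_mx !add_block_mx.
move=> k _; rewrite /error_N tr_block_mx !trmx0 !mulmx_block !mul0mx !mulmx0.
by rewrite !addr0 !add0r.
Qed.

Hypothesis adm : admissible mth A.
Hypotheses (pTh1 : posdef Th1) (pTh2 : psd Th2).
Hypothesis eqD : lyapd g A N D = - (C^T *m C).
Hypotheses (pH : posdef H) (pLH : posdef (- lyapd g A N H)).
Hypothesis eqY : lyap_op gamma A At N Nt Y = - (X0 *m Xt^T).
Hypothesis eqPt : lyap_op gamma At At Nt Nt Pt = - (Xt *m Xt^T).

(* The reduced Lyapunov operator need not be stable; damping it by eps makes
   Th1 a strict certificate for it, at the price of an error of order eps. *)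
Lemma error_certificate : exists2 K, 0 <= K & forall eps, 0 < eps ->
  exists Qe, [/\ psd Qe,
    lyapd g error_A error_N Qe = eps *: Qe - error_C^T *m error_C &
    \tr ((col_mx X0 Xt)^T *m Qe *m col_mx X0 Xt) <= \tr (Th2 *m W) + K * eps].
Proof.
have g0 : 0 <= g by rewrite invr_ge0 sqr_ge0.
have pD : psd D by apply: psd_block_diag => //; exact: posdef_psd.
pose c := \tr D + \tr Th1.
have c0 : 0 <= c by rewrite addr_ge0 // psd_trace_ge0 //; exact: posdef_psd.
(* The entries of Q12 are bounded by c and those of Q22 by 2 c, uniformly in eps; K collects the
   residues eps tr(Q12^T Y), which occurs twice, and eps tr(Q22^T Pt). *)
pose K := c * (2 * \sum_i \sum_j `|Y i j|) + (2 * c) * \sum_i \sum_j `|Pt i j|.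
have sum0 a b (M : 'M[R]_(a, b)) : 0 <= \sum_i \sum_j `|M i j|.
  by apply: sumr_ge0 => i _; apply: sumr_ge0.
exists K => [|eps eps0].
  by rewrite addr_ge0 // !mulr_ge0.
have pN21 : psd (g *: \sum_k (bold_N21 mth A (N k))^T *m Th2 *m bold_N21 mth A (N k)).
  by apply: psdZ => //; apply: psd_sum => k _; exact: psd_congr.
have redL := lyapd_reduced adm pTh2.1 eqD.
have pHs : posdef (- lyapd g (A - (eps / 2)%:M) N H).
  rewrite lyapd_shift opprB addrC; apply: posdefD => //.
  by apply: psdZ; [exact: ltW|exact: posdef_psd].
have pTs : posdef (- lyapd g (At - (eps / 2)%:M) Nt Th1).
  rewrite lyapd_shift opprB redL opprD !opprK.
  apply: posdefD; first exact: posdefZ.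
  by apply: psdD => //; exact: psd_gram.
(* The damped error system is certified blockwise, by [H] for the full part and by [Th1] for the
   reduced part. *)
pose He : 'M[R]_((r + s) + r) := block_mx H 0 0 Th1.
have pHe : posdef He by exact: posdef_block_diag.
have pLHe : posdef (- lyapd g (error_A - (eps / 2)%:M) error_N He).
  have -> : lyapd g (error_A - (eps / 2)%:M) error_N He =
     block_mx (lyapd g (A - (eps / 2)%:M) N H) 0 0
              (lyapd g (At - (eps / 2)%:M) Nt Th1).
    rewrite !lyapd_shift lyapd_error !mulmx0 !mul0mx !big1 => [|k _|k _];
      rewrite ?mulmx0 ?mul0mx //.
    by rewrite /He scale_block_mx opp_block_mx add_block_mx !scaler0 !oppr0 !addr0.
  by rewrite opp_block_mx !oppr0; exact: posdef_block_diag.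
have [Qe pQe] := lyapd_solve g0 pHe pLHe (psd_gram error_C).
rewrite lyapd_shift => /eqP; rewrite subr_eq addrC => /eqP eqQ.
exists Qe; split=> //.
have eQ := esym (submxK Qe).
set Q11 := ulsubmx Qe in eQ; set Q12 := ursubmx Qe in eQ.
set Q21 := dlsubmx Qe in eQ; set Q22 := drsubmx Qe in eQ.
have p11 : psd Q11 by exact: psd_ulsubmx.
have p22 : psd Q22 by exact: psd_drsubmx.
have e21 : Q21 = Q12^T by rewrite /Q12 trmx_ursub pQe.1.
have := eqQ; rewrite {1 2}eQ lyapd_error /error_C tr_row_mx mul_col_row.
rewrite scale_block_mx opp_block_mx add_block_mx => /eq_block_mx [h11 h12 h21 h22].
rewrite [(- _)^T]linearN /= mulNmx mulmxN opprK in h22.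
(* The maximum principle for the damped operators gives Q11 <= D here and Q22 <= Th1 below, bounds
   that do not depend on eps. *)
have dom11 : psd (D - Q11).
  apply: (lyapd_max g0 pH pHs); first by rewrite raddfB /= pD.1 p11.1.
  rewrite lyapd_shift lyapdD lyapdN eqD h11.
  have -> : - (- (C^T *m C) - (eps *: Q11 - C^T *m C) - eps *: (D - Q11)) = eps *: D.
    by move: (C^T *m C) D => U V; apply/matrixP => i j; rewrite !mxE; ring.
  by apply: psdZ => //; exact: ltW.
have dom22 : psd (Th1 - Q22).
  apply: (lyapd_max g0 pTh1 pTs); first by rewrite raddfB /= pTh1.1 p22.1.
  rewrite lyapd_shift lyapdD lyapdN redL h22.
  have -> : - (- (Ct^T *m Ct)
     - g *: (\sum_k (bold_N21 mth A (N k))^T *m Th2 *m bold_N21 mth A (N k))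
     - (eps *: Q22 - Ct^T *m Ct) - eps *: (Th1 - Q22)) =
     eps *: Th1 + g *: (\sum_k (bold_N21 mth A (N k))^T *m Th2 *m bold_N21 mth A (N k)).
    by move: (Ct^T *m Ct) (\sum_k _) => U V; apply/matrixP => i j; rewrite !mxE; ring.
  by apply: psdD => //; apply: psdZ; [exact: ltW|exact: posdef_psd].
have d11 i : Q11 i i <= \tr D.
  apply: le_trans (psd_diag_le i pD).
  by have := psd_diag_ge0 i dom11; rewrite [(D - _) i i]mxE [(- Q11) i i]mxE subr_ge0.
have d22 i : Q22 i i <= \tr Th1.
  apply: le_trans (psd_diag_le i (posdef_psd pTh1)).
  by have := psd_diag_ge0 i dom22; rewrite [(Th1 - _) i i]mxE [(- Q22) i i]mxE subr_ge0.
have b12 i j : `|Q12 i j| <= c.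
  have := psd_entry_bound (lshift r i) (rshift (r + s) j) pQe.
  rewrite eQ block_mxEur block_mxEul block_mxEdr => /le_trans; apply.
  exact: lerD.
have b22 i j : `|Q22 i j| <= 2 * c.
  apply: le_trans (psd_entry_bound i j p22) _.
  have := d22 i; have := d22 j; have := psd_trace_ge0 pD; rewrite /c; lra.
have bY := trace_pair_bound Y b12; have bP := trace_pair_bound Pt b22.
(* Pairing the block equations of the error Gramian with [Y] and with [Pt] replaces traces at the
   initial data by the output traces of [weight_trace], up to terms of order eps. *)
have t12 : \tr (Q12^T *m (X0 *m Xt^T)) = - \tr (C *m Y *m Ct^T) - eps * \tr (Q12^T *m Y).
  have := lyap_op_pairing gamma A At N Nt Q12 Y.
  rewrite eqY h12 mulmxN [\tr (- _)]raddfN /= => e.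
  apply: oppr_inj; rewrite e mulmxN opprK raddfD /= linearZ /= trmx_mul trmxK.
  rewrite mulmxDl -scalemxAl mxtraceD mxtraceZ opprB opprK; congr (_ + _).
  by rewrite [RHS]mxtrace_mulC !mulmxA.
have t22 : \tr (Q22 *m (Xt *m Xt^T)) = \tr (Ct *m Pt *m Ct^T) - eps * \tr (Q22^T *m Pt).
  have := lyap_op_pairing gamma At At Nt Nt Q22 Pt.
  rewrite eqPt -/(lyapd g At Nt Q22) h22 mulmxN [\tr (- _)]raddfN /= p22.1 => e.
  apply: oppr_inj; rewrite e raddfB /= linearZ /=.
  rewrite trmx_mul trmxK p22.1 mulmxBl -scalemxAl raddfB /= mxtraceZ.
  by rewrite opprB; congr (_ - _); rewrite [RHS]mxtrace_mulC !mulmxA.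
have -> : \tr ((col_mx X0 Xt)^T *m Qe *m col_mx X0 Xt) =
   \tr (X0^T *m Q11 *m X0) + 2 * \tr (Q12^T *m (X0 *m Xt^T)) + \tr (Q22 *m (Xt *m Xt^T)).
  rewrite trace_congr eQ e21 tr_col_mx mul_col_row mulmx_block mxtrace_block !mxtraceD.
  rewrite trace_congr.
  have -> : \tr (Q12 *m (Xt *m X0^T)) = \tr (Q12^T *m (X0 *m Xt^T)).
    by rewrite -mxtrace_tr !trmx_mul trmxK mxtrace_mulC.
  ring.
have le11 : \tr (X0^T *m Q11 *m X0) <= \tr (X0^T *m D *m X0).
  have := psd_trace_ge0 (psd_congr X0 dom11).
  by rewrite mulmxBr mulmxBl raddfB /= subr_ge0.
have := weight_trace adm pTh1.1 pTh2.1 eqD eqY eqPt.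
rewrite t12 t22 /K; move: bY bP; rewrite !ler_norml => /andP[bY _] /andP[bP _] e.
have := ler_wpM2l (ltW eps0) bY; have := ler_wpM2l (ltW eps0) bP.
rewrite -e; lra.
Qed.

End ErrorCertificate.

(** * Primitives of locally integrable functions *)

Section LocallyIntegrable.
Context {R : realType}.
Local Notation mu := (@lebesgue_measure R).
Implicit Types (f g F G : R -> R).

Definition locL1 f := forall t : R, 0 <= t -> mu.-integrable `[0, t] (EFin \o f).

Definition integral0 f t := \int[mu]_(x in `[0, t]) f x.

(** These multipliers preserve [locL1]. States are of this kind, whereas controls are only locally
    integrable or square integrable. *)
Definition lbounded_measurable F := forall t : R, 0 <= t ->
  @measurable_fun _ _ R R `[0, t] F
  /\ exists M : R, forall x : R, 0 <= x <= t -> `|F x| <= M.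

(* F is locally absolutely continuous on [0, +oo) with derivative f a.e. *)
Definition primitive F f :=
  locL1 f /\ forall t : R, 0 <= t -> F t = F 0 + integral0 f t.

Lemma mem_itv0 (t x : R) : `[0, t]%classic x = (0 <= x <= t) :> Prop.
Proof. by rewrite /= in_itv. Qed.

Lemma integrable_eq0 f g t : (forall x, 0 <= x <= t -> f x = g x) ->
  mu.-integrable `[0, t] (EFin \o f) -> mu.-integrable `[0, t] (EFin \o g).
Proof.
move=> e; apply: eq_integrable => // x; rewrite inE mem_itv0 /= => xt.
by rewrite e.
Qed.

Lemma locL1_eq f g : (forall x, 0 <= x -> f x = g x) -> locL1 f -> locL1 g.
Proof.
move=> e h t t0; apply: integrable_eq0 (h t t0) => x /andP[x0 _]; exact: e.
Qed.

Lemma integral0_eq f g t : (forall x, 0 <= x <= t -> f x = g x) ->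
  integral0 f t = integral0 g t.
Proof. by move=> e; apply: eq_Rintegral => x; rewrite inE mem_itv0; exact: e. Qed.

Lemma locL1D f g : locL1 f -> locL1 g -> locL1 (fun x => f x + g x).
Proof.
by move=> hf hg t t0; exact: (integrableD _ (hf t t0) (hg t t0)).
Qed.

Lemma locL1Z a f : locL1 f -> locL1 (fun x => a * f x).
Proof. by move=> hf t t0; exact: (integrableZl _ a (hf t t0)). Qed.

Lemma locL1_norm f : locL1 f -> locL1 (fun x => `|f x|).
Proof. by move=> hf t t0; apply: integrable_norm; exact: hf. Qed.

Lemma lbm_locL1 F : lbounded_measurable F -> locL1 F.
Proof.
move=> h t t0; have [mF [M hM]] := h t t0.
have fin : (mu `[0%R, t]%classic < +oo)%E.
  by rewrite lebesgue_measure_itv /=; case: ifP => _; rewrite ?ltry // -EFinB ltry.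
apply: (measurable_bounded_integrable _ fin mF) => //.
exists M; split; first exact: num_real.
by move=> x Mx y; rewrite mem_itv0 => /hM /le_trans; apply; exact: ltW.
Qed.

Lemma lbm_cst a : lbounded_measurable (fun=> a).
Proof. by move=> t t0; split=> //; exists `|a|. Qed.

Lemma locL1_cst a : locL1 (fun=> a).
Proof. exact: lbm_locL1 (lbm_cst a). Qed.

Lemma locL1_sum I (s : seq I) (P : pred I) (f : I -> R -> R) :
  (forall i, P i -> locL1 (f i)) -> locL1 (fun x => \sum_(i <- s | P i) f i x).
Proof.
move=> h; elim: s => [|i s IH].
  by apply: locL1_eq (locL1_cst 0) => x _; rewrite big_nil.
have [Pi|Pi] := boolP (P i).
  by apply: locL1_eq (locL1D (h i Pi) IH) => x _; rewrite big_cons Pi.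
by apply: locL1_eq IH => x _; rewrite big_cons (negbTE Pi).
Qed.

Lemma lbmM F G : lbounded_measurable F -> lbounded_measurable G ->
  lbounded_measurable (fun x => F x * G x).
Proof.
move=> hF hG t t0; have [mF [M hM]] := hF t t0; have [mG [M' hM']] := hG t t0.
split; first exact: measurable_funM.
exists (M * M') => x xt; rewrite normrM ler_pM //; [exact: hM|exact: hM'].
Qed.

Lemma lbmD F G : lbounded_measurable F -> lbounded_measurable G ->
  lbounded_measurable (fun x => F x + G x).
Proof.
move=> hF hG t t0; have [mF [M hM]] := hF t t0; have [mG [M' hM']] := hG t t0.
split; first exact: measurable_funD.
exists (M + M') => x xt; apply: le_trans (ler_normD _ _) _.
by rewrite lerD //; [exact: hM|exact: hM'].
Qed.

Lemma lbm_exp F : lbounded_measurable F -> lbounded_measurable (fun x => expR (F x)).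
Proof.
move=> hF t t0; have [mF [M hM]] := hF t t0.
split; first by apply: measurableT_comp mF; exact: measurable_expR.
exists (expR M) => x xt; rewrite ger0_norm ?expR_ge0 // ler_expR.
exact: le_trans (ler_norm _) (hM x xt).
Qed.

Lemma locL1M f F : locL1 f -> lbounded_measurable F -> locL1 (fun x => f x * F x).
Proof.
move=> hf hF t t0; have [mF [M hM]] := hF t t0.
apply: (integrableMl _ (hf t t0) mF) => //.
exists M; split; first exact: num_real.
by move=> x Mx y; rewrite mem_itv0 => /hM /le_trans; apply; exact: ltW.
Qed.

Lemma integral0D f g t : locL1 f -> locL1 g -> 0 <= t ->
  integral0 (fun x => f x + g x) t = integral0 f t + integral0 g t.
Proof. by move=> hf hg t0; apply: RintegralD => //; [exact: hf|exact: hg]. Qed.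

Lemma integral0Z a f t : locL1 f -> 0 <= t ->
  integral0 (fun x => a * f x) t = a * integral0 f t.
Proof. by move=> hf t0; apply: RintegralZl => //; exact: hf. Qed.

Lemma integral0_ge0 f t : (forall x, 0 <= x <= t -> 0 <= f x) -> 0 <= integral0 f t.
Proof. by move=> h; apply: Rintegral_ge0 => x; rewrite mem_itv0; exact: h. Qed.

Lemma integral0_le f g t : locL1 f -> locL1 g -> 0 <= t ->
  (forall x, 0 <= x <= t -> f x <= g x) -> integral0 f t <= integral0 g t.
Proof.
move=> hf hg t0 h; apply: le_Rintegral (hf t t0) (hg t t0) _ => //.
Qed.

Lemma integral0_0 f : integral0 f 0 = 0.
Proof. by rewrite /integral0 set_itv1 Rintegral_set1. Qed.

Lemma integral0_sub f s t : locL1 f -> 0 <= s -> s <= t ->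
  integral0 f t - integral0 f s = \int[mu]_(x in `]s, t]) f x.
Proof.
move=> hf s0 st; apply: Rintegral_itvB; rewrite ?bnd_simp //.
by apply: hf; exact: le_trans st.
Qed.

Lemma primitive_integral0 f : locL1 f -> primitive (integral0 f) f.
Proof. by move=> hf; split=> // t _; rewrite integral0_0 add0r. Qed.

Lemma primitive_eq F G f g : (forall x, 0 <= x -> F x = G x) ->
  (forall x, 0 <= x -> f x = g x) -> primitive F f -> primitive G g.
Proof.
move=> eF ef [lf hF]; split; first exact: locL1_eq lf.
move=> t t0; rewrite -!eF // hF //; congr (_ + _).
by apply: integral0_eq => x /andP[x0 _]; exact: ef.
Qed.

Lemma primitive_cst a : primitive (fun=> a) (fun=> 0).
Proof.
split=> [|t t0]; first exact: locL1_cst.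
by rewrite /integral0 Rintegral_cst // mul0r addr0.
Qed.

Lemma primitiveD F G f g : primitive F f -> primitive G g ->
  primitive (fun x => F x + G x) (fun x => f x + g x).
Proof.
move=> [lf hF] [lg hG]; split=> [|t t0]; first exact: locL1D.
by rewrite integral0D // (hF t) // (hG t) // addrACA.
Qed.

Lemma primitiveZ a F f : primitive F f ->
  primitive (fun x => a * F x) (fun x => a * f x).
Proof.
move=> [lf hF]; split=> [|t t0]; first exact: locL1Z.
by rewrite integral0Z // (hF t) // mulrDr.
Qed.

Lemma primitiveB F G f g : primitive F f -> primitive G g ->
  primitive (fun x => F x - G x) (fun x => f x - g x).
Proof.
move=> hF /(primitiveZ (-1)) hG.
by apply: primitive_eq (primitiveD hF hG) => x _; rewrite mulN1r.
Qed.

Lemma primitive_sum I (s : seq I) (P : pred I) (F f : I -> R -> R) :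
  (forall i, P i -> primitive (F i) (f i)) ->
  primitive (fun x => \sum_(i <- s | P i) F i x) (fun x => \sum_(i <- s | P i) f i x).
Proof.
move=> h; elim: s => [|i s IH].
  by apply: primitive_eq (primitive_cst 0) => x _; rewrite big_nil.
have [Pi|Pi] := boolP (P i).
  by apply: primitive_eq (primitiveD (h i Pi) IH) => x _; rewrite !big_cons Pi.
by apply: primitive_eq IH => x _; rewrite !big_cons (negbTE Pi).
Qed.

(** Mean value inequality in integrated form: increments are compared through the densities, without
    any pointwise differentiation. *)
Lemma primitive_le F G f g s t : primitive F f -> primitive G g ->
  0 <= s -> s <= t -> (forall x, s <= x <= t -> f x <= g x) ->
  F t - F s <= G t - G s.
Proof.
move=> [lf hF] [lg hG] s0 st h; have t0 := le_trans s0 st.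
have e (K k : R -> R) : locL1 k -> (forall t, 0 <= t -> K t = K 0 + integral0 k t) ->
    K t - K s = \int[mu]_(x in `]s, t]) k x.
  by move=> lk hK; rewrite (hK t) // (hK s) // -integral0_sub //; ring.
have sub : `]s, t] `<=` `[0, t].
  by apply: subset_itvr; rewrite bnd_simp.
rewrite (e F f) // (e G g) //; apply: le_Rintegral => //.
- by apply: integrableS (lf t t0).
- by apply: integrableS (lg t t0).
- by move=> x /=; rewrite in_itv /= => /andP[sx xt]; rewrite h // ltW.
Qed.

Lemma primitive_nondecr F f s t : primitive F f -> 0 <= s -> s <= t ->
  (forall x, s <= x <= t -> 0 <= f x) -> F s <= F t.
Proof.
move=> hF s0 st h; have := primitive_le (primitive_cst 0) hF s0 st h.
by rewrite subrr subr_ge0.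
Qed.

Lemma primitive_dist F G f g s t : primitive F f -> primitive G g ->
  0 <= s -> s <= t -> (forall x, s <= x <= t -> `|f x| <= g x) ->
  `|F t - F s| <= G t - G s.
Proof.
move=> hF hG s0 st h; rewrite ler_norml; apply/andP; split.
  have hN := primitiveZ (-1) hG; rewrite lerNl.
  have := primitive_le hN hF s0 st; rewrite -mulrBr mulN1r => /(_ _).
  rewrite lerNl; apply=> x /h; rewrite mulN1r ler_norml => /andP[] //.
by apply: (primitive_le hF hG) => // x /h; apply: le_trans; exact: ler_norm.
Qed.

Lemma primitive_continuous F f T : primitive F f -> 0 <= T ->
  {within `[0, T], continuous F}.
Proof.
move=> [lf hF] T0.
have c : {within `[0, T], continuous (fun x => F 0 + integral0 f x)}.
  move=> x; apply: cvgD; first exact: cvg_cst.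
  exact: (parameterized_integral_continuous T0 (lf T T0)).
apply: subspace_eq_continuous c => x.
by rewrite inE mem_itv0 => /andP[x0 _]; rewrite /= [RHS]hF.
Qed.

Lemma primitive_lbm F f : primitive F f -> lbounded_measurable F.
Proof.
move=> pF t t0; split.
  by apply: subspace_continuous_measurable_fun => //; exact: (primitive_continuous pF).
have lf := pF.1; exists (`|F 0| + integral0 (fun x => `|f x|) t) => x /andP[x0 xt].
have pH := primitive_integral0 (locL1_norm lf).
have := primitive_dist pF pH (lexx 0) x0 (fun y _ => lexx `|f y|).
have := primitive_nondecr pH x0 xt (fun y _ => normr_ge0 (f y)).
rewrite integral0_0 subr0; have := ler_normD (F 0) (F x - F 0).
rewrite addrC subrK; lra.
Qed.

End LocallyIntegrable.

(** * Product rule, exponential and Gronwall inequality for absolutely continuous functions *)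

Section Calculus.
Context {R : realType}.
Implicit Types (f g F G H W : R -> R).

(* Cut [0, T] into n pieces on which H has increment (H T - H 0) / n: then
   |W T - W 0| is at most c (H T - H 0)^2 / n. *)
Lemma eq_of_quadratic_increments W H (T c : R) : 0 <= T -> 0 <= c ->
  {within `[0, T], continuous H} ->
  (forall s t, 0 <= s -> s <= t -> t <= T -> H s <= H t) ->
  (forall s t, 0 <= s -> s <= t -> t <= T -> `|W t - W s| <= c * (H t - H s) ^+ 2) ->
  W T = W 0.
Proof.
move=> T0 c0 cH mH hW.
pose D := H T - H 0; have D0 : 0 <= D by rewrite subr_ge0 mH.
have step n (k : nat) : (k <= n.+1)%N -> exists t : R, [/\ 0 <= t <= T,
    H t = H 0 + k%:R / n.+1%:R * D & `|W t - W 0| <= k%:R * (c * (D / n.+1%:R) ^+ 2)].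
  elim: k => [|k IH] kn.
    by exists 0; rewrite lexx T0 mul0r mul0r addr0 subrr normr0 mul0r.
  have [t [/andP[t0 tT] Ht Wt]] := IH (ltnW kn).
  have n0 : (0 : R) < n.+1%:R by rewrite ltr0n.
  pose v := H 0 + k.+1%:R / n.+1%:R * D.
  have k1 : k.+1%:R / n.+1%:R <= 1 :> R by rewrite ler_pdivrMr // mul1r ler_nat.
  have k2 : k%:R / n.+1%:R <= k.+1%:R / n.+1%:R :> R.
    by rewrite ler_pM2r ?invr_gt0 // ler_nat.
  have vT : H t <= v <= H T.
    rewrite Ht /v; apply/andP; split; first by rewrite lerD2l ler_wpM2r.
    have -> : H T = H 0 + D by rewrite /D addrC subrK.
    by rewrite lerD2l; have := ler_wpM2r D0 k1; rewrite mul1r.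
  have cH' : {within `[t, T], continuous H}.
    by apply: continuous_subspaceW cH; apply: subset_itvr; rewrite bnd_simp.
  have [|t' tt' Ht'] := IVT tT cH' (v := v).
    by rewrite (min_idPl _) ?(max_idPr _) // mH.
  move: tt'; rewrite in_itv /= => /andP[tt' t'T].
  exists t'; split; [by rewrite t'T (le_trans t0)|by []|].
  have := hW t t' t0 tt' t'T.
  have -> : H t' - H t = D / n.+1%:R.
    rewrite Ht' Ht /v -[k.+1%:R]natr1; field.
    by rewrite nat1r gt_eqF // ltr0n.
  have := ler_distD (W t) (W t') (W 0).
  have -> : k.+1%:R = k%:R + 1 :> R by rewrite natr1.
  rewrite [(k%:R + 1) * _]mulrDl mul1r; move: Wt; move: (c * _) (k%:R * _) => z z'.
  lra.
apply/eqP; rewrite -subr_eq0 -normr_eq0; apply/eqP/le_anti.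
rewrite normr_ge0 andbT; apply/ler_addgt0Pl => e e0; rewrite addr0.
pose n := Num.truncn (c * D ^+ 2 / e).
have hn : c * D ^+ 2 < e * n.+1%:R.
  by rewrite [e * _]mulrC -ltr_pdivrMr //; exact: truncnS_gt.
have [t [/andP[t0 tT] Ht Wt]] := step n _ (leqnn _).
have n0 : (0 : R) < n.+1%:R by rewrite ltr0n.
(* The last cut point may lie before T, but H is constant from there on, and so is W by [hW]. *)
have HtT : H T - H t = 0 by rewrite Ht divff ?gt_eqF // /D; ring.
have := hW t T t0 tT (lexx T); rewrite HtT expr0n mulr0 normr_le0 subr_eq0 => /eqP ->.
apply: le_trans Wt _.
have -> : n.+1%:R * (c * (D / n.+1%:R) ^+ 2) = c * D ^+ 2 / n.+1%:R.
  by field; rewrite nat1r gt_eqF // ltr0n.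
by rewrite ler_pdivrMr // ltW.
Qed.

(** The increment of F G minus the integral of the expected density is of second order in the
    increment of H, the integral of |f| + |g|; [eq_of_quadratic_increments] then concludes. *)
Lemma primitiveM F G f g : primitive F f -> primitive G g ->
  primitive (fun x => F x * G x) (fun x => f x * G x + F x * g x).
Proof.
move=> pF pG; have bF := primitive_lbm pF; have bG := primitive_lbm pG.
have lf := pF.1; have lg := pG.1.
pose phi x := f x * G x + F x * g x.
have lphi : locL1 phi.
  apply: locL1D; first exact: locL1M.
  by apply: locL1_eq (locL1M lg bF) => x _; rewrite mulrC.
pose h x := `|f x| + `|g x|.
have lh : locL1 h by apply: locL1D; exact: locL1_norm.
have pH := primitive_integral0 lh; set H := integral0 h in pH.
have h0 x : 0 <= h x by rewrite addr_ge0.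
split=> // T T0; have pP := primitive_integral0 lphi.
suff : F T * G T - integral0 phi T = F 0 * G 0 - integral0 phi 0.
  by rewrite integral0_0 subr0 => /eqP; rewrite subr_eq => /eqP.
apply: (@eq_of_quadratic_increments (fun x => F x * G x - integral0 phi x) H T 1) => //.
- exact: (primitive_continuous pH).
- by move=> s t s0 st _; apply: (primitive_nondecr pH).
move=> s t s0 st tT; rewrite mul1r.
have d1 x : s <= x <= t -> `|F t - F x| <= H t - H s /\ `|G s - G x| <= H t - H s.
  move=> /andP[sx xt]; have x0 := le_trans s0 sx.
  have Hsx : H s <= H x by apply: (primitive_nondecr pH).
  have Hxt : H x <= H t by apply: (primitive_nondecr pH).
  split.
    apply: (@le_trans _ _ (H t - H x)); last by lra.
    by apply: (primitive_dist pF pH) => // y _; rewrite lerDl.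
  rewrite distrC; apply: (@le_trans _ _ (H x - H s)); last by lra.
  by apply: (primitive_dist pG pH) => // y _; rewrite lerDr.
(* With F frozen at t and G at s, the increment of P over [s, t] is exactly the wanted one, and its
   density is (F t - F x) g + (G s - G x) f. *)
pose P x := F t * G x + G s * F x - integral0 phi x.
have pPP : primitive P (fun x => F t * g x + G s * f x - phi x).
  by apply: primitiveB pP; apply: primitiveD; exact: primitiveZ.
have := primitive_dist pPP (primitiveZ (H t - H s) pH) s0 st.
rewrite -mulrBr -expr2 /P => hP.
have -> : F t * G t - integral0 phi t - (F s * G s - integral0 phi s) =
  F t * G t + G s * F t - integral0 phi t - (F t * G s + G s * F s - integral0 phi s).
  by ring.
apply: hP => x xst; have [dF dG] := d1 x xst.
have -> : F t * g x + G s * f x - phi x = (F t - F x) * g x + (G s - G x) * f x.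
  by rewrite /phi; ring.
apply: le_trans (ler_normD _ _) _; rewrite !normrM /h mulrDr addrC.
by rewrite lerD // ler_wpM2r.
Qed.

(** Same scheme as for products. Convexity of exp bounds the increments of E on both sides; the
    constant 2 M adds the Taylor remainder and the error of freezing E at s. *)
Lemma primitive_exp F f : primitive F f ->
  primitive (fun x => expR (F x)) (fun x => f x * expR (F x)).
Proof.
move=> pF; have bF := primitive_lbm pF; have bE := lbm_exp bF; have lf := pF.1.
pose E x := expR (F x); pose phi x := f x * E x.
have lphi : locL1 phi by exact: locL1M.
have lh := locL1_norm lf.
have pH := primitive_integral0 lh; set H := integral0 _ in pH.
split=> // T T0; have pP := primitive_integral0 lphi.
suff : E T - integral0 phi T = E 0 - integral0 phi 0.
  by rewrite integral0_0 subr0 => /eqP; rewrite subr_eq => /eqP.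
have [_ [M hM]] := bE T T0.
have EM x : 0 <= x <= T -> 0 <= E x <= M.
  by move=> /hM; rewrite ger0_norm ?expR_ge0 // => ->; rewrite expR_ge0.
have M0 : 0 <= M.
  have /EM/andP[] : (0 <= (0 : R) <= T) by rewrite lexx.
  exact: le_trans.
apply: (@eq_of_quadratic_increments (fun x => E x - integral0 phi x) H T (2 * M)) => //.
- by rewrite mulr_ge0.
- exact: (primitive_continuous pH).
- by move=> s t s0 st _; apply: (primitive_nondecr pH).
move=> s t s0 st tT.
have ex (a b : R) : expR b * (a - b) <= expR a - expR b.
  rewrite -{2}(subrK b a) expRD -{3}[expR b]mul1r -mulrBl mulrC ler_wpM2r ?expR_ge0 //.
  by have := expR_ge1Dx (a - b); lra.
have dE x : s <= x <= t -> `|F x - F s| <= H t - H s /\ `|E x - E s| <= M * (H t - H s).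
  move=> /andP[sx xt]; have x0 := le_trans s0 sx.
  have Hsx : H s <= H x by apply: (primitive_nondecr pH).
  have Hxt : H x <= H t by apply: (primitive_nondecr pH).
  have dF : `|F x - F s| <= H t - H s.
    by apply: le_trans (primitive_dist pF pH s0 sx (fun y _ => lexx _)) _; lra.
  split=> //; have /andP[Ex0 ExM] := EM x (introT andP (conj x0 (le_trans xt tT))).
  have sT : s <= T by exact: le_trans st tT.
  have /andP[Es0 EsM] := EM s (introT andP (conj s0 sT)).
  have := ex (F x) (F s); have := ex (F s) (F x); rewrite -/(E x) -/(E s).
  have hF := dF; move: dF; rewrite !ler_norml => /andP[d1 d2] e1 e2.
  have dH : 0 <= H t - H s by lra.
  apply/andP; split.
    have := ler_wpM2l Es0 d1; have := ler_wpM2r dH EsM; lra.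
  have := ler_wpM2l Ex0 d2; have := ler_wpM2r dH ExM; lra.
pose P x := E s * F x - integral0 phi x.
have pPP : primitive P (fun x => E s * f x - phi x).
  by apply: primitiveB pP; exact: primitiveZ.
have [dFt dEt] := dE t (introT andP (conj st (lexx t))).
have hP : `|P t - P s| <= M * (H t - H s) * (H t - H s).
  have := primitive_dist pPP (primitiveZ (M * (H t - H s)) pH) s0 st.
  rewrite -mulrBr; apply=> x xst; have [_ hE] := dE x xst.
  have -> : E s * f x - phi x = - ((E x - E s) * f x) by rewrite /phi; ring.
  by rewrite normrN normrM ler_wpM2r.
have -> : E t - integral0 phi t - (E s - integral0 phi s) =
   (E t - E s - E s * (F t - F s)) + (P t - P s) by rewrite /P; ring.
apply: le_trans (ler_normD _ _) _.
have -> : 2 * M * (H t - H s) ^+ 2 =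
  M * (H t - H s) * (H t - H s) + M * (H t - H s) * (H t - H s) by ring.
apply: lerD => //.
have r0 : 0 <= E t - E s - E s * (F t - F s) by rewrite subr_ge0; exact: ex.
rewrite ger0_norm //.
apply: le_trans (_ : (E t - E s) * (F t - F s) <= _).
  by have := ex (F s) (F t); rewrite -/(E t) -/(E s); lra.
apply: le_trans (ler_norm _) _; rewrite normrM.
by rewrite ler_pM.
Qed.

(** V is multiplied by exp(-K), with K the integral of k. On [0, T] the weight lies between exp(-K
    T) and 1; the lower bound serves the output term a, the upper one the input term b. Keeping a on
    the left is what yields L2 bounds. *)
Lemma energy_gronwall (V phi a b k : R -> R) (T : R) : 0 <= T ->
  primitive V phi -> locL1 a -> locL1 b -> locL1 k ->
  (forall t, 0 <= t <= T -> 0 <= V t) -> (forall t, 0 <= t <= T -> 0 <= a t) ->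
  (forall t, 0 <= t <= T -> 0 <= b t) -> (forall t, 0 <= t <= T -> 0 <= k t) ->
  (forall t, 0 <= t <= T -> phi t + a t <= b t + k t * V t) ->
  V T + integral0 a T <= (V 0 + integral0 b T) * expR (integral0 k T).
Proof.
move=> T0 pV la lb lk V0 a0 b0 k0 h.
have pK := primitive_integral0 lk; set K := integral0 k in pK *.
have pNK := primitiveZ (-1) pK.
have pE := primitive_exp pNK; have pVE := primitiveM pV pE.
have pA := primitive_integral0 la; have pB := primitive_integral0 lb.
have eT0 := expR_ge0 (-1 * K T).
have TT : 0 <= T <= T by rewrite T0 lexx.
have Kx x : 0 <= x <= T -> 0 <= K x <= K T.
  move=> /andP[x0 xT]; apply/andP; split.
    have := primitive_nondecr pK (lexx 0) x0; rewrite /K integral0_0; apply.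
    by move=> y /andP[y0 yx]; apply: k0; rewrite y0 (le_trans yx).
  apply: (primitive_nondecr pK) => // y /andP[xy yT]; apply: k0.
  by rewrite yT (le_trans x0).
have := primitive_le (primitiveD pVE (primitiveZ (expR (-1 * K T)) pA)) pB (lexx 0) T0.
rewrite /= /K !integral0_0 !mulr0 expR0 mulr1 addr0 subr0 -/K => hle.
have {hle} : V T * expR (-1 * K T) + expR (-1 * K T) * integral0 a T - V 0
    <= integral0 b T.
  apply: hle => x xT; have /andP[Kx0 KxT] := Kx x xT.
  set e := expR (-1 * K x).
  have e1 : e <= 1 by rewrite /e -[leRHS]expR0 ler_expR mulN1r oppr_le0.
  have eT : expR (-1 * K T) <= e by rewrite ler_expR !mulN1r lerN2.
  have e0 : 0 <= e := expR_ge0 _.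
  have := ler_wpM2r (a0 x xT) eT; have := ler_wpM2r e0 (h x xT).
  have := ler_wpM2l (b0 x xT) e1; lra.
rewrite mulN1r expRN => hle; have ep := expR_gt0 (K T).
rewrite -ler_pdivrMr // mulrDl; lra.
Qed.

End Calculus.

(** * Linear differential equations *)

Section LinearODE.
Context {R : realType}.

Lemma half_pow_gt0 k : 0 < 2^-1 ^+ k :> R.
Proof. by rewrite exprn_gt0 // invr_gt0. Qed.

(** The limit is the supremum of the lower envelopes u k - 2 c 2^-k, increasing and below the
    decreasing upper ones. The informative sum type lets it define a function of time. *)
Lemma geometric_limit (u : nat -> R) (c : R) :
  (forall k, `|u k.+1 - u k| <= c * 2^-1 ^+ k) ->
  {l | forall k, `|l - u k| <= 2 * c * 2^-1 ^+ k}.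
Proof.
move=> h.
pose x k := u k - 2 * c * 2^-1 ^+ k; pose y k := u k + 2 * c * 2^-1 ^+ k.
have hx : {homo x : i j / (i <= j)%N >-> i <= j}.
  apply: homo_leq => [//|a b d|k]; first exact: le_trans.
  by have := h k; rewrite /x exprS ler_norml => /andP[]; lra.
have hy : {homo y : i j / (i <= j)%N >-> j <= i}.
  apply: homo_leq => [//|a b d ba db|k]; first exact: le_trans ba.
  by have := h k; rewrite /y exprS ler_norml => /andP[]; lra.
have c0 : 0 <= c.
  by have := le_trans (normr_ge0 _) (h 0); rewrite expr0 mulr1.
have xy i : x i <= y i.
  rewrite /x /y; have := mulr_ge0 c0 (ltW (half_pow_gt0 i)); lra.
have xyy i j : x i <= y j.
  have := hx _ _ (leq_maxl i j); have := hy _ _ (leq_maxr i j).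
  by have := xy (maxn i j); lra.
have ubx j : ubound (range x) (y j) by move=> _ [i _ <-].
have hs : has_sup (range x) by split; [exists (x 0), 0|exists (y 0)].
exists (sup (range x)) => k; rewrite ler_norml; apply/andP; split.
  have : x k <= sup (range x) by apply: ub_le_sup; [exact: hs.2|exists k].
  by rewrite /x; lra.
have : sup (range x) <= y k by apply: ge_sup => //; exact: hs.1.
by rewrite /y; lra.
Qed.

Lemma half_pow_limit_eq0 (x c : R) : (forall k, `|x| <= c * 2^-1 ^+ k) -> x = 0.
Proof.
move=> h; have cv : (c * 2^-1 ^+ k @[k --> \oo] --> (0 : R)).
  by apply: cvg_geometric; rewrite ger0_norm ?invr_ge0 // invf_lt1 ?ltr1n.
apply/eqP; rewrite -normr_eq0 eq_le normr_ge0 andbT.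
apply/ler_addgt0Pl => e e0; rewrite addr0.
move/cvgrPdist_le: cv => /(_ e e0) [k _ hk]; apply: le_trans (h k) _.
by have := hk k (leqnn k); rewrite sub0r normrN; exact: le_trans (ler_norm _).
Qed.

Lemma lbm_limit (z : nat -> R -> R) (w : R -> R) (c : R -> R) :
  (forall k, lbounded_measurable (z k)) ->
  (forall T, 0 <= T -> forall t k, 0 <= t <= T -> `|w t - z k t| <= c T * 2^-1 ^+ k) ->
  lbounded_measurable w.
Proof.
move=> hz hw T T0; split.
  apply: (@measurable_fun_cvg _ _ _ _ z) => [k|t]; first by have [] := hz k T T0.
  rewrite mem_itv0 => tT; apply/cvgrPdist_le => e e0.
  have cv : (c T * 2^-1 ^+ k @[k --> \oo] --> (0 : R)).
    by apply: cvg_geometric; rewrite ger0_norm ?invr_ge0 // invf_lt1 ?ltr1n.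
  move/cvgrPdist_le: cv => /(_ e e0); apply: filterS => k.
  rewrite sub0r normrN => hk; apply: le_trans (hw T T0 t k tT) _.
  exact: le_trans (ler_norm _) hk.
have [_ [M hM]] := hz 0%N T T0; exists (c T + M) => t tT.
have := hw T T0 t 0%N tT; rewrite expr0 mulr1 => h1.
have := hM t tT; have := ler_normD (w t - z 0%N t) (z 0%N t).
rewrite subrK; lra.
Qed.

(* Picard iteration, contracting by 1/2 in the norm weighted by exp(-2 H),
   where H is the integral of the sum h of the |a i j|. *)
Lemma linear_ode_exists n (a : 'I_n -> 'I_n -> R -> R) (f : 'I_n -> R -> R)
    (z0 : 'I_n -> R) :
  (forall i j, locL1 (a i j)) -> (forall i, locL1 (f i)) ->
  exists z : R -> 'cV[R]_n, forall i, z 0 i ord0 = z0 i /\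
    primitive (fun t => z t i ord0)
      (fun t => \sum_j a i j t * z t j ord0 + f i t).
Proof.
move=> la lf.
pose rhs (z : 'I_n -> R -> R) i t := \sum_j a i j t * z j t + f i t.
pose z := fix z k := if k is k'.+1 then fun i t => z0 i + integral0 (rhs (z k') i) t
                     else fun i _ => z0 i.
have lrhs (w : 'I_n -> R -> R) i : (forall j, lbounded_measurable (w j)) -> locL1 (rhs w i).
  move=> hw; apply: locL1D => //; apply: locL1_sum => j _; exact: locL1M.
have pz k i : lbounded_measurable (z k i).
  elim: k i => [|k IH] i; first exact: lbm_cst.
  have := primitiveD (primitive_cst (z0 i)) (primitive_integral0 (lrhs (z k) i IH)).
  by move=> /primitive_lbm.
pose h t := \sum_i \sum_j `|a i j t|.
have lh : locL1 h by apply: locL1_sum => i _; apply: locL1_sum => j _; exact: locL1_norm.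
have h0 t : 0 <= h t by apply: sumr_ge0 => i _; apply: sumr_ge0.
have pH := primitive_integral0 lh; set H := integral0 h in pH.
have pE := primitive_exp (primitiveZ 2 pH).
pose E t := expR (2 * H t); rewrite -/E in pE.
have H0 t : 0 <= t -> 0 <= H t by move=> t0; apply: integral0_ge0.
have E1 t : 0 <= t -> 1 <= E t.
  by move=> t0; rewrite -expR0 ler_expR mulr_ge0 // H0.
have bE : lbounded_measurable E by apply: lbm_exp; exact: primitive_lbm (primitiveZ 2 pH).
have lhE : locL1 (fun t => h t * E t) by exact: locL1M.
(* E has density 2 h E, so this integral is (E t - E 0) / 2: the origin of the contraction
   factor. *)
have iE t : 0 <= t -> integral0 (fun t => h t * E t) t <= 2^-1 * E t.
  move=> t0; have [_ /(_ t t0)] := pE.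
  have -> : integral0 (fun x => 2 * h x * expR (2 * H x)) t =
     2 * integral0 (fun t => h t * E t) t.
    rewrite -integral0Z //; apply: integral0_eq => x _; rewrite /E; ring.
  move: (E1 0 (lexx _)); rewrite -/(E t) -/(E 0).
  move: (E t) (E 0) (integral0 _ t) => Et E_0 I; lra.
have rhs_dist (v w : 'I_n -> R -> R) (c T : R) :
    (forall j, lbounded_measurable (v j)) -> (forall j, lbounded_measurable (w j)) ->
    0 <= T -> 0 <= c ->
    (forall j t, 0 <= t <= T -> `|v j t - w j t| <= c * E t) ->
    forall i t, 0 <= t <= T ->
    `|integral0 (rhs v i) t - integral0 (rhs w i) t| <= c * (2^-1 * E t).
  move=> bv bw T0 c0 hvw i t /andP[t0 tT].
  have pv := primitive_integral0 (lrhs v i bv).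
  have pw := primitive_integral0 (lrhs w i bw).
  have := primitive_dist (primitiveB pv pw) (primitiveZ c (primitive_integral0 lhE)) (lexx 0) t0.
  rewrite !integral0_0 !subr0 mulr0 subr0 => hd.
  apply: le_trans (hd _) _; last by rewrite ler_wpM2l // iE.
  move=> x /andP[x0 xt]; have xT : 0 <= x <= T by rewrite x0 (le_trans xt).
  have -> : rhs v i x - rhs w i x = \sum_j a i j x * (v j x - w j x).
    rewrite /rhs; under [RHS]eq_bigr do rewrite mulrBr.
    rewrite sumrB; ring.
  apply: le_trans (ler_norm_sum _ _ _) _.
  apply: le_trans (_ : \sum_j `|a i j x| * (c * E x) <= _).
    by apply: ler_sum => j _; rewrite normrM ler_wpM2l // hvw.
  rewrite -mulr_suml [leLHS]mulrCA; apply: ler_wpM2l => //.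
  apply: ler_wpM2r; first by rewrite (le_trans _ (E1 x x0)).
  by rewrite /h [leRHS](bigD1 i) //= lerDl; apply: sumr_ge0 => k _; apply: sumr_ge0.
pose c T := \sum_i (`|z0 i| + integral0 (fun t => `|rhs (z 0%N) i t|) T + `|z0 i|).
have c0 T : 0 <= T -> 0 <= c T.
  move=> T0; apply: sumr_ge0 => i _.
  by rewrite !addr_ge0 //; apply: integral0_ge0.
have step T (T0 : 0 <= T) k i t : 0 <= t <= T ->
    `|z k.+1 i t - z k i t| <= c T * 2^-1 ^+ k * E t.
  elim: k i t => [|k IH] i t tT; have /andP[t0 tT'] := tT.
    rewrite expr0 mulr1; apply: (@le_trans _ _ (c T)); last first.
      by rewrite -[leLHS]mulr1 ler_wpM2l ?c0 // E1.
    have -> : z 1%N i t - z 0%N i t = integral0 (rhs (z 0%N) i) t by rewrite /=; ring.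
    have lr := lrhs (z 0%N) i (pz 0%N).
    have pn := primitive_integral0 (locL1_norm lr).
    have := primitive_dist (primitive_integral0 lr) pn (lexx 0) t0 (fun x _ => lexx _).
    rewrite !integral0_0 !subr0 => /le_trans; apply.
    apply: le_trans (primitive_nondecr pn t0 tT' (fun x _ => normr_ge0 _)) _.
    rewrite /c (bigD1 i) //=; rewrite -addrA ler_wpDr //.
      by rewrite addr_ge0 //; apply: sumr_ge0 => j _; rewrite !addr_ge0 //; apply: integral0_ge0.
    by rewrite lerDr.
  have -> : z k.+2 i t - z k.+1 i t =
     integral0 (rhs (z k.+1) i) t - integral0 (rhs (z k) i) t by rewrite /=; ring.
  rewrite exprS [2^-1 * _]mulrC !mulrA -[leRHS]mulrA.
  apply: (rhs_dist _ _ _ T) => //.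
  by rewrite mulr_ge0 ?c0 // ltW // half_pow_gt0.
have step' (t : R) (t0 : 0 <= t) i k : `|z k.+1 i t - z k i t| <= c t * E t * 2^-1 ^+ k.
  by have := step t t0 k i t; rewrite t0 lexx => /(_ isT); rewrite mulrAC.
(* The value 0 at negative times is a mere default; every estimate assumes t >= 0. *)
pose lim_at (t : R) i : R :=
  match pselect (0 <= t) with
  | left t0 => sval (geometric_limit (step' t t0 i))
  | right _ => 0
  end.
have limE t i k : 0 <= t -> `|lim_at t i - z k i t| <= 2 * (c t * E t) * 2^-1 ^+ k.
  move=> t0; rewrite /lim_at; case: pselect => // t0'.
  by case: geometric_limit => l /=.
have cE (t T : R) : 0 <= t -> t <= T -> c t * E t <= c T * E T.
  move=> t0 tT; have T0 := le_trans t0 tT.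
  apply: ler_pM; [exact: c0|exact: le_trans ler01 (E1 t t0)| |].
    apply: ler_sum => i _; rewrite lerD2r lerD2l.
    have pn := primitive_integral0 (locL1_norm (lrhs (z 0%N) i (pz 0%N))).
    exact: (primitive_nondecr pn).
  by rewrite ler_expR ler_wpM2l // (primitive_nondecr pH).
have limT i T : 0 <= T -> forall t k, 0 <= t <= T ->
    `|lim_at t i - z k i t| <= 2 * (c T * E T) * 2^-1 ^+ k.
  move=> T0 t k /andP[t0 tT]; apply: le_trans (limE t i k t0) _.
  apply: ler_wpM2r; first exact: ltW (half_pow_gt0 k).
  by apply: ler_wpM2l; [|exact: cE].
pose w j t := lim_at t j.
have bw j : lbounded_measurable (w j) by apply: (lbm_limit (pz ^~ j) (limT j)).
exists (fun t => \col_i lim_at t i) => i.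
have eqw t : 0 <= t -> w i t = z0 i + integral0 (rhs w i) t.
  move=> t0; apply/eqP; rewrite -subr_eq0; apply/eqP.
  set C := 2 * (c t * E t); have C0 : 0 <= C.
    by rewrite !mulr_ge0 ?c0 // (le_trans _ (E1 t t0)).
  apply: (@half_pow_limit_eq0 _ (C * E t)) => k.
  have p0 := half_pow_gt0 k.
  have tt : 0 <= t <= t by rewrite t0 lexx.
  have d1 := limT i t t0 t k.+1 tt; rewrite -/C in d1.
  have d2 : `|integral0 (rhs (z k) i) t - integral0 (rhs w i) t|
            <= C * 2^-1 ^+ k * (2^-1 * E t).
    apply: (rhs_dist _ _ _ t) => //; first by rewrite mulr_ge0 // ltW.
    move=> j x xt; rewrite distrC; apply: le_trans (limT j t t0 x k xt) _.
    have /andP[x0 _] := xt.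
    by rewrite -[leLHS]mulr1 ler_wpM2l ?E1 // mulr_ge0 // ltW.
  have := ler_normD (w i t - z k.+1 i t) (integral0 (rhs (z k) i) t - integral0 (rhs w i) t).
  have -> : w i t - z k.+1 i t + (integral0 (rhs (z k) i) t - integral0 (rhs w i) t)
     = w i t - (z0 i + integral0 (rhs w i) t) by rewrite /=; ring.
  move=> /le_trans; apply; apply: le_trans (lerD d1 d2) _; rewrite exprS.
  have := ler_wpM2l (mulr_ge0 C0 (ltW p0)) (E1 t t0); lra.
split; first by rewrite mxE -/(w i 0) eqw // integral0_0 addr0.
have := primitiveD (primitive_cst (z0 i)) (primitive_integral0 (lrhs w i bw)).
apply: primitive_eq => t t0; first by rewrite mxE -eqw.
by rewrite add0r /rhs; congr (_ + _); apply: eq_bigr => j _; rewrite mxE.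
Qed.

End LinearODE.

(** * Matrix-valued primitives and positivity along matrix differential equations *)

Section MatrixPrimitives.
Context {R : realType}.

Definition mxprimitive a b (W w : R -> 'M[R]_(a, b)) :=
  forall i j, primitive (fun t => W t i j) (fun t => w t i j).

Definition mxlbm a b (W : R -> 'M[R]_(a, b)) :=
  forall i j, lbounded_measurable (fun t => W t i j).

Lemma norm1_entry a b (X : 'M[R]_(a, b)) i j : `|X i j| <= norm1 X.
Proof.
rewrite /norm1 (bigD1 i) //= (bigD1 j) //= -addrA lerDl addr_ge0 //.
  exact: sumr_ge0.
by apply: sumr_ge0 => k _; apply: sumr_ge0.
Qed.

Lemma mxprimitive_lbm a b (W w : R -> 'M[R]_(a, b)) : mxprimitive W w -> mxlbm W.
Proof. by move=> h i j; exact: primitive_lbm (h i j). Qed.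

Lemma mxprimitive_eq a b (W W' w w' : R -> 'M[R]_(a, b)) :
  (forall t, 0 <= t -> W t = W' t) -> (forall t, 0 <= t -> w t = w' t) ->
  mxprimitive W w -> mxprimitive W' w'.
Proof.
by move=> eW ew h i j; apply: primitive_eq (h i j) => t t0; rewrite ?eW ?ew.
Qed.

Lemma mxprimitive_cst a b (M : 'M[R]_(a, b)) : mxprimitive (fun=> M) (fun=> 0).
Proof. by move=> i j; apply: primitive_eq (primitive_cst (M i j)) => // t _; rewrite mxE. Qed.

Lemma mxprimitiveD a b (W w V v : R -> 'M[R]_(a, b)) :
  mxprimitive W w -> mxprimitive V v ->
  mxprimitive (fun t => W t + V t) (fun t => w t + v t).
Proof.
by move=> h k i j; apply: primitive_eq (primitiveD (h i j) (k i j)) => t _; rewrite mxE.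
Qed.

Lemma mxprimitive_scale a b (F f : R -> R) (M : 'M[R]_(a, b)) :
  primitive F f -> mxprimitive (fun t => F t *: M) (fun t => f t *: M).
Proof.
by move=> h i j; apply: primitive_eq (primitiveZ (M i j) h) => t _; rewrite mxE mulrC.
Qed.

Lemma mxprimitiveZ a b c (W w : R -> 'M[R]_(a, b)) : mxprimitive W w ->
  mxprimitive (fun t => c *: W t) (fun t => c *: w t).
Proof.
by move=> h i j; apply: primitive_eq (primitiveZ c (h i j)) => t _; rewrite mxE.
Qed.

Lemma mxprimitiveN a b (W w : R -> 'M[R]_(a, b)) : mxprimitive W w ->
  mxprimitive (fun t => - W t) (fun t => - w t).
Proof.
by move=> /(mxprimitiveZ (-1)); apply: mxprimitive_eq => t _; rewrite scaleN1r.
Qed.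

Lemma mxprimitive_sum a b (I : Type) (s : seq I) (W w : I -> R -> 'M[R]_(a, b)) :
  (forall i, mxprimitive (W i) (w i)) ->
  mxprimitive (fun t => \sum_(i <- s) W i t) (fun t => \sum_(i <- s) w i t).
Proof.
move=> h i j; apply: primitive_eq (primitive_sum s (P := xpredT) (fun k _ => h k i j));
  by move=> t _; rewrite summxE.
Qed.

Lemma mxprimitive_tr a b (W w : R -> 'M[R]_(a, b)) : mxprimitive W w ->
  mxprimitive (fun t => (W t)^T) (fun t => (w t)^T).
Proof. by move=> h i j; apply: primitive_eq (h j i) => t _; rewrite mxE. Qed.

Lemma mxprimitive_mull a b c (M : 'M[R]_(c, a)) (W w : R -> 'M[R]_(a, b)) :
  mxprimitive W w -> mxprimitive (fun t => M *m W t) (fun t => M *m w t).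
Proof.
move=> h i j; apply: primitive_eq
  (primitive_sum (index_enum _) (P := xpredT) (fun k _ => primitiveZ (M i k) (h k j)));
  by move=> t _; rewrite mxE.
Qed.

Lemma mxprimitive_mulr a b c (M : 'M[R]_(b, c)) (W w : R -> 'M[R]_(a, b)) :
  mxprimitive W w -> mxprimitive (fun t => W t *m M) (fun t => w t *m M).
Proof.
move=> h; have := mxprimitive_tr (mxprimitive_mull M^T (mxprimitive_tr h)).
by apply: mxprimitive_eq => t _; rewrite trmx_mul !trmxK.
Qed.

Lemma mxprimitive_lyap_op n k m (gamma : R) (A1 : 'M[R]_n) (A2 : 'M[R]_k)
    (N1 : 'I_m -> 'M[R]_n) (N2 : 'I_m -> 'M[R]_k) W w : mxprimitive W w ->
  mxprimitive (fun t => lyap_op gamma A1 A2 N1 N2 (W t))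
              (fun t => lyap_op gamma A1 A2 N1 N2 (w t)).
Proof.
move=> h; apply: mxprimitiveD.
  by apply: mxprimitiveD; [exact: mxprimitive_mull|exact: mxprimitive_mulr].
apply: mxprimitiveZ; apply: mxprimitive_sum => i.
by apply: mxprimitive_mulr; exact: mxprimitive_mull.
Qed.

Lemma primitive_bf_const n (W w : R -> 'M[R]_n) v : mxprimitive W w ->
  primitive (fun t => bf (W t) v v) (fun t => bf (w t) v v).
Proof. by move=> h; exact: (mxprimitive_mulr v (mxprimitive_mull v^T h)). Qed.

Lemma integral0_cst (c t : R) : 0 <= t -> integral0 (fun=> c) t = c * t.
Proof.
move=> t0; rewrite /integral0 Rintegral_cst //; congr (_ * _).
transitivity (fine t%:E) => //; congr fine.
apply: etrans (lebesgue_measure_itv `[0, t]) _; rewrite /= lte_fin sube0.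
by case: ltP => // t0'; congr (_%:E); apply/le_anti; rewrite t0 t0'.
Qed.

Lemma mxprimitive_lipschitz a b (W w : R -> 'M[R]_(a, b)) (T : R) : 0 <= T ->
  mxprimitive W w -> mxlbm w ->
  exists2 M, 0 <= M & forall s t, 0 <= s -> s <= t -> t <= T ->
    norm1 (W t - W s) <= M * (t - s).
Proof.
move=> T0 h bw.
have e i j : {M : R | forall x, 0 <= x <= T -> `|w x i j| <= M}.
  by apply/cid; have [_] := bw i j T T0.
exists (\sum_i \sum_j sval (e i j)).
  apply: sumr_ge0 => i _; apply: sumr_ge0 => j _; case: (e i j) => M hM /=.
  by apply: le_trans (hM 0 _) => //; rewrite lexx.
move=> s t s0 st tT; rewrite /norm1 mulr_suml; apply: ler_sum => i _.
rewrite mulr_suml; apply: ler_sum => j _; case: (e i j) => M hM /=.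
have pM : primitive (fun x => M * x) (fun=> M).
  split=> [|x x0]; first exact: locL1_cst.
  by rewrite integral0_cst // mulr0 add0r.
rewrite !mxE mulrBr; apply: (primitive_dist (h i j) pM) => // x /andP[sx xt].
by apply: hM; rewrite (le_trans s0) //= (le_trans xt).
Qed.

(* First-contact argument: at the last time t0 up to which W stays positive
   semidefinite, a kernel vector v of W t0 has d/dt v^T W v > 0, so v^T W v
   would have been negative just before. *)
Lemma psd_first_contact n (W w : R -> 'M[R]_n) (T : R) : 0 <= T ->
  mxprimitive W w -> mxlbm w -> (exists2 w', mxprimitive w w' & mxlbm w') ->
  (forall t, 0 <= t -> (W t)^T = W t) -> posdef (W 0) ->
  (forall t v, 0 <= t <= T -> psd (W t) -> v != 0 -> W t *m v = 0 ->
     0 < bf (w t) v v) ->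
  psd (W T).
Proof.
move=> T0 pW bw [w' pw bw'] sW W0 contact.
have [M M0 lipW] := mxprimitive_lipschitz T0 pW bw.
have [M' M'0 lipw] := mxprimitive_lipschitz T0 pw bw'.
have dW s t v : 0 <= s -> s <= t -> t <= T ->
    `|bf (W t) v v - bf (W s) v v| <= M * (t - s) * sqn v.
  move=> s0 st tT; rewrite -bfNm -bfDm; apply: le_trans (bf_le_norm1 _ _) _.
  by rewrite ler_wpM2r ?sqn_ge0 // lipW.
have dw s t v : 0 <= s -> s <= t -> t <= T ->
    `|bf (w t) v v - bf (w s) v v| <= M' * (t - s) * sqn v.
  move=> s0 st tT; rewrite -bfNm -bfDm; apply: le_trans (bf_le_norm1 _ _) _.
  by rewrite ler_wpM2r ?sqn_ge0 // lipw.
pose S := [set t : R | 0 <= t <= T /\ forall s, 0 <= s <= t -> psd (W s)].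
have S0 : S 0.
  split; first by rewrite lexx.
  by move=> s /le_anti <-; exact: posdef_psd.
have ubS : ubound S T by move=> t [/andP[]].
have hS : has_sup S by split; [exists 0|exists T].
have [t0 t0E] : {t0 | t0 = sup S} by exists (sup S).
have t0_ge0 : 0 <= t0 by rewrite t0E; apply: ub_le_sup => //; exact: hS.2.
have t0T : t0 <= T by rewrite t0E; apply: ge_sup => //; exists 0.
have before s : 0 <= s -> s < t0 -> psd (W s).
  rewrite t0E => s0 st0; have [|t [_ ht] st] := @sup_gt _ S s _ st0; first by exists 0.
  by apply: ht; rewrite s0 ltW.
have psd0 : psd (W t0).
  split=> [|v]; first exact: sW.
  have [->|v0] := eqVneq v 0; first by rewrite mulmx0 mxE.
  rewrite -/(bf _ _ _) leNgt; apply/negP => neg; set d := - bf (W t0) v v.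
  have d0 : 0 < d by rewrite /d; lra.
  have sv := sqn_gt0 v0.
  have [t0z|t0p] := eqVneq t0 0.
    by have := psd_bf v (posdef_psd W0); rewrite -t0z; lra.
  have t0_gt : 0 < t0 by rewrite lt_def t0p.
  pose e := Num.min t0 (d / (M * sqn v + 1)).
  have q0 : 0 < M * sqn v + 1 by have := mulr_ge0 M0 (ltW sv); lra.
  have e0 : 0 < e by rewrite lt_min t0_gt divr_gt0.
  have et : e <= t0 by rewrite ge_min lexx.
  have ed : e * (M * sqn v + 1) <= d by rewrite -ler_pdivlMr // ge_min lexx orbT.
  have s0 : 0 <= t0 - e by lra.
  have st : t0 - e < t0 by lra.
  have := dW (t0 - e) t0 v s0 (ltW st) t0T; have -> : t0 - (t0 - e) = e by ring.
  have := psd_bf v (before _ s0 st).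
  move: ed; rewrite /d ler_norml => + + /andP[+ _]; move: e0; clear.
  by move: e (bf _ _ _) (bf _ _ _) (sqn v) => e x y z e0 h1 h2 h3; nra.
have upto s : 0 <= s -> s <= t0 -> psd (W s).
  by move=> s0; rewrite le_eqVlt => /predU1P[->//|]; exact: before.
have [t0_eq|t0_neq] := eqVneq t0 T; first by rewrite -t0_eq.
have t0_lt : t0 < T by rewrite lt_def eq_sym t0_neq.
(* If W t0 is positive definite, the Lipschitz bound keeps W semidefinite a little beyond t0,
   against the choice of t0 as supremum. *)
have [pd|npd] := pselect (posdef (W t0)).
  have [c c0 hc] := posdef_coercive pd.
  pose e := Num.min (T - t0) (c / (M + 1)).
  have e0 : 0 < e by rewrite lt_min subr_gt0 t0_lt divr_gt0 //; lra.
  have eT : e <= T - t0 by rewrite ge_min lexx.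
  have ec : e * (M + 1) <= c by rewrite -ler_pdivlMr ?ge_min ?lexx ?orbT //; lra.
  suff : S (t0 + e) by move=> /(ub_le_sup hS.2); rewrite -t0E; lra.
  split; first by apply/andP; split; lra.
  move=> s /andP[s0 se]; have [st|/ltW st] := leP s t0; first exact: upto.
  split=> [|v]; first exact: sW.
  have := dW t0 s v t0_ge0 st _; have := hc v; have := sqn_ge0 v.
  rewrite -/(bf _ _ _) => v0 h1 h2.
  have sT : s <= T by lra.
  have := h2 sT; rewrite ler_norml => /andP[h3 _].
  have h4 : M * (s - t0) * sqn v <= c * sqn v.
    by apply: ler_wpM2r => //; have := ler_wpM2l M0 (_ : s - t0 <= e); nra.
  lra.
have [v v0 bv] : exists2 v, v != 0 & bf (W t0) v v = 0.
  apply: contrapT => h; apply: npd; split=> [|v v0]; first exact: sW.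
  rewrite -/(bf _ _ _) lt_def psd_bf // andbT; apply/eqP => e.
  by apply: h; exists v.
have kv := psd_kernel psd0 bv.
have tt : 0 <= t0 <= T by rewrite t0_ge0.
have := contact t0 v tt psd0 v0 kv; set eta := bf (w t0) v v => eta0.
have sv := sqn_gt0 v0.
have t0_gt : 0 < t0.
  rewrite lt_def t0_ge0 andbT; apply/eqP => z; move: bv.
  by rewrite z => bv; have := W0.2 v v0; rewrite -/(bf _ _ _) bv ltxx.
(* On [t0 - e, t0] the derivative of v^T W v stays above eta / 2, so the form would be negative at
   t0 - e. *)
pose e := Num.min t0 (eta / (2 * (M' * sqn v + 1))).
have q0 : 0 < M' * sqn v + 1 by have := mulr_ge0 M'0 (ltW sv); lra.
have e0 : 0 < e by rewrite lt_min t0_gt divr_gt0 // mulr_gt0.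
have et : e <= t0 by rewrite ge_min lexx.
have ed : e * (2 * (M' * sqn v + 1)) <= eta.
  by rewrite -ler_pdivlMr ?mulr_gt0 // ge_min lexx orbT.
have s0 : 0 <= t0 - e by lra.
have st : t0 - e <= t0 by lra.
have pV := primitive_bf_const v pW.
have pC : primitive (fun x => eta / 2 * x) (fun=> eta / 2).
  split=> [|x x0]; first exact: locL1_cst.
  by rewrite integral0_cst // mulr0 add0r.
have := primitive_le pC pV s0 st; rewrite bv => /(_ _) hh.
have : eta / 2 * t0 - eta / 2 * (t0 - e) <= 0 - bf (W (t0 - e)) v v.
  apply: hh => x /andP[sx xt]; have x0 := le_trans s0 sx.
  have := dw x t0 v x0 xt t0T; rewrite ler_norml -/eta => /andP[_ h1].
  have h2 : M' * (t0 - x) * sqn v <= e * (M' * sqn v).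
    have := ler_wpM2r (mulr_ge0 M'0 (ltW sv)) (_ : t0 - x <= e); nra.
  nra.
have := psd_bf v (upto _ s0 st); nra.
Qed.

Lemma lyap_op_lyapd n m (gamma : R) (A : 'M[R]_n) (N : 'I_m -> 'M[R]_n) X :
  lyap_op gamma A A N N X = lyapd (gamma ^+ 2)^-1 A^T (fun k => (N k)^T) X.
Proof.
rewrite -lyap_op_dual /lyap_op !trmxK; congr (_ + _ *: _).
by apply: eq_bigr => k _; rewrite !trmxK.
Qed.

(** D is perturbed by e exp(K t) I, which makes the initial value definite. As K I dominates L I +
    I, the derivative at a contact is strictly positive and [psd_first_contact] applies; then e
    tends to 0. *)
Lemma lyapunov_ode_psd n m (gamma : R) (A : 'M[R]_n) (N : 'I_m -> 'M[R]_n)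
    (F : 'M[R]_n) (D : R -> 'M[R]_n) :
  psd F -> psd (D 0) -> (forall t, 0 <= t -> (D t)^T = D t) ->
  mxprimitive D (fun t => lyap_op gamma A A N N (D t) + F) ->
  forall t, 0 <= t -> psd (D t).
Proof.
move=> pF pD0 sD pD T T0; set L := lyap_op gamma A A N N in pD.
set g := (gamma ^+ 2)^-1; have g0 : 0 <= g by rewrite invr_ge0 sqr_ge0.
pose K := norm1 (L 1%:M) + 1.
have K0 : 0 < K by rewrite ltr_wpDl // norm1_ge0.
pose ex (t : R) := expR (K * t).
have pK : primitive (fun t : R => K * t) (fun=> K).
  split=> [|x x0]; first exact: locL1_cst.
  by rewrite integral0_cst // mulr0 add0r.
have pex : primitive ex (fun t => K * ex t) by exact: primitive_exp pK.
suff key (e : R) : 0 < e -> psd (D T + (e * ex T) *: 1%:M).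
  split=> [|v]; first exact: sD.
  rewrite -/(bf _ _ _); apply/ler_addgt0Pl => d d0.
  have p0 : 0 < ex T * (sqn v + 1).
    by rewrite mulr_gt0 ?expR_gt0 // ltr_wpDl // sqn_ge0.
  have := psd_bf v (key (d / (ex T * (sqn v + 1))) (divr_gt0 d0 p0)).
  rewrite bfDm bfZm bf1 => h; apply: le_trans h _; rewrite addrC lerD2r.
  rewrite -[leLHS]mulrA [leLHS]mulrAC ler_pdivrMr // ler_pM2l //.
  by rewrite ler_pM2l ?expR_gt0 // lerDl.
move=> e0.
have pE : mxprimitive (fun t => (e * ex t) *: 1%:M) (fun t => (e * (K * ex t)) *: (1%:M : 'M[R]_n)).
  by apply: mxprimitive_scale; exact: primitiveZ.
pose w t := L (D t) + F + (e * (K * ex t)) *: 1%:M.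
have pL := mxprimitive_lyap_op gamma A A N N pD; rewrite -/L in pL.
have pw : mxprimitive w (fun t => L (L (D t) + F) + 0 + (e * (K * (K * ex t))) *: 1%:M).
  apply: mxprimitiveD; first by apply: mxprimitiveD => //; exact: mxprimitive_cst.
  by apply: mxprimitive_scale; do 2 apply: primitiveZ.
apply: (@psd_first_contact n (fun t => D t + (e * ex t) *: 1%:M) w T) => //.
- exact: mxprimitiveD.
- exact: mxprimitive_lbm pw.
- exists (fun t => L (L (D t) + F) + 0 + (e * (K * (K * ex t))) *: 1%:M) => //.
  apply: mxprimitive_lbm; apply: mxprimitiveD; last first.
    by apply: mxprimitive_scale; do 3 apply: primitiveZ; exact: pex.
  apply: mxprimitiveD; last exact: mxprimitive_cst.
  by apply: mxprimitive_lyap_op; apply: mxprimitiveD; [exact: pL|exact: mxprimitive_cst].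
- by move=> t t0; rewrite linearD /= linearZ /= trmx1 sD.
- rewrite addrC; apply: posdefD => //; apply: posdefZ; last exact: posdef1.
  by rewrite mulr_gt0 // expR_gt0.
move=> t v _ pW v0 kW; have et : 0 < e * ex t by rewrite mulr_gt0 // expR_gt0.
have := lyapd_kernel_ge0 A^T (fun k => (N k)^T) g0 pW kW.
rewrite -lyap_op_lyapd -/L => hL.
have -> : w t = L (D t + (e * ex t) *: 1%:M) - (e * ex t) *: L 1%:M + F
    + (e * (K * ex t)) *: 1%:M.
  by rewrite /w /L !lyap_op_lyapd lyapdD lyapdZ addrK.
move: hL; move: (L (D t + _)) => X hL.
rewrite !bfDm bfNm !bfZm bf1.
have := bf_le_norm1 (L 1%:M) v; have := ler_norm (bf (L 1%:M) v v).
have := psd_bf v pF; have sv := sqn_gt0 v0.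
move=> h1 h2 h3.
have h4 : bf (L 1%:M) v v + sqn v <= K * sqn v by rewrite /K mulrDl mul1r lerD2r; exact: le_trans h2 h3.
have := ler_wpM2l (ltW et) h4; have := mulr_gt0 et sv.
rewrite [e * (K * ex t)]mulrCA mulrDr; move: hL h1; lra.
Qed.

End MatrixPrimitives.

(** * Integrals over the half-line *)

Section HalfLine.
Context {R : realType}.
Local Notation mu := (@lebesgue_measure R).
Implicit Types (f g : R -> R).

Lemma half_line_bigcup : `[0%R, +oo[%classic = \bigcup_n `[0%R, n%:R]%classic :> set R.
Proof.
apply/seteqP; split=> [x /=|x [n _] /=]; rewrite !in_itv /=; last by case/andP=> ->.
rewrite andbT => x0; exists (Num.truncn x).+1 => //=.
by rewrite in_itv /= x0 ltW // truncnS_gt.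
Qed.

Lemma locL1_measurable_half_line f : locL1 f ->
  @measurable_fun _ _ R R `[0%R, +oo[ f.
Proof.
move=> lf; rewrite half_line_bigcup; apply/measurable_fun_bigcup => // n.
by apply/measurable_EFinP; exact: measurable_int (lf n%:R (ler0n _ _)).
Qed.

Lemma integral0_EFin f t : locL1 f -> 0 <= t ->
  (\int[mu]_(x in `[0%R, t]) (f x)%:E)%E = (integral0 f t)%:E.
Proof. by move=> lf t0; rewrite fineK //; apply: integrable_fin_num => //; exact: lf. Qed.

Lemma half_line_cvg f : locL1 f -> (forall x, 0 <= x -> 0 <= f x) ->
  (integral0 f n%:R)%:E @[n --> \oo] --> (\int[mu]_(x in `[0%R, +oo[) (f x)%:E)%E.
Proof.
move=> lf f0; rewrite half_line_bigcup.
have -> : (fun n : nat => (integral0 f n%:R)%:E) =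
    (fun n : nat => (\int[mu]_(x in `[0%R, n%:R]) (f x)%:E)%E).
  by apply/funext => n; rewrite integral0_EFin.
apply: ge0_nondecreasing_set_cvg_integral => //.
- move=> n k nk; apply/subsetPset; apply: subset_itvl.
  by rewrite bnd_simp ler_nat.
- move=> n; exact: measurable_int (lf n%:R (ler0n _ _)).
- by move=> n x; rewrite mem_itv0 => /andP[x0 _]; rewrite lee_fin f0.
Qed.

Lemma half_line_le f (M : R) : locL1 f -> (forall x, 0 <= x -> 0 <= f x) ->
  (forall t, 0 <= t -> integral0 f t <= M) ->
  (\int[mu]_(x in `[0%R, +oo[) (f x)%:E <= M%:E)%E.
Proof.
move=> lf f0 h; have c := half_line_cvg lf f0.
rewrite -(cvg_lim _ c) //; apply: lime_le; first exact: cvgP c.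
by apply: nearW => n; rewrite lee_fin h.
Qed.

Lemma half_line_ge f (t : R) : locL1 f -> (forall x, 0 <= x -> 0 <= f x) -> 0 <= t ->
  ((integral0 f t)%:E <= \int[mu]_(x in `[0%R, +oo[) (f x)%:E)%E.
Proof.
move=> lf f0 t0; rewrite -integral0_EFin //; apply: ge0_subset_integral => //.
- by apply/measurable_EFinP; exact: locL1_measurable_half_line.
- by move=> x /=; rewrite in_itv /= andbT lee_fin; exact: f0.
- by move=> x /=; rewrite !in_itv /= => /andP[->].
Qed.

Lemma half_line_integrable f (M : R) : locL1 f ->
  (forall t, 0 <= t -> integral0 (fun x => `|f x|) t <= M) ->
  mu.-integrable `[0%R, +oo[ (EFin \o f).
Proof.
move=> lf h; apply/integrableP; split.
  by apply/measurable_EFinP; exact: locL1_measurable_half_line.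
apply: le_lt_trans (ltry M); exact: half_line_le (locL1_norm lf) _ h.
Qed.

Lemma half_line_locL1 f : mu.-integrable `[0%R, +oo[ (EFin \o f) -> locL1 f.
Proof.
move=> h t t0; apply: integrableS h => //.
by move=> x /=; rewrite !in_itv /= => /andP[->].
Qed.

Lemma half_line_lim_ge0 f : (forall x, 0 <= x -> 0 <= f x) ->
  mu.-integrable `[0%R, +oo[ (EFin \o f) ->
  integral0 f n%:R @[n --> \oo] --> \int[mu]_(x in `[0%R, +oo[) f x.
Proof.
move=> f0 h; have c := half_line_cvg (half_line_locL1 h) f0.
have fn : (\int[mu]_(x in `[0%R, +oo[) (f x)%:E)%E \is a fin_num.
  exact: integrable_fin_num.
by move: c; rewrite -(fineK fn) => /fine_cvg.
Qed.

Lemma half_line_lim f : mu.-integrable `[0%R, +oo[ (EFin \o f) ->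
  integral0 f n%:R @[n --> \oo] --> \int[mu]_(x in `[0%R, +oo[) f x.
Proof.
move=> h; have hn := integrable_norm h; have l := half_line_locL1 h.
have hs : mu.-integrable `[0%R, +oo[ (EFin \o (fun x => f x + `|f x|)).
  exact: (integrableD _ h hn).
have c1 := half_line_lim_ge0 (fun x _ => normr_ge0 (f x)) hn.
have f2 x : 0 <= x -> 0 <= f x + `|f x|.
  by move=> _; have := ler_norm (- f x); rewrite normrN; lra.
have c2 := half_line_lim_ge0 f2 hs.
have -> : \int[mu]_(x in `[0%R, +oo[) f x =
   \int[mu]_(x in `[0%R, +oo[) (f x + `|f x|) - \int[mu]_(x in `[0%R, +oo[) `|f x|.
  by rewrite RintegralD // addrK.
have -> : (fun n : nat => integral0 f n%:R) =
   (fun n : nat => integral0 (fun x => f x + `|f x|) n%:R - integral0 (fun x => `|f x|) n%:R).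
  by apply/funext => n; rewrite integral0D ?addrK //; exact: locL1_norm.
exact: cvgB.
Qed.

(** Upgrades convergence along integers to all large t: past n the remaining mass of |f| is at most
    e / 2, and t is compared with an integer j beyond it. *)
Lemma half_line_tail f (e : R) : mu.-integrable `[0%R, +oo[ (EFin \o f) -> 0 < e ->
  exists2 T, 0 <= T & forall t, T <= t ->
    `|integral0 f t - \int[mu]_(x in `[0%R, +oo[) f x| <= e.
Proof.
move=> h e0; have hn := integrable_norm h; have l := half_line_locL1 h.
have pf := primitive_integral0 l; have pn := primitive_integral0 (locL1_norm l).
have /cvgrPdist_le c1 := half_line_lim_ge0 (fun x _ => normr_ge0 (f x)) hn.
have e2 : 0 < e / 2 by rewrite divr_gt0.
have [n _ hN] := c1 (e / 2) e2; exists n%:R => // t nt.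
have t0 : 0 <= t by exact: le_trans nt.
have /cvgrPdist_le c2 := half_line_lim h.
have [k _ hk] := c2 (e / 2) e2.
pose j := maxn (maxn n k) (Num.truncn t).+1.
have tj : t <= j%:R.
  by apply: le_trans (ltW (truncnS_gt t)) _; rewrite ler_nat leq_maxr.
have kj : (k <= j)%N by rewrite /j leq_max leq_max leqnn orbT.
have fn : integral0 (fun x => `|f x|) j%:R <= \int[mu]_(x in `[0%R, +oo[) `|f x|.
  rewrite -lee_fin [leRHS]fineK; last exact: (integrable_fin_num _ hn).
  exact: half_line_ge (locL1_norm l) _ _.
have num (x y z X Y Z G : R) : X <= Y -> `|y - x| <= Z - Y -> Z <= G ->
    `|G - X| <= e / 2 -> `|z - y| <= e / 2 -> `|x - z| <= e.
  clear; rewrite !ler_norml => h1 /andP[h2 h3] h4 /andP[h5 h6] /andP[h7 h8].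
  by apply/andP; split; lra.
apply: num fn (hN n (leqnn n)) (hk j kj).
  exact: (primitive_nondecr pn (ler0n _ n) nt (fun x _ => normr_ge0 _)).
exact: (primitive_dist pf pn t0 tj (fun x _ => lexx _)).
Qed.

(** Otherwise |f| >= |c| / 2 from some time on, and an interval of length [d] would carry the mass M
    + 1, above the bound M of all integrals of |f|. *)
Lemma half_line_integrable_lim0 f (c : R) :
  mu.-integrable `[0%R, +oo[ (EFin \o f) ->
  (forall e, 0 < e -> exists T, forall t, T <= t -> `|f t - c| <= e) -> c = 0.
Proof.
move=> h hc; apply/eqP; apply: contraT => c0; have nc : 0 < `|c| by rewrite normr_gt0.
have l := locL1_norm (half_line_locL1 h).
have [T hT] := hc (`|c| / 2) (divr_gt0 nc (ltr0Sn _ 1)).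
have hn := integrable_norm h.
have [M hM] : exists M : R, forall t, 0 <= t -> integral0 (fun x => `|f x|) t <= M.
  exists (fine (\int[mu]_(x in `[0%R, +oo[) (`|f x|)%:E)%E) => t t0.
  rewrite -lee_fin [leRHS]fineK; last exact: (integrable_fin_num _ hn).
  exact: half_line_ge.
pose T0 := Num.max T 0; have T00 : 0 <= T0 by rewrite le_max lexx orbT.
have M0 : 0 <= M.
  by apply: le_trans (hM 0 (lexx _)); rewrite integral0_0.
pose d := 2 * (M + 1) / `|c|; have d0 : 0 <= d by rewrite divr_ge0 //; lra.
have pc : primitive (fun x => `|c| / 2 * x) (fun=> `|c| / 2).
  split=> [|x x0]; first exact: locL1_cst.
  by rewrite integral0_cst // mulr0 add0r.
have Td : T0 <= T0 + d by rewrite lerDl.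
have := primitive_le pc (primitive_integral0 l) T00 Td => /(_ _) hle.
have : `|c| / 2 * (T0 + d) - `|c| / 2 * T0 <=
   integral0 (fun x => `|f x|) (T0 + d) - integral0 (fun x => `|f x|) T0.
  apply: hle => x /andP[x1 _].
  have Tx : T <= x by apply: le_trans x1; rewrite le_max lexx.
  have := hT x Tx; have := ler_normD (f x) (c - f x).
  rewrite addrC subrK distrC; lra.
rewrite -mulrBr addrAC subrr add0r.
have -> : `|c| / 2 * d = M + 1 by rewrite /d; field; rewrite gt_eqF.
have := hM _ (le_trans T00 Td); have : 0 <= integral0 (fun x => `|f x|) T0.
  by apply: integral0_ge0.
by lra.
Qed.

End HalfLine.

(** * The reduced Gramian: existence and Lyapunov equation *)

Section Gramian.
Context {R : realType}.
Local Notation mu := (@lebesgue_measure R).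

Lemma solution_primitive a b (f : R -> 'M[R]_(a, b) -> 'M[R]_(a, b)) X0 X :
  is_solution f X0 X -> mxprimitive X (fun t => f t (X t)) /\ X 0 = X0.
Proof.
move=> h; have e0 i j : X 0 i j = X0 i j.
  have [_ ->] := h 0 (lexx 0) i j; rewrite -[RHS]addr0; congr (_ + _).
  exact: integral0_0.
split; last by apply/matrixP => i j; exact: e0.
move=> i j; split=> t t0; have [h1 h2] := h t t0 i j; first exact: h1.
by rewrite e0 h2.
Qed.

Definition integral_mx n k (Z : R -> 'M[R]_(n, k)) (t : R) : 'M[R]_(n, k) :=
  \matrix_(i, j) integral0 (fun s => Z s i j) t.

Lemma integral_mx_primitive n k (Z : R -> 'M[R]_(n, k)) :
  (forall i j, locL1 (fun s => Z s i j)) -> mxprimitive (integral_mx Z) Z.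
Proof.
move=> lZ i j; apply: primitive_eq (primitive_integral0 (lZ i j)) => // t _.
by rewrite mxE.
Qed.

Lemma integral_mx0 n k (Z : R -> 'M[R]_(n, k)) : integral_mx Z 0 = 0.
Proof. by apply/matrixP => i j; rewrite !mxE integral0_0. Qed.

Lemma lyap_op0 n k m (gamma : R) (A1 : 'M[R]_n) (A2 : 'M[R]_k)
    (N1 : 'I_m -> 'M[R]_n) (N2 : 'I_m -> 'M[R]_k) : lyap_op gamma A1 A2 N1 N2 0 = 0.
Proof.
rewrite /lyap_op mulmx0 mul0mx big1 ?scaler0 ?addr0 // => i _.
by rewrite mulmx0 mul0mx.
Qed.

Lemma mxprimitive_unique n k (W W' w : R -> 'M[R]_(n, k)) t : 0 <= t ->
  mxprimitive W w -> mxprimitive W' w -> W 0 = W' 0 -> W t = W' t.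
Proof.
move=> t0 h h' e; apply/matrixP => i j.
by rewrite (h i j).2 // (h' i j).2 // e.
Qed.

Lemma matrix_ode_integral n m (gamma : R) (A : 'M[R]_n) (N : 'I_m -> 'M[R]_n) Z t :
  0 <= t -> mxprimitive Z (fun t => lyap_op gamma A A N N (Z t)) ->
  Z t = Z 0 + lyap_op gamma A A N N (integral_mx Z t).
Proof.
move=> t0 pZ; have lZ i j : locL1 (fun s => Z s i j) by apply: lbm_locL1; exact: mxprimitive_lbm pZ i j.
have pI := mxprimitiveD (mxprimitive_cst (Z 0)) (mxprimitive_lyap_op gamma A A N N (integral_mx_primitive lZ)).
apply: (@mxprimitive_unique _ _ Z
  (fun t => Z 0 + lyap_op gamma A A N N (integral_mx Z t)) _ t t0 pZ).
  by apply: mxprimitive_eq pI => // x _; rewrite add0r.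
by rewrite integral_mx0 lyap_op0 addr0.
Qed.

Lemma lyap_op_continuous n m (gamma : R) (A : 'M[R]_n) (N : 'I_m -> 'M[R]_n) :
  exists2 K, 0 <= K & forall X Y i j,
    `|lyap_op gamma A A N N X i j - lyap_op gamma A A N N Y i j| <= K * norm1 (X - Y).
Proof.
pose L := lyap_op gamma A A N N.
have LB X Y : L X - L Y = L (X - Y) by rewrite /L !lyap_op_lyapd -lyapdN -lyapdD.
have LD X Y : L (X + Y) = L X + L Y by rewrite /L !lyap_op_lyapd lyapdD.
have LZ a X : L (a *: X) = a *: L X by rewrite /L !lyap_op_lyapd lyapdZ.
have L0 : L 0 = 0 by exact: lyap_op0.
exists (\sum_k \sum_l norm1 (L (delta_mx k l))).
  by apply: sumr_ge0 => k _; apply: sumr_ge0 => l _; exact: norm1_ge0.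
move=> X Y i j; rewrite -/L.
have -> : L X i j - L Y i j = L (X - Y) i j by rewrite -LB !mxE.
move: (X - Y) => D; rewrite {1}[D]matrix_sum_delta.
rewrite (big_morph L LD L0) summxE mulr_suml.
apply: le_trans (ler_norm_sum _ _ _) _; apply: ler_sum => k _.
rewrite (big_morph L LD L0) summxE mulr_suml.
apply: le_trans (ler_norm_sum _ _ _) _; apply: ler_sum => l _.
rewrite LZ mxE normrM mulrC ler_pM //; exact: norm1_entry.
Qed.

(** Z t = Z 0 + L(integral of Z up to t) converges to Z 0 + L(gramian Z), and an integrable function
    can only converge to 0. No decay rate of Z enters. *)
Lemma gramian_lyapunov n m (gamma : R) (A : 'M[R]_n) (N : 'I_m -> 'M[R]_n) Z :
  mxprimitive Z (fun t => lyap_op gamma A A N N (Z t)) -> gramian_exists Z ->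
  lyap_op gamma A A N N (gramian Z) = - Z 0.
Proof.
move=> pZ eZ; set L := lyap_op gamma A A N N.
have lZ i j : locL1 (fun s => Z s i j) := half_line_locL1 (eZ i j).
have [K K0 hK] := lyap_op_continuous gamma A N.
apply/eqP; rewrite -addr_eq0; apply/eqP/matrixP => i j; rewrite [RHS]mxE addrC.
apply: (half_line_integrable_lim0 (eZ i j)) => e e0.
pose d := e / ((K + 1) * (n * n)%:R + 1).
have q0 : 0 < (K + 1) * (n * n)%:R + 1 by rewrite ltr_wpDl // mulr_ge0 // ?ler0n //; lra.
have d0 : 0 < d by rewrite divr_gt0.
have tail k l := cid2 (half_line_tail (eZ k l) d0).
pose T := \sum_k \sum_l s2val (tail k l).
have Tkl k l : s2val (tail k l) <= T.
  have p a b : 0 <= s2val (tail a b) by case: (tail a b).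
  rewrite /T (bigD1 k) //= (bigD1 l) //= -addrA lerDl addr_ge0 //; first exact: sumr_ge0.
  by apply: sumr_ge0 => a _; exact: sumr_ge0.
have T0 : 0 <= T by apply: sumr_ge0 => k _; apply: sumr_ge0 => l _; case: (tail k l).
exists T => t Tt; have t0 := le_trans T0 Tt.
have eD (X Y V : 'M[R]_n) : (X + Y) i j - (X + V) i j = Y i j - V i j.
  by rewrite !mxE; ring.
rewrite (matrix_ode_integral t0 pZ) eD.
apply: le_trans (hK _ _ _ _) _.
apply: (@le_trans _ _ (K * ((n * n)%:R * d))).
  apply: ler_wpM2l => //; rewrite /norm1.
  apply: (@le_trans _ _ (\sum_(k < n) \sum_(l < n) d)).
    apply: ler_sum => k _; apply: ler_sum => l _; rewrite !mxE.
    case: (tail k l) (Tkl k l) => T' T'0 hT' /= T'T; apply: hT'.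
    exact: le_trans T'T Tt.
  by rewrite !sumr_const card_ord -mulrnA mulr_natl.
rewrite /d !mulrA ler_pdivrMr // [leRHS]mulrC ler_pM2r // mulrDl mul1r.
have : 0 <= (n * n)%:R :> R by rewrite ler0n.
lra.
Qed.

Lemma lyap_op_tr n m (gamma : R) (A : 'M[R]_n) (N : 'I_m -> 'M[R]_n) X :
  (lyap_op gamma A A N N X)^T = lyap_op gamma A A N N X^T.
Proof. by rewrite !lyap_op_lyapd lyapd_tr. Qed.

(** Gronwall for the sum of the squared entries. It serves to show that Z stays symmetric, since Z^T
    - Z solves the same equation from 0. *)
Lemma lyapunov_ode_zero n m (gamma : R) (A : 'M[R]_n) (N : 'I_m -> 'M[R]_n) U :
  mxprimitive U (fun t => lyap_op gamma A A N N (U t)) -> U 0 = 0 ->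
  forall t, 0 <= t -> U t = 0.
Proof.
move=> pU U0 T T0; set L := lyap_op gamma A A N N in pU.
have [K K0 hK] := lyap_op_continuous gamma A N.
pose V t := \sum_i \sum_j U t i j * U t i j.
have pV : primitive V (fun t => \sum_i \sum_j (L (U t) i j * U t i j + U t i j * L (U t) i j)).
  by apply: primitive_sum => i _; apply: primitive_sum => j _; apply: primitiveM.
have sq0 t i j : 0 <= U t i j * U t i j by rewrite -expr2 sqr_ge0.
have V0 t : 0 <= V t by apply: sumr_ge0 => i _; apply: sumr_ge0 => j _.
have entry t i j : U t i j * U t i j <= V t.
  rewrite /V (bigD1 i) //= (bigD1 j) //= -addrA lerDl addr_ge0 //; first exact: sumr_ge0.
  by apply: sumr_ge0 => a _; exact: sumr_ge0.
pose c : R := \sum_(i < n) \sum_(j < n) (2 * K * \sum_(k < n) \sum_(l < n) 1).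
have c0 : 0 <= c.
  apply: sumr_ge0 => i _; apply: sumr_ge0 => j _; rewrite mulr_ge0 ?mulr_ge0 //.
  by apply: sumr_ge0 => k _; apply: sumr_ge0.
have := @energy_gronwall R V _ (fun=> 0) (fun=> 0) (fun=> c) T T0 pV
  (locL1_cst 0) (locL1_cst 0) (locL1_cst c).
have -> : V 0 = 0 by rewrite /V U0 big1 // => i _; rewrite big1 // => j _; rewrite mxE mulr0.
rewrite integral0_cst // mul0r !addr0 mul0r => h.
have {h} VT : V T <= 0.
  apply: h => // t _; rewrite add0r addr0 /c mulr_suml; apply: ler_sum => i _.
  rewrite mulr_suml; apply: ler_sum => j _.
  have -> : L (U t) i j * U t i j + U t i j * L (U t) i j = 2 * (L (U t) i j * U t i j) by ring.
  rewrite -!mulrA; apply: ler_wpM2l => //.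
  apply: le_trans (ler_norm _) _; rewrite normrM.
  have := hK (U t) 0 i j; rewrite lyap_op0 subr0 [X in _ - X]mxE subr0 -/L => hL.
  apply: le_trans (ler_wpM2r (normr_ge0 _) hL) _; rewrite -mulrA.
  apply: ler_wpM2l => //; rewrite /norm1 !mulr_suml; apply: ler_sum => k _.
  rewrite !mulr_suml; apply: ler_sum => l _; rewrite mul1r.
  have := entry t i j; have := entry t k l; rewrite -!expr2.
  have := sqr_ge0 (`|U t k l| - `|U t i j|).
  rewrite -[U t k l ^+ 2]real_normK ?num_real // -[U t i j ^+ 2]real_normK ?num_real //.
  nra.
apply/matrixP => i j; rewrite mxE; apply/eqP; rewrite -sqrf_eq0 expr2 eq_le sq0 andbT.
exact: le_trans (entry T i j) VT.
Qed.

(* With D = Th - \int_0^t Z one has D' = L D + G, so D stays nonnegative. *)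
Lemma gramian_exists_bounded n m (gamma : R) (A : 'M[R]_n) (N : 'I_m -> 'M[R]_n) Z
    (Th G : 'M[R]_n) :
  mxprimitive Z (fun t => lyap_op gamma A A N N (Z t)) -> psd (Z 0) ->
  psd Th -> psd G -> lyap_op gamma A A N N Th = - Z 0 - G -> gramian_exists Z.
Proof.
move=> pZ pZ0 pTh pG eTh; set L := lyap_op gamma A A N N in pZ eTh.
have lZ i j : locL1 (fun s => Z s i j).
  by apply: lbm_locL1; exact: mxprimitive_lbm pZ i j.
have sZ t : 0 <= t -> (Z t)^T = Z t.
  move=> t0; apply/eqP; rewrite -subr_eq0; apply/eqP.
  apply: (@lyapunov_ode_zero n m gamma A N (fun t => (Z t)^T - Z t)) => //.
    have := mxprimitiveD (mxprimitive_tr pZ) (mxprimitiveN pZ).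
    apply: mxprimitive_eq => // x _.
    by rewrite /L lyap_op_tr !lyap_op_lyapd -lyapdN -lyapdD.
  by rewrite pZ0.1 subrr.
have psdZt t : 0 <= t -> psd (Z t).
  apply: (@lyapunov_ode_psd R n m gamma A N 0 Z psd0 pZ0 sZ).
  by apply: mxprimitive_eq pZ => // x _; rewrite addr0.
have pI := integral_mx_primitive lZ.
have psdD t : 0 <= t -> psd (Th - integral_mx Z t).
  apply: (@lyapunov_ode_psd R n m gamma A N G (fun t => Th - integral_mx Z t) pG).
  - by rewrite integral_mx0 subr0.
  - move=> x x0; rewrite linearB /= pTh.1; congr (_ - _).
    apply/matrixP => i j; rewrite !mxE; apply: integral0_eq => y /andP[y0 _].
    by rewrite -{1}(sZ y y0) mxE.
  have := mxprimitiveD (mxprimitive_cst Th) (mxprimitiveN pI).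
  apply: mxprimitive_eq => // x x0; rewrite add0r (matrix_ode_integral x0 pZ) -/L.
  have -> : L (Th - integral_mx Z x) = L Th - L (integral_mx Z x).
    by rewrite /L !lyap_op_lyapd lyapdD lyapdN.
  by rewrite eTh; move: (L _) => X; apply/matrixP => i j; rewrite !mxE; ring.
have Idiag i t : 0 <= t -> integral0 (fun s => Z s i i) t <= \tr Th.
  move=> t0; apply: le_trans (psd_diag_le i pTh).
  by have := psd_diag_ge0 i (psdD t t0); rewrite !mxE subr_ge0.
move=> i j; apply: (half_line_integrable (M := \tr Th + \tr Th)) => // t t0.
apply: le_trans (lerD (Idiag i t t0) (Idiag j t t0)); rewrite -integral0D //.
apply: integral0_le => //; [exact: locL1_norm|exact: locL1D|].
by move=> x /andP[x0 _]; exact: psd_entry_bound (psdZt x x0).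
Qed.

End Gramian.

(** * The homogeneous subsystem *)

Section QuadraticEnergy.
Context {R : realType}.

(** Sum over i and j of the nonnegative forms at v_j e_i - v_i e_j. This is how the trace and
    |v_0|^2 separate in the final bound. *)
Lemma psd_le_trace n (M : 'M[R]_n) v : psd M -> bf M v v <= \tr M * sqn v.
Proof.
move=> pM; have h i j : 2 * (v i ord0 * M i j * v j ord0)
    <= M i i * v j ord0 ^+ 2 + M j j * v i ord0 ^+ 2.
  have := psd_bf (v j ord0 *: delta_mx i ord0 - v i ord0 *: delta_mx j ord0) pM.
  rewrite bfDl !bfDr !bfNl !bfNr !bfZl !bfZr !bf_delta.
  have -> : M j i = M i j by rewrite -{1}pM.1 mxE.
  lra.
have : \sum_i \sum_j 2 * (v i ord0 * M i j * v j ord0) <=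
    \sum_i \sum_j (M i i * v j ord0 ^+ 2 + M j j * v i ord0 ^+ 2).
  by apply: ler_sum => i _; apply: ler_sum => j _.
have -> : \sum_i \sum_j 2 * (v i ord0 * M i j * v j ord0) = 2 * bf M v v.
  by rewrite bfE mulr_sumr; apply: eq_bigr => i _; rewrite mulr_sumr.
have -> : \sum_i \sum_j (M i i * v j ord0 ^+ 2 + M j j * v i ord0 ^+ 2)
    = 2 * (\tr M * sqn v); last by lra.
have e1 : \sum_i \sum_j M i i * v j ord0 ^+ 2 = \tr M * sqn v.
  by rewrite mulr_suml; apply: eq_bigr => i _; rewrite mulr_sumr.
under eq_bigr => i _ do rewrite big_split /=.
rewrite big_split /= [X in _ + X]exchange_big /= e1; ring.
Qed.

(** The form at gamma a v - gamma^-1 w is nonnegative. The weight of the w term is that of the N_k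
    terms in the Lyapunov operator; the other term feeds the Gronwall exponent. *)
Lemma psd_young n (Q : 'M[R]_n) (gamma a : R) v w : 0 < gamma -> psd Q ->
  2 * (a * bf Q v w) <= gamma ^+ 2 * a ^+ 2 * bf Q v v + (gamma ^+ 2)^-1 * bf Q w w.
Proof.
move=> g0 pQ; have := psd_bf ((gamma * a) *: v - gamma^-1 *: w) pQ.
rewrite bfDl !bfDr !bfNl !bfNr !bfZl !bfZr (bf_sym w v pQ.1) -exprVn => h.
have e : gamma * gamma^-1 = 1 by rewrite divff ?gt_eqF.
have -> : gamma ^+ 2 * a ^+ 2 * bf Q v v + gamma^-1 ^+ 2 * bf Q w w =
   2 * (gamma * gamma^-1) * (a * bf Q v w) +
   (gamma * a * (gamma * a * bf Q v v) - gamma * a * (gamma^-1 * bf Q v w) +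
    (- (gamma^-1 * (gamma * a * bf Q v w)) - - (gamma^-1 * (gamma^-1 * bf Q w w)))).
  ring.
by rewrite e mulr1; lra.
Qed.

Lemma primitive_bf n (Q : 'M[R]_n) (x xd : R -> 'cV[R]_n) : Q^T = Q ->
  mxprimitive x xd ->
  primitive (fun t => bf Q (x t) (x t)) (fun t => 2 * bf Q (x t) (xd t)).
Proof.
move=> sQ h.
have := primitive_sum (index_enum _) (P := xpredT) (fun i _ =>
  primitive_sum (index_enum _) (P := xpredT) (fun j _ =>
    primitiveM (primitiveZ (Q i j) (h i ord0)) (h j ord0))).
apply: primitive_eq => t _.
  by rewrite bfE; apply: eq_bigr => i _; apply: eq_bigr => j _; ring.
have -> : 2 * bf Q (x t) (xd t) = bf Q (xd t) (x t) + bf Q (x t) (xd t).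
  by rewrite (bf_sym (xd t)) //; ring.
rewrite !bfE -big_split; apply: eq_bigr => i _; rewrite -big_split.
by apply: eq_bigr => j _ /=; ring.
Qed.

Lemma lbm_sum (I : Type) (s : seq I) (f : I -> R -> R) :
  (forall i, lbounded_measurable (f i)) ->
  lbounded_measurable (fun t => \sum_(i <- s) f i t).
Proof.
move=> h; elim: s => [|i s IH].
  by have := lbm_cst (0 : R); congr lbounded_measurable; apply/funext => t; rewrite big_nil.
have := lbmD (h i) IH; congr lbounded_measurable; apply/funext => t.
by rewrite big_cons.
Qed.

Lemma lbm_sqn n (x : R -> 'cV[R]_n) : mxlbm x -> lbounded_measurable (fun t => sqn (x t)).
Proof. by move=> h; apply: lbm_sum => i; apply: lbmM; exact: h. Qed.

Lemma bilinear_dissipation n m (gamma : R) (A : 'M[R]_n) (N : 'I_m -> 'M[R]_n)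
    (Q : 'M[R]_n) (c : 'I_m -> R) x : 0 < gamma -> psd Q ->
  2 * bf Q x (A *m x) + \sum_k 2 * (c k * bf Q x (N k *m x)) <=
  bf (lyapd (gamma ^+ 2)^-1 A N Q) x x + gamma ^+ 2 * (\sum_k c k ^+ 2) * bf Q x x.
Proof.
move=> g0 pQ; rewrite bf_lyapd ?pQ.1 // -addrA lerD2l addrC.
rewrite mulr_sumr mulr_suml mulr_sumr -big_split.
by apply: ler_sum => k _; exact: psd_young.
Qed.

(** Along solutions the N_k terms are absorbed by the Lyapunov operator at [Q]; the surplus eps Q
    left by the damping costs the factor exp(eps T). *)
Lemma bilinear_energy n m p (gamma eps : R) (A : 'M[R]_n) (N : 'I_m -> 'M[R]_n)
    (C : 'M[R]_(p, n)) (Q : 'M[R]_n) (c : R -> 'I_m -> R) (x : R -> 'cV[R]_n) T :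
  0 < gamma -> 0 <= eps -> psd Q ->
  lyapd (gamma ^+ 2)^-1 A N Q = eps *: Q - C^T *m C ->
  locL1 (fun t => \sum_k c t k ^+ 2) ->
  mxprimitive x (fun t => A *m x t + \sum_k c t k *: (N k *m x t)) -> 0 <= T ->
  integral0 (fun t => sqn (C *m x t)) T <=
  bf Q (x 0) (x 0)
  * expR (gamma ^+ 2 * integral0 (fun t => \sum_k c t k ^+ 2) T + eps * T).
Proof.
move=> g0 e0 pQ eQ lc px T0; set u2 := fun t => \sum_k c t k ^+ 2.
pose k t := gamma ^+ 2 * u2 t + eps.
have u20 t : 0 <= u2 t by apply: sumr_ge0 => i _; exact: sqr_ge0.
have lk : locL1 k by apply: locL1D; [exact: locL1Z|exact: locL1_cst].
have pV := primitive_bf pQ.1 px.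
have bCx : mxlbm (fun t => C *m x t).
  move=> i j; have -> : (fun t => (C *m x t) i j) = (fun t => \sum_l C i l * x t l j).
    by apply/funext => t; rewrite mxE.
  apply: lbm_sum => l; apply: lbmM; first exact: lbm_cst.
  exact: primitive_lbm (px l j).
have := @energy_gronwall R _ _ (fun t => sqn (C *m x t)) (fun=> 0) k T T0 pV
  (lbm_locL1 (lbm_sqn bCx)) (locL1_cst 0) lk.
rewrite integral0_cst // mul0r addr0.
have -> : integral0 k T = gamma ^+ 2 * integral0 u2 T + eps * T.
  rewrite integral0D //; [|exact: locL1Z|exact: locL1_cst].
  by rewrite integral0Z // integral0_cst.
move=> h; have {}h : bf Q (x T) (x T) + integral0 (fun t => sqn (C *m x t)) T <=
  bf Q (x 0) (x 0) * expR (gamma ^+ 2 * integral0 u2 T + eps * T).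
  apply: h => // t _; [exact: psd_bf|exact: sqn_ge0| |].
    by rewrite addr_ge0 // mulr_ge0 ?sqr_ge0.
  have := bilinear_dissipation A N (c t) (x t) g0 pQ.
  have -> : 2 * bf Q (x t) (A *m x t + \sum_k0 c t k0 *: (N k0 *m x t)) =
      2 * bf Q (x t) (A *m x t) + \sum_i 2 * (c t i * bf Q (x t) (N i *m x t)).
    rewrite bfDr bf_sumr mulrDr mulr_sumr; congr (_ + _).
    by apply: eq_bigr => i _; rewrite bfZr.
  rewrite eQ bfDm bfZm bfNm bf_gram add0r /k.
  by rewrite -/(u2 t); lra.
by have := psd_bf (x T) pQ; lra.
Qed.

Lemma le_right_limit (F : R -> R) (a : R) : {for 0, continuous F} ->
  (forall e, 0 < e -> a <= F e) -> a <= F 0.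
Proof.
move=> /cvgrPdist_le cF h; apply/ler_addgt0Pl => d d0.
have /nbhs_ballP[e /= e0 he] := cF d d0.
have e2 : 0 < e / 2 by rewrite divr_gt0.
have b : ball 0 e (e / 2) by rewrite /ball /= sub0r normrN gtr0_norm //; lra.
have := he _ b; have := h _ e2; rewrite ler_norml => h1 /andP[h2 h3]; lra.
Qed.

End QuadraticEnergy.

(** * The homogeneous error bound *)

Section Homogeneous.
Context {R : realType} {r s m p q : nat} (mth : method) (A : 'M[R]_(r + s)).
Context (N : 'I_m -> 'M[R]_(r + s)) (C : 'M[R]_(p, r + s)).
Context (gamma : R) (Th1 : 'M[R]_r) (Th2 : 'M[R]_s) (H : 'M[R]_(r + s)).
Context (X0 : 'M[R]_(r + s, q)) (Y : 'M[R]_(r + s, r)) (Z : R -> 'M[R]_r).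
Local Notation g := ((gamma ^+ 2)^-1).
Local Notation D := (block_mx Th1 0 0 Th2).
Local Notation At := (red_A mth A).
Local Notation Nt := (fun k => red_N mth A (N k)).
Local Notation Ct := (red_C mth A C).
Local Notation Xt := (usubmx X0).
Local Notation W := (weight mth gamma A N X0 Y (gramian Z)).

Hypothesis gamma0 : 0 < gamma.
Hypothesis adm : admissible mth A.
Hypotheses (pTh1 : posdef Th1) (pTh2 : psd Th2).
Hypothesis eqD : lyapd g A N D = - (C^T *m C).
Hypothesis eqP : lyap_op gamma A A N N D = - (X0 *m X0^T).
Hypotheses (pH : posdef H) (pLH : posdef (- lyapd g A N H)).
Hypothesis eqY : lyap_op gamma A At N Nt Y = - (X0 *m Xt^T).
Hypothesis hZ : is_Z gamma At Nt Xt Z.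
Hypothesis eZ : mth = SPA -> gramian_exists Z.

(** Upper left block of the reachability equation for [D]. It makes [Th1] a supersolution with a
    semidefinite defect, from which the reduced Gramian exists under BT; for SPA its existence is a
    hypothesis. *)
Lemma bt_gramian_block :
  lyap_op gamma (ulsubmx A) (ulsubmx A) (fun k => ulsubmx (N k)) (fun k => ulsubmx (N k)) Th1
  = - (Xt *m Xt^T) - g *: \sum_k ursubmx (N k) *m Th2 *m (ursubmx (N k))^T.
Proof.
have := congr1 ulsubmx eqP.
have ulD (U V : 'M[R]_(r + s)) : ulsubmx (U + V) = ulsubmx U + ulsubmx V.
  by apply/matrixP => i j; rewrite !mxE.
have ulS (F : 'I_m -> 'M[R]_(r + s)) : ulsubmx (\sum_k F k) = \sum_k ulsubmx (F k).
  apply: (big_morph (fun M : 'M[R]_(r + s) => ulsubmx M)) => //.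
  by apply/matrixP => i j; rewrite !mxE.
have ulZ (U : 'M[R]_(r + s)) : ulsubmx (g *: U) = g *: ulsubmx U.
  by apply/matrixP => i j; rewrite !mxE.
have ulN (U : 'M[R]_(r + s)) : ulsubmx (- U) = - ulsubmx U.
  by apply/matrixP => i j; rewrite !mxE.
rewrite {1}/lyap_op !ulD ulZ ulS ulN.
have -> : ulsubmx (A *m D) = ulsubmx A *m Th1.
  by rewrite -{1}[A]submxK mulmx_block block_mxKul mulmx0 addr0.
have -> : ulsubmx (D *m A^T) = Th1 *m (ulsubmx A)^T.
  by rewrite -{1}[A]submxK tr_block_mx mulmx_block block_mxKul mul0mx addr0.
have -> : ulsubmx (X0 *m X0^T) = Xt *m Xt^T.
  by rewrite -{1 2}[X0]vsubmxK tr_col_mx mul_col_row block_mxKul.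
have eN k : ulsubmx (N k *m D *m (N k)^T) =
   ulsubmx (N k) *m Th1 *m (ulsubmx (N k))^T + ursubmx (N k) *m Th2 *m (ursubmx (N k))^T.
  rewrite -{1 2}[N k]submxK tr_block_mx !mulmx_block block_mxKul.
  by rewrite !mulmx0 addr0 add0r.
rewrite (eq_bigr _ (fun k _ => eN k)) big_split /= scalerDr addrA => <-.
by rewrite addrK.
Qed.

Lemma reduced_gramian_exists : gramian_exists Z.
Proof.
move: hZ eZ; case: mth => [hZ' _|_]; last by apply.
have [pZ Z0] := solution_primitive hZ'.
apply: (gramian_exists_bounded pZ _ (posdef_psd pTh1) _ (G := g *: \sum_k ursubmx (N k) *m Th2 *m (ursubmx (N k))^T)).
- by rewrite Z0; have := psd_gram Xt^T; rewrite trmxK.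
- apply: psdZ; first by rewrite invr_ge0 sqr_ge0.
  by apply: psd_sum => k _; have := psd_congr (ursubmx (N k))^T pTh2; rewrite trmxK.
- by rewrite Z0; exact: bt_gramian_block.
Qed.

Lemma reduced_gramian_eq :
  lyap_op gamma At At Nt Nt (gramian Z) = - (Xt *m Xt^T).
Proof.
have [pZ <-] := solution_primitive hZ.
exact: gramian_lyapunov pZ reduced_gramian_exists.
Qed.

(** [error_certificate] puts a nonnegative trace below tr(Th2 W) + K eps for every eps > 0. The sign
    matters because [Num.sqrt] is 0 on negative numbers. *)
Lemma weight_ge0 : 0 <= \tr (Th2 *m W).
Proof.
have [K K0 hK] := error_certificate adm pTh1 pTh2 eqD pH pLH eqY reduced_gramian_eq.
have := @le_right_limit R (fun e => \tr (Th2 *m W) + K * e) 0.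
rewrite mulr0 addr0; apply=> [|e e0].
  by apply: cvgD; [exact: cvg_cst|apply: cvgM; [exact: cvg_cst|exact: cvg_id]].
have [Qe [pQe _]] := hK e e0; apply: le_trans.
by apply: psd_trace_ge0; exact: psd_congr.
Qed.

(** At fixed T, eps tends to 0 simultaneously in the certificate and in the exponential factor. *)
Lemma homogeneous_bound (v0 : 'cV[R]_q) (c : R -> 'I_m -> R)
    (x : R -> 'cV[R]_(r + s)) (xt : R -> 'cV[R]_r) T :
  locL1 (fun t => \sum_k c t k ^+ 2) ->
  mxprimitive x (fun t => A *m x t + \sum_k c t k *: (N k *m x t)) ->
  mxprimitive xt (fun t => At *m xt t + \sum_k c t k *: (Nt k *m xt t)) ->
  x 0 = X0 *m v0 -> xt 0 = Xt *m v0 -> 0 <= T ->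
  integral0 (fun t => sqn (C *m x t - Ct *m xt t)) T <=
  \tr (Th2 *m W) * sqn v0
  * expR (gamma ^+ 2 * integral0 (fun t => \sum_k c t k ^+ 2) T).
Proof.
move=> lc px pxt x0 xt0 T0.
have [K K0 hK] := error_certificate adm pTh1 pTh2 eqD pH pLH eqY reduced_gramian_eq.
set U := gamma ^+ 2 * integral0 _ T; set w := \tr (Th2 *m W).
have := @le_right_limit R
  (fun e => (w + K * e) * sqn v0 * expR (U + e * T)).
move=> /(_ (integral0 (fun t => sqn (C *m x t - Ct *m xt t)) T)).
rewrite mulr0 mul0r !addr0; apply=> [|e e0].
  apply: cvgM.
    apply: cvgM; last exact: cvg_cst.
    by apply: cvgD; [exact: cvg_cst|apply: cvgM; [exact: cvg_cst|exact: cvg_id]].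
  apply: (cvg_comp (fun e => U + e * T) expR); last exact: continuous_expR.
  by apply: cvgD; [exact: cvg_cst|apply: cvgM; [exact: cvg_id|exact: cvg_cst]].
have [Qe [pQe eQe trQe]] := hK e e0.
pose xe t := col_mx (x t) (xt t).
have pxe : mxprimitive xe (fun t => error_A mth A *m xe t +
    \sum_k c t k *: (error_N mth A N k *m xe t)).
  have eq_rhs t : error_A mth A *m xe t + \sum_k c t k *: (error_N mth A N k *m xe t) =
     col_mx (A *m x t + \sum_k c t k *: (N k *m x t))
            (At *m xt t + \sum_k c t k *: (Nt k *m xt t)).
    have -> : \sum_k c t k *: (error_N mth A N k *m xe t) =
       col_mx (\sum_k c t k *: (N k *m x t)) (\sum_k c t k *: (Nt k *m xt t)).
      elim: (index_enum _) => [|k l IH]; first by rewrite !big_nil col_mx0.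
      rewrite !big_cons IH /xe /error_N mul_block_col !mul0mx addr0 add0r.
      by rewrite scale_col_mx add_col_mx.
    by rewrite /error_A /xe mul_block_col !mul0mx addr0 add0r add_col_mx.
  move=> i j; case: (split_ordP i) => k ->.
    by apply: primitive_eq (px k j) => t _; rewrite ?eq_rhs ?col_mxEu.
  by apply: primitive_eq (pxt k j) => t _; rewrite ?eq_rhs ?col_mxEd.
have := bilinear_energy gamma0 (ltW e0) pQe eQe lc pxe T0.
rewrite -/U.
have -> : integral0 (fun t => sqn (error_C mth A C *m xe t)) T =
    integral0 (fun t => sqn (C *m x t - Ct *m xt t)) T.
  by apply: integral0_eq => t _; rewrite /error_C /xe mul_row_col mulNmx.
move=> /le_trans; apply; apply: ler_wpM2r; first exact: expR_ge0.
have -> : bf Qe (xe 0) (xe 0) = bf ((col_mx X0 Xt)^T *m Qe *m col_mx X0 Xt) v0 v0.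
  by rewrite /xe x0 xt0 -mul_col_mx /bf trmx_mul !mulmxA.
apply: le_trans (psd_le_trace _ (psd_congr _ pQe)) _.
by apply: ler_wpM2r; [exact: sqn_ge0|exact: trQe].
Qed.

End Homogeneous.

(** * The inhomogeneous subsystem *)

Section BalancedInhomogeneous.
Context {R : realType} {n m p : nat} (gamma : R).
Context (A : 'M[R]_n) (N : 'I_m -> 'M[R]_n) (B : 'M[R]_(n, m)) (C : 'M[R]_(p, n)).
Context (sigma : 'rV[R]_n) (H : 'M[R]_n).
Local Notation g := ((gamma ^+ 2)^-1).
Local Notation Sg := (diag_mx sigma).
Local Notation Si := (diag_mx (\row_i (sigma ord0 i)^-1)).
Implicit Types (J : {set 'I_n}) (v w z : 'cV[R]_n).

Hypothesis gamma0 : 0 < gamma.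
Hypothesis sigma0 : forall i, 0 < sigma ord0 i.
Hypothesis eqQ : lyapd g A N Sg = - (C^T *m C).
Hypothesis leP : psd (- lyapd g A N Si - Si *m B *m B^T *m Si).
Hypotheses (pH : posdef H) (pLH : posdef (- lyapd g A N H)).

Lemma g_gt0 : 0 < g. Proof. by rewrite invr_gt0 exprn_gt0. Qed.

Lemma psd_diag (d : 'rV[R]_n) : (forall i, 0 <= d ord0 i) -> psd (diag_mx d).
Proof.
move=> d0; split=> [|v]; first by rewrite tr_diag_mx.
rewrite -/(bf _ _ _) bf_diag; apply: sumr_ge0 => i _.
by rewrite -mulrA mulr_ge0 // -expr2 sqr_ge0.
Qed.

Lemma psd_Sg : psd Sg. Proof. by apply: psd_diag => i; exact: ltW. Qed.

Lemma psd_Si : psd Si.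
Proof. by apply: psd_diag => i; rewrite mxE invr_ge0 ltW. Qed.

Lemma mul_diag_col (d : 'rV[R]_n) v i j : (diag_mx d *m v) i j = d ord0 i * v i j.
Proof. by rewrite mul_diag_mx mxE. Qed.

Lemma posdef_Sg : posdef Sg.
Proof.
split=> [|v v0]; first by rewrite tr_diag_mx.
rewrite -/(bf _ _ _) lt_def psd_bf ?andbT; last exact: psd_Sg.
apply: contraNneq v0 => /(psd_kernel psd_Sg) kv; apply/eqP/matrixP => i j.
rewrite ord1 [RHS]mxE; move/matrixP/(_ i ord0): kv; rewrite mul_diag_col [RHS]mxE => /eqP.
by rewrite mulf_eq0 gt_eqF //= => /eqP.
Qed.

Lemma diag_inv_mulK v : Si *m (Sg *m v) = v.
Proof.
apply/matrixP => i j; rewrite !mul_diag_col mxE mulKf //.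
by rewrite gt_eqF.
Qed.

Lemma subZ_entry v w a i j : (v - a *: w) i j = v i j - a * w i j.
Proof. by rewrite !mxE. Qed.

Definition dot v w := \sum_i v i ord0 * w i ord0.

(** The kernel of the block A_JJ, extended by zero outside J; [kerJ_trivial] is the invertibility of
    this block. *)
Definition kerJ J v :=
  (forall i, i \notin J -> v i ord0 = 0) /\ (forall i, i \in J -> (A *m v) i ord0 = 0).

(** v lives on J and A v off J, so no product of their entries survives in a diagonal form. *)
Lemma bf_kerJ (d : 'rV[R]_n) J v : kerJ J v -> bf (diag_mx d) v (A *m v) = 0.
Proof.
move=> [h1 h2]; rewrite bf_diag big1 // => i _.
by have [/h2->|/h1->] := boolP (i \in J); rewrite ?mulr0 ?mul0r.
Qed.

Lemma psd_kernel_le M v : psd M -> bf M v v <= 0 -> M *m v = 0.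
Proof.
by move=> pM h; apply: psd_kernel => //; apply/le_anti; rewrite h psd_bf.
Qed.

Lemma sumN_ge0 M v : psd M -> 0 <= \sum_k bf M (N k *m v) (N k *m v).
Proof. by move=> pM; apply: sumr_ge0 => k _; exact: psd_bf. Qed.

Lemma bf_sum0_kernel v : \sum_k bf Sg (N k *m v) (N k *m v) <= 0 ->
  forall k, N k *m v = 0.
Proof.
move=> h k; have [//|nz] := eqVneq (N k *m v) 0.
have := posdef_Sg.2 _ nz; rewrite -/(bf _ _ _) => pos.
have : bf Sg (N k *m v) (N k *m v) <= 0.
  apply: le_trans h; rewrite (bigD1 k) //= lerDl; apply: sumr_ge0 => j _.
  exact: psd_bf psd_Sg.
by rewrite leNgt pos.
Qed.

(** Evaluated at v, the equation for Sigma loses its drift and equates a nonnegative N_k term with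
    -|C v|^2, so both vanish. Applied to v itself it then gives the identity. *)
Lemma kerJ_observability J v : kerJ J v ->
  (forall k, N k *m v = 0) /\ A^T *m (Sg *m v) = - (Sg *m (A *m v)).
Proof.
move=> kv; have e := congr1 (fun M => bf M v v) eqQ.
rewrite /= bf_lyapd ?tr_diag_mx // (bf_kerJ _ kv) mulr0 add0r bfNm bf_gram in e.
have g0 := g_gt0; have s0 := sumN_ge0 v psd_Sg.
have Cv : C *m v = 0.
  apply/eqP; rewrite -sqn_eq0 eq_le sqn_ge0 andbT.
  by have := mulr_ge0 (ltW g0) s0; rewrite e; lra.
have Nv : forall k, N k *m v = 0.
  apply: bf_sum0_kernel; rewrite -(pmulr_rle0 _ g0) e oppr_le0; exact: sqn_ge0.
split=> //; have := congr1 (fun M => M *m v) eqQ.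
rewrite /lyapd !mulmxDl -scalemxAl mulmx_suml big1 => [|k _]; last first.
  by rewrite -mulmxA Nv mulmx0.
rewrite scaler0 addr0 mulNmx -!mulmxA Cv mulmx0 oppr0 => /eqP.
by rewrite addr_eq0 => /eqP.
Qed.

Lemma bf_dot M v w : bf M v w = dot v (M *m w).
Proof. by rewrite /bf -mulmxA mxE; apply: eq_bigr => i _; rewrite mxE. Qed.

Lemma dot_adj M v w : dot v (M *m w) = dot (M^T *m v) w.
Proof.
rewrite -bf_dot /bf -[in RHS](mul1mx w) -bf_dot /bf trmx_mul trmxK.
by rewrite mulmx1.
Qed.

(** The test vector z is chosen so that Sigma^-1 z = Sigma v; by observability its drift term
    vanishes. The semidefinite slack of the inequality then has nonpositive form at z, hence kills
    z, and the inequality becomes an equation there. *)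
Lemma kerJ_controllability J v : kerJ J v ->
  let z := Sg *m (Sg *m v) in
  A^T *m (Sg *m v) = - (Si *m (A *m z)).
Proof.
move=> kv z; have [_ e1] := kerJ_observability kv.
have Siz : Si *m z = Sg *m v by rewrite /z diag_inv_mulK.
pose M := - lyapd g A N Si - Si *m B *m B^T *m Si.
have g0 := g_gt0; have s0 := sumN_ge0 z psd_Si.
have bz : bf Si z (A *m z) = 0.
  rewrite bf_dot dot_adj tr_diag_mx Siz dot_adj e1 /dot big1 // => i _.
  rewrite mxE !mul_diag_col; case: kv => h1 h2.
  by have [/h2->|/h1->] := boolP (i \in J); rewrite !(mulr0, oppr0, mul0r).
have eL : bf (lyapd g A N Si) z z = g * \sum_k bf Si (N k *m z) (N k *m z).
  by rewrite bf_lyapd ?tr_diag_mx // bz mulr0 add0r.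
have eB : bf (Si *m B *m B^T *m Si) z z = sqn (B^T *m (Si *m z)).
  have -> : Si *m B *m B^T *m Si = (B^T *m Si)^T *m (B^T *m Si).
    by rewrite trmx_mul trmxK tr_diag_mx !mulmxA.
  by rewrite bf_gram -mulmxA.
have sB := sqn_ge0 (B^T *m (Si *m z)); have gs := mulr_ge0 (ltW g0) s0.
have eM : bf M z z = - (g * \sum_k bf Si (N k *m z) (N k *m z)) - sqn (B^T *m (Si *m z)).
  by rewrite bfDm !bfNm eL eB.
have Mz : M *m z = 0 by apply: psd_kernel_le leP _; rewrite eM; lra.
have M0 : bf M z z = 0 by rewrite bf_dot Mz /dot big1 // => i _; rewrite [X in _ * X]mxE mulr0.
have Bz : B^T *m (Si *m z) = 0 by apply/eqP; rewrite -sqn_eq0; apply/eqP; lra.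
have Ns : \sum_k bf Si (N k *m z) (N k *m z) = 0.
  have /eqP : g * \sum_k bf Si (N k *m z) (N k *m z) = 0 by lra.
  by rewrite mulf_eq0 gt_eqF //= => /eqP.
have SiN k : Si *m (N k *m z) = 0.
  apply: psd_kernel_le psd_Si _; rewrite -Ns (bigD1 k) //= lerDl; apply: sumr_ge0 => j _.
  exact: psd_bf psd_Si.
move: Mz; rewrite /M /lyapd mulmxBl mulNmx !mulmxDl -scalemxAl mulmx_suml.
rewrite big1 => [|k _]; last by rewrite -!mulmxA SiN mulmx0.
rewrite scaler0 addr0 -!mulmxA Bz !mulmx0 subr0 Siz => /eqP.
by rewrite oppr_eq0 addr_eq0 => /eqP.
Qed.

(** The two expressions for A^T Sigma v give Sigma A v = Sigma^-1 A Sigma^2 v, whose left side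
    vanishes on J. The term a v serves to cancel an entry later. *)
Lemma kerJ_square J v a : kerJ J v ->
  kerJ J (Sg *m (Sg *m v) - a *: v).
Proof.
move=> kv; have [_ e1] := kerJ_observability kv; have e2 := kerJ_controllability kv.
case: (kv) => h1 h2; split=> i iJ.
  by rewrite subZ_entry !mul_diag_col h1 // !mulr0 subr0.
rewrite mulmxBr -scalemxAr subZ_entry h2 // mulr0 subr0.
have := congr1 (fun M : 'cV[R]_n => M i ord0) (esym e2); rewrite /= e1.
have oppE (u : 'cV[R]_n) : (- u) i ord0 = - u i ord0 by rewrite mxE.
rewrite !oppE !mul_diag_col h2 // mulr0 => /oppr_inj/eqP.
by rewrite [(\row__ _) _ _]mxE mulf_eq0 invr_eq0 gt_eqF //= => /eqP.
Qed.

(* A vector of minimal support in the kernel is supported on one level set of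
   sigma, since the kernel is stable under Sigma^2. *)
Lemma kerJ_trivial J : (forall i j, i \in J -> j \notin J -> sigma ord0 i != sigma ord0 j) ->
  forall v, kerJ J v -> v = 0.
Proof.
move=> sep v; have [k] := ubnP #|[pred i | v i ord0 != 0]|.
elim: k v => // k IH v ltk kv; apply/eqP; apply: contraT => v0.
have [i vi] : exists i, v i ord0 != 0.
  apply/existsP; apply: contraNT v0; rewrite negb_exists => /forallP h.
  by apply/eqP/matrixP => i j; rewrite ord1 mxE; apply/eqP; have := h i; rewrite negbK.
have iJ : i \in J by apply: contraNT vi => /(kv.1)->.
(* The i-th entry cancels, so this kernel vector has smaller support and is zero by induction. *)
have w0 : Sg *m (Sg *m v) - sigma ord0 i ^+ 2 *: v = 0.
  apply: (IH _ _ (kerJ_square (sigma ord0 i ^+ 2) kv)).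
  rewrite ltnS in ltk; apply: leq_trans ltk; apply: proper_card; apply/properP; split.
    apply/fintype.subsetP => j; rewrite !inE; apply: contraNN => /eqP vj.
    by rewrite subZ_entry !mul_diag_col vj !mulr0 subr0.
  exists i; rewrite !inE // subZ_entry !mul_diag_col negbK; apply/eqP; ring.
have level j : v j ord0 != 0 -> sigma ord0 j = sigma ord0 i.
  move=> vj; move/matrixP/(_ j ord0): w0; rewrite subZ_entry !mul_diag_col [RHS]mxE => e.
  have : (sigma ord0 j ^+ 2 - sigma ord0 i ^+ 2) * v j ord0 = 0 by rewrite -[RHS]e; ring.
  move=> /eqP; rewrite mulf_eq0 (negbTE vj) orbF subr_eq0 eqrXn2 // ?ltW //.
  by move=> /eqP.
have Sv : Sg *m v = sigma ord0 i *: v.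
  apply/matrixP => j l; rewrite ord1 mul_diag_col mxE.
  by have [->|/level->] := eqVneq (v j ord0) 0; rewrite ?mulr0.
have [Nv e1] := kerJ_observability kv; have := kerJ_controllability kv.
have z2 : Sg *m (Sg *m v) = (sigma ord0 i ^+ 2) *: v.
  by rewrite Sv -scalemxAr Sv scalerA.
rewrite /= e1 z2 -scalemxAr -scalemxAr => e2.
(* On J this is [kerJ]; off J, Sigma A v = sigma_i^2 Sigma^-1 A v, and separation of sigma forces
   the entry to be 0. *)
have Av : A *m v = 0.
  apply/matrixP => j l; rewrite ord1 [RHS]mxE.
  have [jJ|jJ] := boolP (j \in J); first exact: kv.2.
  have := congr1 (fun M : 'cV[R]_n => M j ord0) (oppr_inj e2).
  have eZ a (U : 'cV[R]_n) : (a *: U) j ord0 = a * U j ord0 by rewrite mxE.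
  rewrite /= eZ !mul_diag_col [(\row__ _) _ _]mxE => {}e2.
  have sj := sigma0 j; have si := sigma0 i; have nij := sep i j iJ jJ.
  have : (sigma ord0 j ^+ 2 - sigma ord0 i ^+ 2) * (A *m v) j ord0 = 0.
    rewrite mulrBl expr2 -mulrA e2; field; rewrite gt_eqF //.
  move=> /eqP; rewrite mulf_eq0 subr_eq0 eqrXn2 // ?ltW // eq_sym (negbTE nij) /=.
  by move=> /eqP.
(* A v = 0 and N_k v = 0 make the form of the operator at [H] vanish at v, against its strict
   negativity. *)
have := pLH.2 v v0; rewrite -/(bf _ _ _) bfNm bf_lyapd ?pH.1 // Av bf0r mulr0 add0r.
by rewrite big1 ?mulr0 ?oppr0 ?ltxx // => l _; rewrite Nv bf0r.
Qed.

End BalancedInhomogeneous.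

(** * Locally square integrable functions and Minkowski's inequality *)

Section LocallySquareIntegrable.
Context {R : realType}.
Local Notation mu := (@lebesgue_measure R).
Implicit Types f g : R -> R.

Definition locL2 f := locL1 f /\ locL1 (fun x => f x * f x).

Lemma locL1_le f g : (forall t : R, 0 <= t -> @measurable_fun _ _ R R `[0, t] f) ->
  locL1 g -> (forall x, 0 <= x -> `|f x| <= g x) -> locL1 f.
Proof.
move=> mf lg h t t0; apply: (le_integrable _ _ _ (lg t t0)) => //.
  by apply/measurable_EFinP; exact: mf.
move=> x; rewrite mem_itv0 => /andP[x0 _] /=; rewrite lee_fin.
exact: le_trans (h x x0) (ler_norm _).
Qed.

Lemma locL1_measurable f (t : R) : locL1 f -> 0 <= t -> @measurable_fun _ _ R R `[0, t] f.
Proof. by move=> lf t0; apply/measurable_EFinP; exact: measurable_int (lf t t0). Qed.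

Lemma locL2M f g : locL2 f -> locL2 g -> locL1 (fun x => f x * g x).
Proof.
move=> [lf lf2] [lg lg2]; apply: (@locL1_le _ (fun x => f x * f x + g x * g x)).
- by move=> t t0; apply: measurable_funM; exact: locL1_measurable.
- exact: locL1D.
move=> x _; rewrite normrM -[f x * f x]expr2 -[g x * g x]expr2.
rewrite -[f x ^+ 2]real_normK ?num_real // -[g x ^+ 2]real_normK ?num_real //.
have := sqr_ge0 (`|f x| - `|g x|); have := mulr_ge0 (normr_ge0 (f x)) (normr_ge0 (g x)).
nra.
Qed.

Lemma locL2_eq f g : (forall x, 0 <= x -> f x = g x) -> locL2 f -> locL2 g.
Proof.
by move=> e [l1 l2]; split; [apply: locL1_eq l1|apply: locL1_eq l2 => x x0; rewrite e].
Qed.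

Lemma locL2D f g : locL2 f -> locL2 g -> locL2 (fun x => f x + g x).
Proof.
move=> hf hg; split; first by apply: locL1D; [exact: hf.1|exact: hg.1].
apply: locL1_eq (locL1D (locL1D hf.2 hg.2) (locL1Z 2 (locL2M hf hg))) => x _; ring.
Qed.

Lemma locL2Z a f : locL2 f -> locL2 (fun x => a * f x).
Proof.
move=> [h1 h2]; split; first exact: locL1Z.
by apply: locL1_eq (locL1Z (a * a) h2) => x _; ring.
Qed.

Lemma lbm_locL2 f : lbounded_measurable f -> locL2 f.
Proof. by move=> h; split; [exact: lbm_locL1|exact: lbm_locL1 (lbmM h h)]. Qed.

Lemma locL2_sum (I : Type) (s : seq I) (f : I -> R -> R) :
  (forall i, locL2 (f i)) -> locL2 (fun t => \sum_(i <- s) f i t).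
Proof.
move=> h; elim: s => [|i s IH].
  by apply: locL2_eq (lbm_locL2 (lbm_cst 0)) => x _; rewrite big_nil.
by apply: locL2_eq (locL2D (h i) IH) => x _; rewrite big_cons.
Qed.

Lemma locL2_mulmx a b (M : 'M[R]_(a, b)) (v : R -> 'cV[R]_b) :
  (forall i, locL2 (fun t => v t i ord0)) ->
  forall i, locL2 (fun t => (M *m v t) i ord0).
Proof.
move=> h i; apply: locL2_eq (locL2_sum (index_enum _) (fun j => locL2Z (M i j) (h j))).
by move=> t _; rewrite mxE.
Qed.

Lemma locL1_sqn n (v : R -> 'cV[R]_n) : (forall i, locL2 (fun t => v t i ord0)) ->
  locL1 (fun t => sqn (v t)).
Proof. by move=> h; apply: locL1_sum => i _; exact: (h i).2. Qed.

(** From (x + y)^2 <= (1 + l) x^2 + (1 + 1/l) y^2. The optimal l is b / a; adding a small d to both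
    keeps the quotient meaningful when a or b is 0. *)
Lemma minkowski_integral0 n (v w : R -> 'cV[R]_n) (T a b : R) : 0 <= T ->
  (forall i, locL2 (fun t => v t i ord0)) -> (forall i, locL2 (fun t => w t i ord0)) ->
  0 <= a -> 0 <= b ->
  integral0 (fun t => sqn (v t)) T <= a ^+ 2 ->
  integral0 (fun t => sqn (w t)) T <= b ^+ 2 ->
  integral0 (fun t => sqn (v t + w t)) T <= (a + b) ^+ 2.
Proof.
move=> T0 hv hw a0 b0 hva hwb.
have hvw i : locL2 (fun t => (v t + w t) i ord0).
  by apply: locL2_eq (locL2D (hv i) (hw i)) => t _; rewrite mxE.
have key (l : R) : 0 < l -> integral0 (fun t => sqn (v t + w t)) T <=
    (1 + l) * a ^+ 2 + (1 + l^-1) * b ^+ 2.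
  move=> l0; have li : 0 < l^-1 by rewrite invr_gt0.
  apply: (@le_trans _ _ (integral0 (fun t => (1 + l) * sqn (v t) + (1 + l^-1) * sqn (w t)) T)).
    apply: integral0_le => //; first exact: locL1_sqn.
      by apply: locL1D; apply: locL1Z; exact: locL1_sqn.
    move=> t _; rewrite /sqn !mulr_sumr -big_split; apply: ler_sum => i _ /=.
    rewrite mxE; set x := v t i ord0; set y := w t i ord0.
    have := mulr_ge0 (ltW li) (sqr_ge0 (l * x - y)).
    have -> : l^-1 * (l * x - y) ^+ 2 = l * x ^+ 2 - 2 * x * y + l^-1 * y ^+ 2.
      by field; rewrite gt_eqF.
    by move: x y => x y; lra.
  rewrite integral0D; [|apply: locL1Z; exact: locL1_sqn|apply: locL1Z; exact: locL1_sqn|by []].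
  rewrite !integral0Z //; [|exact: locL1_sqn|exact: locL1_sqn].
  by apply: lerD; apply: ler_wpM2l => //; lra.
apply/ler_addgt0Pl => e e0.
pose d := Num.min 1 (e / (2 * (a + b) + 1 + 1)).
have q0 : 0 < 2 * (a + b) + 1 + 1 by lra.
have d0 : 0 < d by rewrite lt_min ltr01 divr_gt0.
have d1 : d <= 1 by rewrite ge_min lexx.
have de : d * (2 * (a + b) + 1 + 1) <= e by rewrite -ler_pdivlMr // ge_min lexx orbT.
have ad : 0 < a + d by lra.
have bd : 0 < b + d by lra.
have := key ((b + d) / (a + d)) (divr_gt0 bd ad).
rewrite invf_div => h; apply: le_trans h _.
have h1 : (b + d) / (a + d) * a ^+ 2 <= (b + d) * (a + d).
  rewrite mulrAC ler_pdivrMr // -mulrA; apply: ler_wpM2l; first exact: ltW.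
  by nra.
have h2 : (a + d) / (b + d) * b ^+ 2 <= (a + d) * (b + d).
  rewrite mulrAC ler_pdivrMr // -mulrA; apply: ler_wpM2l; first exact: ltW.
  by nra.
rewrite [(1 + _) * a ^+ 2]mulrDl [(1 + _) * b ^+ 2]mulrDl !mul1r.
apply: (@le_trans _ _ (a ^+ 2 + (b + d) * (a + d) + (b ^+ 2 + (a + d) * (b + d)))).
  by apply: lerD; rewrite lerD2l.
have dd : d * d <= d by rewrite -[leRHS]mulr1 ler_wpM2l // ltW.
have fin (x : R) : x * (2 * (a + b) + 1 + 1) <= e -> x * x <= x ->
    a ^+ 2 + (b + x) * (a + x) + (b ^+ 2 + (a + x) * (b + x)) <= e + (a + b) ^+ 2.
  by clear; nra.
exact: (fin _ de dd).
Qed.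

(** The linear arithmetic of [step_bound]: index 1 refers to the difference measured by Sigma and
    index 2 to the sum measured by Sigma^-1. S are the bilinear terms, G the weighted N_k forms, V
    the energies, K the Gronwall density, W = |C w|^2, U = |u|^2 and r = s^2. *)
Fact step_arith (a1 a2 b1 b2 b3 S1 S2 G1 G2 V1 V2 W U K r : R) :
  a1 + r * a2 = b1 + S1 + r * (b2 + 2 * b3 + S2) ->
  2 * S1 <= K * V1 + G1 -> 2 * b1 + G1 = - W ->
  r * (2 * S2 + (2 * b2 + G2 + 4 * b3)) <= r * (K * V2 + G2 + 4 * U) ->
  2 * a1 + r * (2 * a2) + W <= 4 * r * U + K * (V1 + r * V2).
Proof. lra. Qed.

End LocallySquareIntegrable.

(** * Removal of one level of sigma *)

Section Trajectories.
Context {R : realType} {n m p : nat} (gamma : R).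
Context (A : 'M[R]_n) (N : 'I_m -> 'M[R]_n) (B : 'M[R]_(n, m)) (C : 'M[R]_(p, n)).
Context (sigma : 'rV[R]_n) (mth : method) (u : R -> 'cV[R]_m) (c : R -> 'I_m -> R).
Local Notation g := ((gamma ^+ 2)^-1).
Local Notation Sg := (diag_mx sigma).
Local Notation Si := (diag_mx (\row_i (sigma ord0 i)^-1)).
Implicit Types (J : {set 'I_n}).

Definition bilinear_rhs (c : 'I_m -> R) (u : 'cV[R]_m) (xi : 'cV[R]_n) : 'cV[R]_n :=
  A *m xi + B *m u + \sum_k c k *: (N k *m xi).

Definition eliminated (xi : 'cV[R]_n) (u : 'cV[R]_m) i : Prop :=
  if mth is BT then xi i ord0 = 0 else (A *m xi + B *m u) i ord0 = 0.

(* Reduced trajectories in the coordinates of the full system: the states with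
   index in J are set to zero (BT) or follow from the static equations (SPA). *)
Definition trajectory J (xi : R -> 'cV[R]_n) : Prop :=
  [/\ forall i, locL2 (fun t => xi t i ord0),
      forall i, i \notin J -> xi 0 i ord0 = 0 /\
        primitive (fun t => xi t i ord0) (fun t => bilinear_rhs (c t) (u t) (xi t) i ord0)
    & forall i, i \in J -> forall t, 0 <= t -> eliminated (xi t) (u t) i].

Hypothesis gamma0 : 0 < gamma.
Hypothesis sigma0 : forall i, 0 < sigma ord0 i.
Hypothesis eqQ : lyapd g A N Sg = - (C^T *m C).
Hypothesis leP : psd (- lyapd g A N Si - Si *m B *m B^T *m Si).
Hypothesis lu : forall i, locL2 (fun t => u t i ord0).
Hypothesis lc : locL1 (fun t => \sum_k c t k ^+ 2).

(** Retains the dynamic components; these are the absolutely continuous ones, hence the only ones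
    allowed in an energy. *)
Definition mask J (v : 'cV[R]_n) : 'cV[R]_n :=
  \col_i (if i \in J then 0 else v i ord0).

(* The coupling terms on J minus J' cancel between the two quadratic forms,
   because sigma is constant there. *)
Lemma step_identity J J' s (ct : 'I_m -> R) (ut : 'cV[R]_m) (xi eta : 'cV[R]_n) :
  J' \subset J -> (forall i, i \in J -> i \notin J' -> sigma ord0 i = s) ->
  (forall i, i \in J' -> eliminated xi ut i) ->
  (forall i, i \in J -> eliminated eta ut i) ->
  let w := xi - eta in let q := xi + eta in
  let xm := mask J' xi - mask J eta in let xp := mask J' xi + mask J eta in
  let f v := bilinear_rhs ct ut v in
  bf Sg xm (mask J' (f xi) - mask J (f eta))
  + s ^+ 2 * bf Si xp (mask J' (f xi) + mask J (f eta))
  = bf Sg w (A *m w) + bf Sg xm (\sum_k ct k *: (N k *m w))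
    + s ^+ 2 * (bf Si q (A *m q + 2 *: (B *m ut)) + bf Si xp (\sum_k ct k *: (N k *m q))).
Proof.
move=> sJ sig exi eeta w q xm xp f.
pose nl (v : 'cV[R]_n) : 'cV[R]_n := \sum_k ct k *: (N k *m v).
have nlD v v' : nl (v + v') = nl v + nl v'.
  by rewrite /nl -big_split; apply: eq_bigr => k _; rewrite mulmxDr scalerDr.
have nlN v : nl (- v) = - nl v.
  by rewrite /nl -sumrN; apply: eq_bigr => k _; rewrite mulmxN scalerN.
pose a := A *m xi + B *m ut; pose b := A *m eta + B *m ut.
have -> : A *m w = a - b by rewrite mulmxBr /a /b opprD addrACA subrr addr0.
have -> : A *m q + 2 *: (B *m ut) = a + b.
  by rewrite mulmxDr /a /b addrACA -[2]/(1 + 1) scalerDl scale1r.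
have -> : \sum_k ct k *: (N k *m w) = nl xi - nl eta by rewrite -nlN -nlD.
have -> : \sum_k ct k *: (N k *m q) = nl xi + nl eta by rewrite -nlD.
rewrite /w /q.
have -> : f xi = a + nl xi by [].
have -> : f eta = b + nl eta by [].
have ae : forall i, i \in J' -> if mth is BT then xi i ord0 = 0 else a i ord0 = 0 by exact: exi.
have be : forall i, i \in J -> if mth is BT then eta i ord0 = 0 else b i ord0 = 0 by exact: eeta.
move: (nl xi) (nl eta) a b ae be => nx ne a b ae be.
rewrite /xm /xp !bf_diag -!big_split !mulr_sumr -!big_split /=.
apply: eq_bigr => i _; rewrite !mxE.
have si : sigma ord0 i * (sigma ord0 i)^-1 = 1 by rewrite divff // gt_eqF.
have [iJ'|iJ'] := boolP (i \in J').
  have iJ : i \in J by exact: (fintype.subsetP sJ).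
  have := ae i iJ'; have := be i iJ; rewrite iJ.
  by case: mth => -> ->; ring.
have [iJ|iJ] := boolP (i \in J); last by ring.
have := be i iJ; rewrite (sig i iJ iJ') in si *.
have -> : s ^+ 2 = s * s by rewrite expr2.
move: si; move: (s^-1) => r si.
move=> h; apply/eqP; rewrite -subr_eq0; apply/eqP.
(* With r = s^-1, the two sides differ by a multiple of s r - 1. *)
transitivity ((s * r - 1) * (s * (xi i ord0 * (a i ord0 + nx i ord0)
  - ((xi i ord0 + eta i ord0) * (a i ord0 + b i ord0)
     + xi i ord0 * (nx i ord0 + ne i ord0))))); last by rewrite si subrr mul0r.
by move: h; case: mth => ->; ring.
Qed.

Lemma mask_primitive J xi : trajectory J xi ->
  mxprimitive (fun t => mask J (xi t)) (fun t => mask J (bilinear_rhs (c t) (u t) (xi t))).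
Proof.
move=> [_ h _] i j; rewrite ord1; have [iJ|iJ] := boolP (i \in J).
  by apply: primitive_eq (primitive_cst 0) => t _; rewrite [RHS]mxE iJ.
by apply: primitive_eq (h i iJ).2 => t _; rewrite [RHS]mxE (negbTE iJ).
Qed.

Lemma mask_init J xi : trajectory J xi -> mask J (xi 0) = 0.
Proof.
move=> [_ h _]; apply/matrixP => i j; rewrite !mxE.
by case: ifPn => // /h [].
Qed.

(** With x = B^T Sigma^-1 q, the inequality contributes -|x|^2 and the control 4 x.u; completing the
    square leaves 4 |u|^2. Its square root is the factor 2 of the final bound. *)
Lemma gram_inequality q (ut : 'cV[R]_m) :
  bf (lyapd g A N Si) q q + 4 * bf Si q (B *m ut) <= 4 * sqn ut.
Proof.
have h := psd_bf q leP.
have e1 : bf (Si *m B *m B^T *m Si) q q = sqn (B^T *m (Si *m q)).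
  have -> : Si *m B *m B^T *m Si = (B^T *m Si)^T *m (B^T *m Si).
    by rewrite trmx_mul trmxK tr_diag_mx !mulmxA.
  by rewrite bf_gram -mulmxA.
have e2 : bf Si q (B *m ut) = \sum_k (B^T *m (Si *m q)) k ord0 * ut k ord0.
  rewrite /bf.
  have -> : q^T *m Si *m (B *m ut) = (B^T *m (Si *m q))^T *m ut.
    by rewrite !trmx_mul trmxK tr_diag_mx !mulmxA.
  by rewrite mxE; apply: eq_bigr => k _; rewrite mxE.
move: h; rewrite bfDm !bfNm e1 e2 => h.
apply: (@le_trans _ _ (- sqn (B^T *m (Si *m q)) +
  4 * (\sum_k (B^T *m (Si *m q)) k ord0 * ut k ord0))); first lra.
rewrite /sqn -sumrN !mulr_sumr -big_split; apply: ler_sum => k _ /=.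
move: ((B^T *m (Si *m q)) k ord0) (ut k ord0) => x y.
by have := sqr_ge0 (x - 2 * y); lra.
Qed.

(** The difference dissipates |C w|^2 by the equation for Sigma; the sum, driven by 2 B u, injects
    at most 4 s^2 |u|^2 by [gram_inequality]. The energy starts at 0 as both trajectories start at
    rest. *)
Lemma step_bound J J' s xi eta T :
  J' \subset J -> 0 <= s -> (forall i, i \in J -> i \notin J' -> sigma ord0 i = s) ->
  trajectory J' xi -> trajectory J eta -> 0 <= T ->
  integral0 (fun t => sqn (C *m (xi t - eta t))) T <=
  4 * s ^+ 2 * integral0 (fun t => sqn (u t)) T
  * expR (gamma ^+ 2 * integral0 (fun t => \sum_k c t k ^+ 2) T).
Proof.
move=> sJ s0 sig txi teta T0.
pose xm t := mask J' (xi t) - mask J (eta t).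
pose xp t := mask J' (xi t) + mask J (eta t).
pose fx t := bilinear_rhs (c t) (u t) (xi t).
pose fe t := bilinear_rhs (c t) (u t) (eta t).
have px := mask_primitive txi; have pe := mask_primitive teta.
have pxm := mxprimitiveD px (mxprimitiveN pe); have pxp := mxprimitiveD px pe.
have pSg := psd_Sg sigma0; have pSi := psd_Si sigma0.
have pV := primitiveD (primitive_bf pSg.1 pxm)
  (primitiveZ (s ^+ 2) (primitive_bf pSi.1 pxp)).
rewrite -/(xm _) in pV.
pose k t := gamma ^+ 2 * \sum_l c t l ^+ 2.
have lk : locL1 k by exact: locL1Z.
have lw i : locL2 (fun t => (C *m (xi t - eta t)) i ord0).
  apply: locL2_mulmx => j; have [lx _ _] := txi; have [le _ _] := teta.
  by apply: locL2_eq (locL2D (lx j) (locL2Z (-1) (le j))) => t _; rewrite !mxE mulN1r.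
have la : locL1 (fun t => sqn (C *m (xi t - eta t))) by exact: locL1_sqn.
have lb : locL1 (fun t => 4 * s ^+ 2 * sqn (u t)) by apply: locL1Z; exact: locL1_sqn.
have := @energy_gronwall R _ _ _ _ k T T0 pV la lb lk.
have -> : integral0 k T = gamma ^+ 2 * integral0 (fun t => \sum_k c t k ^+ 2) T.
  exact: integral0Z.
have -> : integral0 (fun t => 4 * s ^+ 2 * sqn (u t)) T = 4 * s ^+ 2 * integral0 (fun t => sqn (u t)) T.
  by apply: integral0Z => //; exact: locL1_sqn.
rewrite !(mask_init txi, mask_init teta) subrr addr0 !bf0l mulr0 addr0 add0r => h.
have V0 t : 0 <= bf Sg (xm t) (xm t) + s ^+ 2 * bf Si (xp t) (xp t).
  by rewrite addr_ge0 ?mulr_ge0 ?sqr_ge0 ?psd_bf.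
apply: le_trans (h _ _ _ _ _) => {h}.
- by rewrite lerDr; exact: V0.
- by move=> t _; exact: V0.
- by move=> t _; exact: sqn_ge0.
- by move=> t _; rewrite mulr_ge0 ?sqn_ge0 // mulr_ge0 ?sqr_ge0.
- by move=> t _; rewrite mulr_ge0 ?sqr_ge0 // sumr_ge0 // => l _; exact: sqr_ge0.
move=> t /andP[t0 _]; rewrite -/(xm t) -/(xp t) -/(fx t) -/(fe t).
have id := @step_identity J J' s (c t) (u t) (xi t) (eta t) sJ sig _ _.
have {id} := id (fun i iJ => let: And3 _ _ h := txi in h i iJ t t0)
                (fun i iJ => let: And3 _ _ h := teta in h i iJ t t0).
rewrite /= -/(xm t) -/(xp t) -/(fx t) -/(fe t).
set w := xi t - eta t; set q := xi t + eta t => id.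
have sumE (M : 'M[R]_n) v z : bf M v (\sum_l c t l *: (N l *m z)) =
    \sum_l c t l * bf M v (N l *m z).
  by rewrite bf_sumr; apply: eq_bigr => l _; rewrite bfZr.
rewrite !sumE [bf Si q (A *m q + _)]bfDr [bf Si q (2 *: _)]bfZr in id.
have young (M : 'M[R]_n) v z : psd M ->
    2 * \sum_l c t l * bf M v (N l *m z) <=
    k t * bf M v v + g * \sum_l bf M (N l *m z) (N l *m z).
  move=> pM; rewrite /k mulr_sumr [gamma ^+ 2 * _]mulr_sumr mulr_suml mulr_sumr -big_split.
  by apply: ler_sum => l _; exact: psd_young.
have y1 := young Sg (xm t) w pSg; have y2 := young Si (xp t) q pSi.
have l1 : 2 * bf Sg w (A *m w) + g * \sum_l bf Sg (N l *m w) (N l *m w) = - sqn (C *m w).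
  by rewrite -bf_lyapd ?tr_diag_mx // eqQ bfNm bf_gram.
have l2 : 2 * bf Si q (A *m q) + g * \sum_l bf Si (N l *m q) (N l *m q)
    + 4 * bf Si q (B *m u t) <= 4 * sqn (u t).
  by rewrite -bf_lyapd ?tr_diag_mx //; exact: gram_inequality.
move: id y1 l1 (ler_wpM2l (sqr_ge0 s) (lerD y2 l2)).
exact: step_arith.
Qed.

End Trajectories.

(** * Intermediate trajectories and summation over the levels *)

Section Chain.
Context {R : realType} {n m p : nat} (gamma : R).
Context (A : 'M[R]_n) (N : 'I_m -> 'M[R]_n) (B : 'M[R]_(n, m)) (C : 'M[R]_(p, n)).
Context (sigma : 'rV[R]_n) (H : 'M[R]_n).
Context (mth : method) (u : R -> 'cV[R]_m) (c : R -> 'I_m -> R).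
Local Notation g := ((gamma ^+ 2)^-1).
Local Notation Sg := (diag_mx sigma).
Local Notation Si := (diag_mx (\row_i (sigma ord0 i)^-1)).
Implicit Types (J : {set 'I_n}).

Hypothesis gamma0 : 0 < gamma.
Hypothesis sigma0 : forall i, 0 < sigma ord0 i.
Hypothesis eqQ : lyapd g A N Sg = - (C^T *m C).
Hypothesis leP : psd (- lyapd g A N Si - Si *m B *m B^T *m Si).
Hypotheses (pH : posdef H) (pLH : posdef (- lyapd g A N H)).
Hypothesis lu : forall i, locL2 (fun t => u t i ord0).
Hypothesis lc : forall k, locL2 (fun t => c t k).

(** The eliminated components depend linearly on the others and on the control. For SPA the system
    matrix is the identity off J and A_JJ on J, and [kerJ_trivial] makes it a unit. *)
Lemma static_closure J :
  (forall i j, i \in J -> j \notin J -> sigma ord0 i != sigma ord0 j) ->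
  exists G : 'M[R]_n, exists K : 'M[R]_(n, m), forall (z : 'cV[R]_n) ut,
    (forall i, i \notin J -> (G *m z + K *m ut) i ord0 = z i ord0) /\
    (forall i, i \in J -> eliminated A B mth (G *m z + K *m ut) ut i).
Proof.
move=> sep; pose Pc : 'M[R]_n := diag_mx (\row_i (i \notin J)%:R).
pose P : 'M[R]_n := diag_mx (\row_i (i \in J)%:R).
have PcE k (v : 'M[R]_(n, k)) i j : (Pc *m v) i j = if i \in J then 0 else v i j.
  by rewrite mul_diag_mx !mxE; case: (i \in J); rewrite ?mul0r ?mul1r.
have PE k (v : 'M[R]_(n, k)) i j : (P *m v) i j = if i \in J then v i j else 0.
  by rewrite mul_diag_mx !mxE; case: (i \in J); rewrite ?mul0r ?mul1r.
have addE (v w : 'cV[R]_n) i : (v + w) i ord0 = v i ord0 + w i ord0 by rewrite mxE.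
have oppE (v : 'cV[R]_n) i : (- v) i ord0 = - v i ord0 by rewrite mxE.
case E : mth.
  exists Pc, 0 => z ut; rewrite mul0mx addr0; split=> i iJ.
    by rewrite PcE (negbTE iJ).
  by rewrite /eliminated PcE iJ.
pose M := Pc + P *m A *m P.
have ME (v : 'cV[R]_n) i : (M *m v) i ord0 =
    if i \in J then (A *m (P *m v)) i ord0 else v i ord0.
  rewrite mulmxDl addE -!mulmxA PcE PE; case: (i \in J); rewrite ?add0r ?addr0 //.
have uM : M \in unitmx.
  apply: inj_unitmx => v Mv.
  have hv i : (M *m v) i ord0 = 0 by rewrite Mv mxE.
  have v0 i : i \notin J -> v i ord0 = 0 by move=> iJ; have := hv i; rewrite ME (negbTE iJ).
  have Pv : P *m v = v.
    apply/matrixP => i j; rewrite ord1 PE; case: ifPn => // /v0 ->.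
    by [].
  apply: (kerJ_trivial gamma0 sigma0 eqQ leP pH pLH sep); split=> // i iJ.
  by have := hv i; rewrite ME iJ Pv.
exists (invmx M *m (Pc - P *m A *m Pc)), (- (invmx M *m (P *m B))) => z ut.
set xi := _ + _.
have Mxi : M *m xi = Pc *m z - P *m (A *m (Pc *m z) + B *m ut).
  have e1 k (X : 'M[R]_(n, k)) : M *m (invmx M *m X) = X.
    by rewrite mulmxA mulmxV // mul1mx.
  rewrite /xi mulmxDr mulNmx mulmxN -!mulmxA !e1 mulmxBl mulmxDr opprD addrA.
  by rewrite !mulmxA.
clearbody xi.
have xiE i : (M *m xi) i ord0 = if i \in J then - (A *m (Pc *m z) + B *m ut) i ord0
                                else z i ord0.
  rewrite Mxi addE oppE PcE PE; case: (i \in J); rewrite ?add0r ?oppr0 ?addr0 //.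
have xz i : i \notin J -> xi i ord0 = z i ord0.
  by move=> iJ; have := xiE i; rewrite ME (negbTE iJ).
split=> // i iJ; rewrite /eliminated.
have split_xi : xi = P *m xi + Pc *m z.
  apply/matrixP => k j; rewrite ord1 addE PE PcE; case: ifPn => [_|/xz ->].
    by rewrite addr0.
  by rewrite add0r.
rewrite {1}split_xi mulmxDr -addrA addE.
by have := xiE i; rewrite ME iJ => ->; rewrite addNr.
Qed.

(** Substituting G z + K u in the dynamic equations gives a linear equation for z, whose components
    in J are held at 0. Its forcing contains products of c and u, integrable because both are
    locally square integrable. *)
Lemma trajectory_exists J :
  (forall i j, i \in J -> j \notin J -> sigma ord0 i != sigma ord0 j) ->
  exists xi, trajectory A N B mth u c J xi.
Proof.
move=> /static_closure [G [K hGK]].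
have lc1 k : locL1 (fun t => c t k) := (lc k).1.
pose a i j t := if i \in J then 0 else (A *m G) i j + \sum_k c t k * (N k *m G) i j.
pose f i t := if i \in J then 0 else
  ((A *m K + B) *m u t) i ord0 + \sum_k c t k * (N k *m K *m u t) i ord0.
have la i j : locL1 (a i j).
  rewrite /a; case: (i \in J); first exact: locL1_cst.
  apply: locL1D; first exact: locL1_cst.
  apply: locL1_sum => k _; apply: locL1_eq (locL1Z ((N k *m G) i j) (lc1 k)) => t _.
  by rewrite mulrC.
have lf i : locL1 (f i).
  rewrite /f; case: (i \in J); first exact: locL1_cst.
  apply: locL1D; first exact: (locL2_mulmx _ lu i).1.
  by apply: locL1_sum => k _; apply: locL2M => //; exact: locL2_mulmx.
have [z hz] := linear_ode_exists (fun=> 0) la lf.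
exists (fun t => G *m z t + K *m u t).
have zl i : locL2 (fun t => z t i ord0) by apply: lbm_locL2; exact: primitive_lbm (hz i).2.
split=> [i|i iJ|i iJ t t0].
- have lG := locL2_mulmx G zl; have lK := locL2_mulmx K lu.
  by apply: locL2_eq (locL2D (lG i) (lK i)) => t _; rewrite [RHS]mxE.
- have [z0 pz] := hz i; have e t := (hGK (z t) (u t)).1 i iJ.
  split; first by rewrite e z0.
  apply: primitive_eq pz => t _; first by rewrite e.
  rewrite /a /f (negbTE iJ) /bilinear_rhs.
  have -> : A *m (G *m z t + K *m u t) + B *m u t +
     \sum_k c t k *: (N k *m (G *m z t + K *m u t)) =
     (A *m G *m z t + \sum_k c t k *: (N k *m G *m z t)) +
     ((A *m K + B) *m u t + \sum_k c t k *: (N k *m K *m u t)).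
    have -> : \sum_k c t k *: (N k *m (G *m z t + K *m u t)) =
        \sum_k c t k *: (N k *m G *m z t) + \sum_k c t k *: (N k *m K *m u t).
      by rewrite -big_split; apply: eq_bigr => k _; rewrite mulmxDr scalerDr !mulmxA.
    rewrite [RHS]addrACA; congr (_ + _).
    by rewrite mulmxDr mulmxDl !mulmxA addrA.
  have addE (v w : 'cV[R]_n) : (v + w) i ord0 = v i ord0 + w i ord0 by rewrite mxE.
  rewrite !addE; congr (_ + (_ + _)); last by rewrite summxE; apply: eq_bigr => k _; rewrite [RHS]mxE.
  rewrite summxE mxE.
  rewrite (eq_bigr (fun j => (A *m G) i j * z t j ord0 + \sum_k c t k * ((N k *m G) i j * z t j ord0))).
    rewrite big_split; congr (_ + _); rewrite exchange_big /=; apply: eq_bigr => k _.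
    rewrite [RHS]mxE [X in _ * X]mxE mulr_sumr; apply: eq_bigr => j _ //.
  by move=> j _; rewrite mulrDl mulr_suml; congr (_ + _); apply: eq_bigr => k _; rewrite mulrA.
- exact: (hGK (z t) (u t)).2.
Qed.

(** Induction on the size of J, restoring its largest level first. Separation at J itself is only
    weak, since the cut may pass through a multiple value of sigma; there the trajectory is given,
    and every smaller set met is strictly separated. *)
Lemma chain_bound J xi eta T :
  (forall i j, i \in J -> j \notin J -> sigma ord0 i <= sigma ord0 j) ->
  trajectory A N B mth u c finset.set0 xi -> trajectory A N B mth u c J eta -> 0 <= T ->
  integral0 (fun t => sqn (C *m (xi t - eta t))) T <=
  (2 * \sum_(i in J) sigma ord0 i) ^+ 2 * integral0 (fun t => sqn (u t)) T
  * expR (gamma ^+ 2 * integral0 (fun t => \sum_k c t k ^+ 2) T).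
Proof.
move=> sep txi + T0; set U := integral0 (fun t => sqn (u t)) T.
set E := expR _; have U0 : 0 <= U by apply: integral0_ge0 => t _; exact: sqn_ge0.
have E0 : 0 <= E := expR_ge0 _.
have lc2 : locL1 (fun t => \sum_k c t k ^+ 2) by apply: locL1_sum => k _; exact: (lc k).2.
(* Writes all bounds as squares, the form that Minkowski's inequality takes here. *)
pose r := Num.sqrt (U * E).
have rE : r ^+ 2 = U * E by rewrite sqr_sqrtr // mulr_ge0.
have r0 : 0 <= r by exact: sqrtr_ge0.
have step J' J'' s v w := step_bound gamma0 sigma0 eqQ leP lu lc2 (J := J') (J' := J'')
  (s := s) (xi := v) (eta := w) (T := T) (mth := mth).
have [k] := ubnP #|J|; elim: k J eta sep => // k IH J eta sep ltk teta.
rewrite -mulrA -rE -exprMn.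
have [J0|/finset.set0Pn[i0 i0J]] := eqVneq J finset.set0.
  rewrite J0 in teta *; rewrite big_set0 mulr0 mul0r.
  apply: le_trans (step finset.set0 finset.set0 0 xi eta _ _ _ _ _ _) _ => //.
    by move=> i; rewrite inE.
  by rewrite expr0n /= mulr0 !mul0r.
have [i1 i1J hmax] := arg_maxP (fun i => sigma ord0 i) i0J.
(* All indices of J at the top level leave together, so J' is strictly separated from its complement
   and [trajectory_exists] applies to it. *)
pose tau := sigma ord0 i1; pose J' := [set i in J | sigma ord0 i < tau]%SET.
have sJ' : J' \subset J by apply/fintype.subsetP => i; rewrite inE => /andP[].
have sepJ' i j : i \in J' -> j \notin J' -> sigma ord0 i < sigma ord0 j.
  rewrite !inE => /andP[iJ it]; rewrite negb_and => /orP[jJ|].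
    exact: lt_le_trans it (sep i1 j i1J jJ).
  by rewrite -leNgt; exact: lt_le_trans.
have [zeta tzeta] : exists zeta, trajectory A N B mth u c J' zeta.
  by apply: trajectory_exists => i j iJ jJ; rewrite lt_eqF // sepJ'.
have ltJ' : (#|J'| < k)%N.
  rewrite ltnS in ltk; apply: leq_trans ltk; apply: proper_card; apply/properP; split=> //.
  by exists i1 => //; rewrite inE ltxx andbF.
have ih := IH J' zeta (fun i j h1 h2 => ltW (sepJ' i j h1 h2)) ltJ' tzeta.
rewrite -mulrA -rE -exprMn in ih.
have st : integral0 (fun t => sqn (C *m (zeta t - eta t))) T <= (2 * tau * r) ^+ 2.
  apply: le_trans (step J J' tau zeta eta sJ' (ltW (sigma0 i1)) _ tzeta teta T0) _.
    move=> i iJ; rewrite inE iJ /= -leNgt => h; apply/le_anti; rewrite h andbT.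
    exact: hmax.
  by rewrite -mulrA -rE !exprMn; lra.
have lC J1 J2 v w : trajectory A N B mth u c J1 v -> trajectory A N B mth u c J2 w ->
    forall i, locL2 (fun t => (C *m (v t - w t)) i ord0).
  move=> [lv _ _] [lw _ _]; apply: locL2_mulmx => i.
  by apply: locL2_eq (locL2D (lv i) (locL2Z (-1) (lw i))) => t _; rewrite !mxE mulN1r.
have sum0 (K : {set 'I_n}) : 0 <= \sum_(i in K) sigma ord0 i.
  by apply: sumr_ge0 => i _; exact: ltW.
have := minkowski_integral0 T0 (lC _ _ _ _ txi tzeta) (lC _ _ _ _ tzeta teta) _ _ ih st.
have -> : integral0 (fun t => sqn (C *m (xi t - zeta t) + C *m (zeta t - eta t))) T =
    integral0 (fun t => sqn (C *m (xi t - eta t))) T.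
  by apply: integral0_eq => t _; rewrite -mulmxDr addrA subrK.
have t0 : 0 <= tau by exact: ltW (sigma0 i1).
move=> /(_ _ _) h; apply: le_trans (h _ _) _; rewrite ?mulr_ge0 //.
rewrite lerXn2r ?nnegrE ?addr_ge0 ?mulr_ge0 // -mulrDl -mulrDr.
rewrite ler_wpM2r // ler_wpM2l //.
(* A level costs 2 tau once, whereas the sum over J counts tau for each of its indices; the surplus
   terms are nonnegative. *)
rewrite [leRHS](bigD1 i1) //= [leLHS]addrC lerD2l.
rewrite [leRHS](bigID (fun i => sigma ord0 i < tau)) /= ler_wpDr //.
  by apply: sumr_ge0 => i _; exact: ltW.
apply: (@le_trans _ _ (\sum_(i in J') sigma ord0 i)) => //.
rewrite le_eqVlt; apply/orP; left; apply/eqP; apply: eq_bigl => i.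
rewrite inE -andbA; congr (_ && _).
by case: (eqVneq i i1) => [->|]; rewrite ?ltxx.
Qed.

End Chain.

(** * Changes of coordinates *)

Section CoordinateChange.
Context {R : realType} {n m : nat} (gamma : R) (A : 'M[R]_n) (N : 'I_m -> 'M[R]_n).
Context (T : 'M[R]_n).
Hypothesis uT : T \in unitmx.
Local Notation V := (invmx T).
Local Notation conj M := (T *m M *m V).

Lemma invmx_cancel : V *m T = 1%:M. Proof. exact: mulVmx. Qed.

Lemma invmx_cancel_tr : T^T *m V^T = 1%:M. Proof. by rewrite -trmx_mul invmx_cancel trmx1. Qed.

Lemma lyapd_conj g X :
  lyapd g (conj A) (fun k => conj (N k)) (V^T *m X *m V) = V^T *m lyapd g A N X *m V.
Proof.
have h (M1 M2 : 'M[R]_n) : (conj M1)^T *m (V^T *m X *m V) *m conj M2 =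
    V^T *m (M1^T *m X *m M2) *m V.
  rewrite !trmx_mul -!mulmxA; congr (_ *m _); congr (_ *m _).
  by rewrite (mulmxA T^T) invmx_cancel_tr mul1mx (mulmxA V T) invmx_cancel mul1mx.
have h1 (M1 : 'M[R]_n) : (conj M1)^T *m (V^T *m X *m V) = V^T *m (M1^T *m X) *m V.
  by have := h M1 1%:M; rewrite !mulmx1 mulmxV // !mulmx1.
have h2 (M2 : 'M[R]_n) : (V^T *m X *m V) *m conj M2 = V^T *m (X *m M2) *m V.
  by rewrite -!mulmxA (mulmxA V T) invmx_cancel mul1mx.
rewrite /lyapd h1 h2 !mulmxDr !mulmxDl -scalemxAr -scalemxAl; congr (_ + _ *: _).
by rewrite mulmx_sumr mulmx_suml; apply: eq_bigr => k _; exact: h.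
Qed.

Lemma lyap_op_conj P :
  lyap_op gamma (conj A) (conj A) (fun k => conj (N k)) (fun k => conj (N k)) (T *m P *m T^T)
  = T *m lyap_op gamma A A N N P *m T^T.
Proof.
have h1 (M : 'M[R]_n) : conj M *m (T *m P *m T^T) = T *m (M *m P) *m T^T.
  by rewrite -!mulmxA (mulmxA V T) invmx_cancel mul1mx.
have h2 (P' M : 'M[R]_n) : T *m P' *m T^T *m (conj M)^T = T *m (P' *m M^T) *m T^T.
  by rewrite !trmx_mul -!mulmxA (mulmxA T^T) invmx_cancel_tr mul1mx.
rewrite /lyap_op h1 h2 !mulmxDr !mulmxDl -scalemxAr -scalemxAl; congr (_ + _ *: _).
by rewrite mulmx_sumr mulmx_suml; apply: eq_bigr => k _; rewrite h1 h2.
Qed.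

Lemma stable_conj g H : posdef H -> lyapd g A N H = - 1%:M ->
  let H' := V^T *m H *m V in
  posdef H' /\ posdef (- lyapd g (conj A) (fun k => conj (N k)) H').
Proof.
move=> pH eH H'; have uV : V \in unitmx by rewrite unitmx_inv.
split; first exact: posdef_congr.
rewrite lyapd_conj eH mulmxN mulNmx opprK; apply: posdef_congr => //.
exact: posdef1.
Qed.

Lemma primitive_conj (F : R -> 'cV[R]_n) (c : R -> 'I_m -> R) (x : R -> 'cV[R]_n) :
  mxprimitive x (fun t => A *m x t + F t + \sum_k c t k *: (N k *m x t)) ->
  mxprimitive (fun t => T *m x t)
    (fun t => conj A *m (T *m x t) + T *m F t + \sum_k c t k *: (conj (N k) *m (T *m x t))).
Proof.
move=> /(mxprimitive_mull T); apply: mxprimitive_eq => // t _.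
have h (M : 'M[R]_n) : T *m (M *m x t) = conj M *m (T *m x t).
  by rewrite -!mulmxA (mulmxA V T) invmx_cancel mul1mx.
rewrite !mulmxDr h; congr (_ + _); rewrite mulmx_sumr; apply: eq_bigr => k _.
by rewrite -scalemxAr h.
Qed.

End CoordinateChange.

(** * Block splitting and lifting of reduced trajectories *)

Section Splitting.
Context {R : realType}.

Lemma diag_mx_block r s (d : 'rV[R]_(r + s)) :
  diag_mx d = block_mx (ulsubmx (diag_mx d)) 0 0 (drsubmx (diag_mx d)).
Proof.
rewrite -{1}[diag_mx d]submxK; congr block_mx; apply/matrixP => i j;
  rewrite !mxE /=; case: eqP => // /(congr1 val) /=.
  by move=> e; have := ltn_ord i; rewrite e ltnNge leq_addr.
by move=> e; have := ltn_ord j; rewrite -e ltnNge leq_addr.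
Qed.

(* The equation e makes the index type splittable, so that the casts of the
   statement become trivial. *)
Lemma homogeneous_part n r s m p q (e : n = (r + s)%N) (mth : method) (gamma : R)
    (A H : 'M[R]_n) (N : 'I_m -> 'M[R]_n) (C : 'M[R]_(p, n)) (X0 : 'M[R]_(n, q))
    (theta : 'rV[R]_n) (Y : 'M[R]_(r + s, r)) (Z : R -> 'M[R]_r) (v0 : 'cV[R]_q)
    (c : R -> 'I_m -> R) (x : R -> 'cV[R]_n) (xt : R -> 'cV[R]_r) (T : R) :
  let Ax := castmx (e, e) A in
  let Nx := fun k => castmx (e, e) (N k) in
  let Xx := castmx (e, erefl q) X0 in
  let Cx := castmx (erefl p, e) C in
  let Th := castmx (e, e) (diag_mx theta) in
  let At := red_A mth Ax in
  let Nt := fun k => red_N mth Ax (Nx k) in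
  let W := weight mth gamma Ax Nx Xx Y (gramian Z) in
  0 < gamma -> admissible mth Ax -> posdef (ulsubmx Th) -> (forall i, 0 <= theta ord0 i) ->
  lyapd (gamma ^+ 2)^-1 A N (diag_mx theta) = - (C^T *m C) ->
  lyap_op gamma A A N N (diag_mx theta) = - (X0 *m X0^T) ->
  posdef H -> posdef (- lyapd (gamma ^+ 2)^-1 A N H) ->
  lyap_op gamma Ax At Nx Nt Y = - (Xx *m (usubmx Xx)^T) ->
  is_Z gamma At Nt (usubmx Xx) Z -> (mth = SPA -> gramian_exists Z) ->
  locL1 (fun t => \sum_k c t k ^+ 2) ->
  mxprimitive x (fun t => A *m x t + \sum_k c t k *: (N k *m x t)) ->
  mxprimitive xt (fun t => At *m xt t + \sum_k c t k *: (Nt k *m xt t)) ->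
  x 0 = X0 *m v0 -> xt 0 = usubmx Xx *m v0 -> 0 <= T ->
  0 <= \tr (drsubmx Th *m W) /\
  integral0 (fun t => sqn (C *m x t - red_C mth Ax Cx *m xt t)) T <=
  \tr (drsubmx Th *m W) * sqn v0
  * expR (gamma ^+ 2 * integral0 (fun t => \sum_k c t k ^+ 2) T).
Proof.
subst n; cbv zeta; rewrite !castmx_id.
have -> : (fun k => castmx (erefl (r + s)%N, erefl (r + s)%N) (N k)) = N.
  by apply/funext => k; rewrite castmx_id.
have -> : (fun k => red_N mth A (castmx (erefl (r + s)%N, erefl (r + s)%N) (N k))) =
          (fun k => red_N mth A (N k)).
  by apply/funext => k; rewrite castmx_id.
move=> g0 adm pTh1 th0 eqD eqP pH pLH eqY hZ eZ lc px pxt x0 xt0 T0.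
have pTh2 : psd (drsubmx (diag_mx theta)) by apply: psd_drsubmx; exact: psd_diag.
rewrite diag_mx_block in eqD eqP.
split; first exact: (weight_ge0 adm pTh1 pTh2 eqD eqP pH pLH eqY hZ eZ).
apply: (homogeneous_bound g0 adm pTh1 pTh2 eqD eqP pH pLH eqY hZ eZ lc px _ x0 xt0 T0).
by apply: mxprimitive_eq pxt => // t _; congr (_ + _); apply: eq_bigr => k _.
Qed.

(** The eliminated components are appended, 0 for BT and the solution of the static equation for
    SPA. [red_D] and [red_E] are exactly what the control part of that solution contributes to the
    output and to the bilinear terms. *)
Lemma reduced_trajectory n r s m p (e : n = (r + s)%N) (mth : method)
    (A : 'M[R]_n) (N : 'I_m -> 'M[R]_n) (B : 'M[R]_(n, m)) (C : 'M[R]_(p, n))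
    (u : R -> 'cV[R]_m) (c : R -> 'I_m -> R) (xt : R -> 'cV[R]_r) :
  let AB := castmx (e, e) A in
  let NB := fun k => castmx (e, e) (N k) in
  let BB := castmx (e, erefl m) B in
  let CB := castmx (erefl p, e) C in
  admissible mth AB -> (forall i, locL2 (fun t => u t i ord0)) ->
  (forall t k, N k = 0 \/ c t k = u t k ord0) ->
  mxprimitive xt (fun t => red_A mth AB *m xt t + red_B mth AB BB *m u t
    + \sum_k u t k ord0 *: (red_N mth AB (NB k) *m xt t + red_E mth AB (NB k) BB *m u t)) ->
  xt 0 = 0 ->
  exists2 eta, trajectory A N B mth u c [set i : 'I_n | (r <= i)%N]%SET eta
    & forall t, C *m eta t = red_C mth AB CB *m xt t + red_D mth AB BB CB *m u t.
Proof.
subst n; cbv zeta; rewrite !castmx_id => adm lu hc pxt xt0.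
pose z t : 'cV[R]_s := if mth is BT then 0 else
  - (invmx (drsubmx A) *m (dlsubmx A *m xt t + dsubmx B *m u t)).
pose eta t := col_mx (xt t) (z t).
have lxt i : locL2 (fun t => xt t i ord0).
  by apply: lbm_locL2; exact: primitive_lbm (pxt i ord0).
have lz i : locL2 (fun t => z t i ord0).
  rewrite /z; case: (mth).
    by apply: locL2_eq (lbm_locL2 (lbm_cst 0)) => t _; rewrite mxE.
  have l1 := locL2_mulmx (invmx (drsubmx A) *m dlsubmx A) lxt.
  have l2 := locL2_mulmx (invmx (drsubmx A) *m dsubmx B) lu.
  apply: locL2_eq (locL2Z (-1) (locL2D (l1 i) (l2 i))) => t _.
  by rewrite [RHS]mxE mulN1r mulmxDr !mulmxA [in RHS]mxE.
have Meta k (M : 'M[R]_(k, r + s)) t : M *m eta t = lsubmx M *m xt t + rsubmx M *m z t.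
  by rewrite -{1}[M]hsubmxK mul_row_col.
have static : forall t, mth = SPA -> dsubmx A *m eta t + dsubmx B *m u t = 0.
  move=> t E; rewrite Meta /z; move: adm; rewrite E /= => uA.
  rewrite mulmxN mulmxA mulmxV // mul1mx opprD addrA.
  by rewrite -[lsubmx _]/(dlsubmx A) subrr add0r addNr.
have cu t k (v : 'cV[R]_(r + s)) : c t k *: (N k *m v) = u t k ord0 *: (N k *m v).
  by have [->|->] := hc t k; rewrite ?mul0mx ?scaler0.
pose elim_D k (M : 'M[R]_(k, r + s)) : 'M[R]_(k, m) := if mth is BT then 0 else
  - (rsubmx M *m invmx (drsubmx A) *m dsubmx B).
have elim k (M : 'M[R]_(k, r + s)) t :
    M *m eta t = red_C mth A M *m xt t + elim_D k M *m u t.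
  rewrite Meta /z /elim_D; case: (mth) => /=; first by rewrite mulmx0 mul0mx.
  by rewrite mulmxN !mulmxDr opprD addrA mulmxBl mulNmx !mulmxA.
have upper t : usubmx (bilinear_rhs A N B (c t) (u t) (eta t)) =
   red_A mth A *m xt t + red_B mth A B *m u t
    + \sum_k u t k ord0 *: (red_N mth A (N k) *m xt t + red_E mth A (N k) B *m u t).
  rewrite /bilinear_rhs (eq_bigr _ (fun k _ => cu t k _)).
  have us (F : 'I_m -> 'cV[R]_(r + s)) : usubmx (\sum_k F k) = \sum_k usubmx (F k).
    exact: (raddf_sum (@usubmx R r s 1)).
  rewrite !linearD /= us !usubmx_mul elim; congr (_ + _).
    rewrite -addrA; congr (_ + _); rewrite /elim_D.
    by case: (mth); rewrite /= ?mul0mx ?add0r // mulNmx addrC mulmxBl.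
  apply: eq_bigr => k _; rewrite linearZ /= usubmx_mul elim; congr (_ *: (_ + _)).
have eta_u t i : eta t (lshift s i) ord0 = xt t i ord0 by rewrite /eta col_mxEu.
have eta_d t i : eta t (rshift r i) ord0 = z t i ord0 by rewrite /eta col_mxEd.
have inJ i : rshift r i \in [set i : 'I_(r + s) | (r <= i)%N]%SET.
  by rewrite inE /= leq_addr.
have ninJ i : lshift s i \notin [set i : 'I_(r + s) | (r <= i)%N]%SET.
  by rewrite inE /= -ltnNge ltn_ord.
exists eta => [|t]; last by rewrite elim.
split=> i.
- case: (split_ordP i) => j ->.
    by apply: locL2_eq (lxt j) => t _; rewrite eta_u.
  by apply: locL2_eq (lz j) => t _; rewrite eta_d.
- case: (split_ordP i) => j ->; last by rewrite inJ.
  move=> _; split; first by rewrite eta_u xt0 mxE.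
  apply: primitive_eq (pxt j ord0) => t _; first by rewrite eta_u.
  by rewrite -upper mxE.
case: (split_ordP i) => j ->; first by rewrite (negbTE (ninJ j)).
move=> _ t t0; rewrite /eliminated; case E : mth.
  by rewrite eta_d /z E mxE.
have := congr1 (fun M : 'cV[R]_s => M j ord0) (static t E).
by rewrite -dsubmx_mul -dsubmx_mul -linearD /= [RHS]mxE => h; rewrite -[RHS]h [RHS]mxE.
Qed.

End Splitting.

(** * The error bound *)

Section L2Norms.
Context {R : realType}.
Local Notation mu := (@lebesgue_measure R).

Lemma norm2_sqr n (v : 'cV[R]_n) : norm2 v ^+ 2 = sqn v.
Proof. by rewrite /norm2 sqr_sqrtr //; exact: sqn_ge0. Qed.

Lemma L2normE n (f : R -> 'cV[R]_n) :
  L2norm f = ((\int[mu]_(t in `[0%R, +oo[) (sqn (f t))%:E) `^ 2^-1)%E.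
Proof. by rewrite /L2norm; under eq_integral => t _ do rewrite norm2_sqr. Qed.

Lemma integral_sqn_ge0 n (f : R -> 'cV[R]_n) :
  (0 <= \int[mu]_(t in `[0%R, +oo[) (sqn (f t))%:E)%E.
Proof. by apply: integral_ge0 => t _; rewrite lee_fin sqn_ge0. Qed.

Lemma L2norm_sqrt n (f : R -> 'cV[R]_n) (I : R) :
  (\int[mu]_(t in `[0%R, +oo[) (sqn (f t))%:E)%E = I%:E ->
  L2norm f = (Num.sqrt I)%:E.
Proof.
move=> h; rewrite L2normE h poweR_EFin powR12_sqrt //.
by have := integral_sqn_ge0 f; rewrite h lee_fin.
Qed.

Lemma L2norm_le n (f : R -> 'cV[R]_n) (M : R) : 0 <= M ->
  (\int[mu]_(t in `[0%R, +oo[) (sqn (f t))%:E <= (M ^+ 2)%:E)%E ->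
  (L2norm f <= M%:E)%E.
Proof.
move=> M0 h; have f0 := integral_sqn_ge0 f.
have fn : (\int[mu]_(t in `[0%R, +oo[) (sqn (f t))%:E)%E \is a fin_num.
  by rewrite ge0_fin_numE // (le_lt_trans h) // ltry.
have e := esym (fineK fn); rewrite (L2norm_sqrt e) lee_fin.
rewrite -(ger0_norm M0) -sqrtr_sqr ler_wsqrtr // -lee_fin -e; exact: h.
Qed.

Lemma in_L2_integral n (f : R -> 'cV[R]_n) : in_L2 f ->
  exists I : R, (\int[mu]_(t in `[0%R, +oo[) (sqn (f t))%:E)%E = I%:E.
Proof.
move=> [_]; rewrite L2normE; have := integral_sqn_ge0 f.
case: (\int[mu]_(t in _) _)%E => [I _ _|_|//]; first by exists I.
by rewrite poweRyr ?ltxx // invr_eq0 pnatr_eq0.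
Qed.

(** Each squared entry lies below the integrable [sqn], and |x| <= 1 + x^2 gives local integrability
    of the entry itself. *)
Lemma in_L2_locL2 n (f : R -> 'cV[R]_n) : in_L2 f ->
  forall i, locL2 (fun t => f t i ord0).
Proof.
move=> hf; have [I hI] := in_L2_integral hf; move: hf => [mf _].
have m1 i (t : R) : 0 <= t -> @measurable_fun _ _ R R `[0, t] (fun s => f s i ord0).
  move=> t0; apply: measurable_funS (mf i) => //.
  by move=> x /=; rewrite !in_itv /= => /andP[->].
have ms : @measurable_fun _ _ R R `[0%R, +oo[ (fun t => sqn (f t)).
  rewrite /sqn; apply: measurable_sum => i.
  by apply: measurable_funX; exact: mf.
have ls : locL1 (fun t => sqn (f t)).
  apply: half_line_locL1; apply/integrableP; split; first exact/measurable_EFinP.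
  under eq_integral => t _ do rewrite /= ger0_norm ?sqn_ge0 //.
  by rewrite hI ltry.
have l2 i : locL1 (fun t => f t i ord0 * f t i ord0).
  apply: locL1_le ls _ => [t t0|x _]; first by apply: measurable_funM; exact: m1.
  rewrite ger0_norm -?expr2 ?sqr_ge0 // /sqn (bigD1 i) //= lerDl.
  by apply: sumr_ge0 => j _; exact: sqr_ge0.
move=> i; split=> //; apply: locL1_le (locL1D (locL1_cst 1) (l2 i)) _ => [t t0|x _].
  exact: m1.
rewrite -expr2 -[f x i ord0 ^+ 2]real_normK ?num_real //.
by have := sqr_ge0 (`|f x i ord0| - 1); have := normr_ge0 (f x i ord0); nra.
Qed.

End L2Norms.
Theorem theorem4p5 (R : realType) (n m p q : nat)
  (A : 'M[R]_n) (N : 'I_m -> 'M[R]_n) (B : 'M[R]_(n, m)) (C : 'M[R]_(p, n))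
  (X0 : 'M[R]_(n, q)) (v0 : 'cV[R]_q) (u : R -> 'cV[R]_m) (gamma : R)
  (P0 Q PB : 'M[R]_n)
  (Sx SB : 'M[R]_n) (theta sigma : 'rV[R]_n)
  (rx rB : nat) (hrx : (rx <= n)%N) (hrB : (rB <= n)%N)
  (mthx mthB : method)
  (Y : 'M[R]_(rx + (n - rx), rx)) (Z : R -> 'M[R]_rx)
  (y yx yB : R -> 'cV[R]_p) :
  hurwitz A ->
  in_L2 u ->
  0 < gamma ->
  spectrum (kron_op gamma A N) `<=` open_left_half_plane ->
  lyap_op gamma A A N N P0 = - (X0 *m X0^T) ->
  lyap_op gamma A^T A^T (fun k => (N k)^T) (fun k => (N k)^T) Q
    = - (C^T *m C) ->
  posdef PB ->
  loewner_le
    (lyap_op gamma A^T A^T (fun k => (N k)^T) (fun k => (N k)^T) (invmx PB))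
    (- (invmx PB *m B *m B^T *m invmx PB)) ->
  balancing Sx P0 Q theta ->
  balancing SB PB Q sigma ->
  trailing_smallest rx theta ->
  trailing_smallest rB sigma ->
  let Ax := split_sq hrx (Sx *m A *m invmx Sx) in
  let Nx := fun k => split_sq hrx (Sx *m N k *m invmx Sx) in
  let Xx := split_rows hrx (Sx *m X0) in
  let Cx := split_cols hrx (C *m invmx Sx) in
  let Theta1 := ulsubmx (split_sq hrx (diag_mx theta)) in
  let Theta2 := drsubmx (split_sq hrx (diag_mx theta)) in
  let AB := split_sq hrB (SB *m A *m invmx SB) in
  let NB := fun k => split_sq hrB (SB *m N k *m invmx SB) in
  let BB := split_rows hrB (SB *m B) in
  let CB := split_cols hrB (C *m invmx SB) in
  let At := red_A mthx Ax in
  let Nt := fun k => red_N mthx Ax (Nx k) in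
  let Xt := usubmx Xx in
  let W := weight mthx gamma Ax Nx Xx Y (gramian Z) in
  admissible mthx Ax ->
  admissible mthB AB ->
  posdef Theta1 ->
  is_Z gamma At Nt Xt Z ->
  (mthx = SPA -> gramian_exists Z) ->
  lyap_op gamma Ax At Nx Nt Y = - (Xx *m Xt^T) ->
  bilinear_output A B C N (X0 *m v0) u y ->
  homogeneous_output At (red_C mthx Ax Cx) Nt (Xt *m v0) u yx ->
  inhomogeneous_output (red_A mthB AB) (red_B mthB AB BB) (red_C mthB AB CB)
    (red_D mthB AB BB CB) (fun k => red_E mthB AB (NB k) BB)
    (fun k => red_N mthB AB (NB k)) u yB ->
  let err := fun t => y t - (yx t + yB t) in
  let gu0 := fun t => gamma *: control0 N u t in
  let sum_sigma := \sum_(i < n | (rB <= i)%N) sigma ord0 i in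
  (L2norm err
   <= ((Num.sqrt (\tr (Theta2 *m W)) * norm2 v0)%:E
       + (2 * sum_sigma)%:E * L2norm u)
      * expeR ((2^-1)%:E * L2norm gu0 ^+ 2))%E.

Proof.
move=> _ hu gamma0 sp eqP0 eqQ0 pPB leB balX balB _ trB Ax Nx Xx Cx Theta1 Theta2
  AB NB BB CB At Nt Xt W admX admB pTh1 hZ eZ eqY hy hyx hyB.
cbv zeta; set err := fun t => y t - _; set gu0 := fun t => gamma *: _.
set sum_sigma := \sum_(i < n | _) _.
set g := (gamma ^+ 2)^-1.
have g0 : 0 < g by rewrite invr_gt0 exprn_gt0.
have [H pH eH] := kron_stable sp; rewrite -/g in eH.
have lu := in_L2_locL2 hu.
(* c is u^0. It agrees with u wherever N_k is nonzero, so it may replace u in every bilinear term,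
   and the exponent then involves u^0 alone. *)
pose c t k := control0 N u t k ord0.
have cE t k : c t k = if N k == 0 then 0 else u t k ord0 by rewrite /c mxE.
have hc t k : N k = 0 \/ c t k = u t k ord0.
  by rewrite cE; have [->|_] := eqVneq; [left|right].
have lc k : locL2 (fun t => c t k).
  have [N0|N0] := eqVneq (N k) 0.
    by apply: locL2_eq (lbm_locL2 (lbm_cst 0)) => t _; rewrite cE N0 eqxx.
  by apply: locL2_eq (lu k) => t _; rewrite cE (negbTE N0).
have lc2 : locL1 (fun t => \sum_k c t k ^+ 2) by apply: locL1_sum => k _; exact: (lc k).2.
case: balX => uX eqXP eqXQ [th0 _]; case: balB => uB eqBP eqBQ _.
have eqQ : lyapd g A N Q = - (C^T *m C) by rewrite -lyap_op_dual.
have eqD (S : 'M[R]_n) d : S \in unitmx -> (invmx S)^T *m Q *m invmx S = diag_mx d ->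
    lyapd g (S *m A *m invmx S) (fun k => S *m N k *m invmx S) (diag_mx d)
    = - ((C *m invmx S)^T *m (C *m invmx S)).
  by move=> uS <-; rewrite lyapd_conj // eqQ mulmxN mulNmx trmx_mul !mulmxA.
have [x [/solution_primitive[px x0] yE]] := hy.
have [xt [/solution_primitive[pxt xt0] yxE]] := hyx.
have [xb [/solution_primitive[pxb xb0] yBE]] := hyB.
have ucE (k : 'I_m) (t : R) (v : 'cV[R]_n) : u t k ord0 *: (N k *m v) = c t k *: (N k *m v).
  by have [->|->] := hc t k; rewrite ?mul0mx ?scaler0.
have hcS (S : 'M[R]_n) t k : S *m N k *m invmx S = 0 \/ c t k = u t k ord0.
  by have [->|->] := hc t k; [left; rewrite mulmx0 mul0mx|right].
have [pHB pLHB] := stable_conj uB pH eH.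
have posS : posdef (diag_mx sigma).
  rewrite -eqBP; have := posdef_congr (T := SB^T) _ pPB; rewrite trmxK; apply.
  by rewrite unitmx_tr.
have sigma0 i : 0 < sigma ord0 i.
  have := posS.2 (delta_mx i ord0); rewrite -/(bf _ _ _) bf_delta mxE eqxx mulr1n; apply.
  by apply/eqP => /matrixP/(_ i ord0)/eqP; rewrite !mxE !eqxx oner_eq0.
have invS : diag_mx (\row_i (sigma ord0 i)^-1) = (invmx SB)^T *m invmx PB *m invmx SB.
  have uD := posdef_unit posS.
  have e1 : diag_mx (\row_i (sigma ord0 i)^-1) *m diag_mx sigma = 1%:M.
    apply/matrixP => i j; rewrite mul_diag_mx !mxE.
    by case: eqP => _; rewrite ?mulr0 // !mulr1n mulVf // gt_eqF.
  have e2 : (invmx SB)^T *m invmx PB *m invmx SB *m diag_mx sigma = 1%:M.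
    rewrite -eqBP -!mulmxA (mulmxA (invmx SB)) mulVmx // mul1mx.
    rewrite (mulmxA (invmx PB)) mulVmx ?mul1mx; last exact: posdef_unit.
    by rewrite -trmx_mul mulmxV // trmx1.
  by rewrite -[LHS]mulmx1 -(mulmxV uD) mulmxA e1 -e2 mulmxK.
have leS : psd (- lyapd g (SB *m A *m invmx SB) (fun k => SB *m N k *m invmx SB)
      (diag_mx (\row_i (sigma ord0 i)^-1))
    - diag_mx (\row_i (sigma ord0 i)^-1) *m (SB *m B) *m (SB *m B)^T
      *m diag_mx (\row_i (sigma ord0 i)^-1)).
  have := psd_congr (invmx SB) leB; rewrite lyap_op_dual -/g invS lyapd_conj //.
  rewrite mulmxBr mulmxBl mulmxN mulNmx addrC !trmx_mul.
  have e1 : (invmx SB)^T *m invmx PB *m invmx SB *m (SB *m B) = (invmx SB)^T *m invmx PB *m B.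
    by rewrite -!mulmxA (mulmxA (invmx SB)) mulVmx // mul1mx.
  have e2 : B^T *m SB^T *m ((invmx SB)^T *m invmx PB *m invmx SB) = B^T *m invmx PB *m invmx SB.
    by rewrite -!mulmxA (mulmxA SB^T) -trmx_mul mulVmx // trmx1 mul1mx.
  by rewrite e1 -[_ *m (B^T *m SB^T) *m _]mulmxA e2 !mulmxA.
(* With J empty nothing is eliminated: xi is the full inhomogeneous state started at rest, in the
   coordinates of [SB]. *)
have [xi txi] : exists xi, trajectory (SB *m A *m invmx SB) (fun k => SB *m N k *m invmx SB)
    (SB *m B) mthB u c finset.set0 xi.
  apply: (trajectory_exists mthB gamma0 sigma0 (eqD _ _ uB eqBQ) leS pHB pLHB lu lc).
  by move=> i j; rewrite inE.
have [eta teta etaE] := @reduced_trajectory R n rB (n - rB)%N m p (esym (subnKC hrB)) mthB _ _ _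
  (C *m invmx SB) u c xb admB lu (hcS SB) pxb xb0.
have chain T := chain_bound gamma0 sigma0 (eqD _ _ uB eqBQ) leS pHB pLHB lu lc
  (xi := xi) (eta := eta) (T := T) _ txi teta.
have sepB i j : i \in [set i : 'I_n | (rB <= i)%N]%SET ->
    j \notin [set i : 'I_n | (rB <= i)%N]%SET -> sigma ord0 i <= sigma ord0 j.
  by rewrite !inE -ltnNge => iB jB; exact: trB.
have {}chain := chain sepB.
have [pHX pLHX] := stable_conj uX pH eH.
have [lxi pxi _] := txi.
have pVxi : mxprimitive (fun t => invmx SB *m xi t)
    (fun t => A *m (invmx SB *m xi t) + B *m u t + \sum_k c t k *: (N k *m (invmx SB *m xi t))).
  have pm : mxprimitive xi (fun t => bilinear_rhs (SB *m A *m invmx SB)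
      (fun k => SB *m N k *m invmx SB) (SB *m B) (c t) (u t) (xi t)).
    by move=> i j; rewrite ord1; apply: (pxi i _).2; rewrite inE.
  apply: mxprimitive_eq (mxprimitive_mull (invmx SB) pm) => // t _.
  have SK k (M : 'M[R]_(n, k)) : invmx SB *m (SB *m M) = M by rewrite mulmxA mulVmx // mul1mx.
  rewrite /bilinear_rhs !mulmxDr -!mulmxA !SK; congr (_ + _).
  rewrite mulmx_sumr; apply: eq_bigr => k _.
  by rewrite -scalemxAr -!mulmxA SK.
have xi0 : xi 0 = 0.
  apply/matrixP => i j; rewrite ord1 [RHS]mxE.
  by have [] := pxi i _; rewrite ?inE.
(* The homogeneous part is defined by subtraction, which makes the decomposition of y immediate; its
   equation follows by linearity. *)
pose xh t := Sx *m (x t - invmx SB *m xi t).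
have pxh : mxprimitive xh (fun t => (Sx *m A *m invmx Sx) *m xh t
    + \sum_k c t k *: ((Sx *m N k *m invmx Sx) *m xh t)).
  have pd : mxprimitive (fun t => x t - invmx SB *m xi t)
      (fun t => A *m (x t - invmx SB *m xi t) + 0 +
         \sum_k c t k *: (N k *m (x t - invmx SB *m xi t))).
    apply: mxprimitive_eq (mxprimitiveD px (mxprimitiveN pVxi)) => // t _.
    rewrite (eq_bigr _ (fun k _ => ucE k t (x t))) !opprD.
    rewrite (addrACA _ _ _ (- \sum_k _)) (addrACA (A *m x t)) subrr -mulmxBr; congr (_ + _).
    by rewrite -sumrB; apply: eq_bigr => k _; rewrite mulmxBr scalerBr.
  by apply: mxprimitive_eq (primitive_conj uX pd) => // t _; rewrite mulmx0 addr0.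
have xh0 : xh 0 = (Sx *m X0) *m v0 by rewrite /xh xi0 mulmx0 subr0 x0 mulmxA.
have eqPX : lyap_op gamma (Sx *m A *m invmx Sx) (Sx *m A *m invmx Sx)
    (fun k => Sx *m N k *m invmx Sx) (fun k => Sx *m N k *m invmx Sx) (diag_mx theta)
    = - ((Sx *m X0) *m (Sx *m X0)^T).
  by rewrite -eqXP lyap_op_conj // eqP0 mulmxN mulNmx trmx_mul !mulmxA.
have Nt0 k : N k = 0 -> Nt k = 0.
  move=> N0; have Nx0 : Nx k = 0.
    by rewrite /Nx N0 mulmx0 mul0mx /split_sq; apply/matrixP => i j; rewrite castmxE !mxE.
  rewrite /Nt Nx0 /red_N.
  have -> : ulsubmx (0 : 'M[R]_(rx + (n - rx))) = 0 by apply/matrixP => i j; rewrite !mxE.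
  have -> : ursubmx (0 : 'M[R]_(rx + (n - rx))) = 0 by apply/matrixP => i j; rewrite !mxE.
  by case: (mthx); rewrite ?mul0mx ?subr0.
have pxtc : mxprimitive xt (fun t => At *m xt t + \sum_k c t k *: (Nt k *m xt t)).
  apply: mxprimitive_eq pxt => // t _; congr (_ + _); apply: eq_bigr => k _.
  by have [/Nt0->|->] := hc t k; rewrite ?mul0mx ?scaler0.
have hom T (T0 : 0 <= T) := @homogeneous_part R n rx (n - rx)%N m p q (esym (subnKC hrx)) mthx
  gamma _ _ _ (C *m invmx Sx) (Sx *m X0) theta Y Z v0 c xh xt T gamma0 admX pTh1 th0
  (eqD _ _ uX eqXQ) eqPX pHX pLHX eqY hZ eZ lc2 pxh pxtc xh0 xt0 T0.
have W0 : 0 <= \tr (Theta2 *m W) by exact: (hom 0 (lexx 0)).1.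
have {}hom T (T0 : 0 <= T) : integral0 (fun t => sqn (C *m invmx Sx *m xh t - red_C mthx Ax Cx *m xt t)) T <=
    \tr (Theta2 *m W) * sqn v0 * expR (gamma ^+ 2 * integral0 (fun t => \sum_k c t k ^+ 2) T).
  exact: (hom T T0).2.
have [U hU] := in_L2_integral hu.
have U0 : 0 <= U by have := integral_sqn_ge0 u; rewrite hU lee_fin.
have lsu : locL1 (fun t => sqn (u t)) by exact: locL1_sqn.
have intU T : 0 <= T -> integral0 (fun t => sqn (u t)) T <= U.
  by move=> T0; rewrite -lee_fin -hU half_line_ge // => t _; exact: sqn_ge0.
have guE t : sqn (gu0 t) = gamma ^+ 2 * \sum_k c t k ^+ 2.
  by rewrite /sqn mulr_sumr; apply: eq_bigr => k _; rewrite mxE exprMn.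
have lgu : locL1 (fun t => sqn (gu0 t)).
  by apply: locL1_eq (locL1Z (gamma ^+ 2) lc2) => t _; rewrite guE.
have [K hK] : exists K, (\int[@lebesgue_measure R]_(t in `[0%R, +oo[) (sqn (gu0 t))%:E)%E = K%:E.
  have le : (\int[@lebesgue_measure R]_(t in `[0%R, +oo[) (sqn (gu0 t))%:E
      <= (gamma ^+ 2 * U)%:E)%E.
    apply: half_line_le => // [t _|T T0]; first exact: sqn_ge0.
    apply: le_trans (ler_wpM2l (sqr_ge0 _) (intU T T0)); rewrite -integral0Z //.
    apply: integral0_le => //; first exact: locL1Z.
    move=> t _; rewrite guE ler_wpM2l ?sqr_ge0 //; apply: ler_sum => k _.
    by rewrite cE; case: ifP => // _; rewrite expr0n sqr_ge0.
  have fn : (\int[@lebesgue_measure R]_(t in `[0%R, +oo[) (sqn (gu0 t))%:E)%E \is a fin_num.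
    by rewrite ge0_fin_numE ?integral_sqn_ge0 // (le_lt_trans le) // ltry.
  by exists (fine (\int[@lebesgue_measure R]_(t in `[0%R, +oo[) (sqn (gu0 t))%:E)%E); rewrite fineK.
have K0 : 0 <= K by have := integral_sqn_ge0 gu0; rewrite hK lee_fin.
have intK T : 0 <= T -> gamma ^+ 2 * integral0 (fun t => \sum_k c t k ^+ 2) T <= K.
  move=> T0; rewrite -integral0Z // -lee_fin -hK.
  have -> : integral0 (fun t => gamma ^+ 2 * \sum_k c t k ^+ 2) T = integral0 (fun t => sqn (gu0 t)) T.
    by apply: integral0_eq => t _; rewrite guE.
  by rewrite half_line_ge // => t _; exact: sqn_ge0.
rewrite (L2norm_sqrt hU) (L2norm_sqrt hK) -EFin_expe sqr_sqrtr // -!EFinM.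
(* The partial bounds control squared norms with the factor exp K; E is its square root. *)
set w := \tr (Theta2 *m W) in W0 hom *; set E := expR (2^-1 * K).
have E0 : 0 <= E := expR_ge0 _.
have EE : E ^+ 2 = expR K by rewrite expr2 -expRD; congr expR; lra.
have sum0 : 0 <= sum_sigma by apply: sumr_ge0 => i _; exact: ltW.
pose a := Num.sqrt w * norm2 v0 * E; pose b := 2 * sum_sigma * Num.sqrt U * E.
have a0 : 0 <= a by rewrite !mulr_ge0 ?sqrtr_ge0.
have b0 : 0 <= b by rewrite !mulr_ge0 ?sqrtr_ge0.
rewrite mulrDl -/a -/b.
pose ex t := C *m invmx Sx *m xh t - red_C mthx Ax Cx *m xt t.
pose eb t := C *m invmx SB *m (xi t - eta t).
have errE t : 0 <= t -> err t = ex t + eb t.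
  move=> t0; rewrite /err yE // yxE // yBE // /ex /eb mulmxBr etaE -/AB -/BB -/CB.
  have -> : C *m invmx Sx *m xh t = C *m x t - C *m invmx SB *m xi t.
    by rewrite /xh -!mulmxA (mulmxA (invmx Sx)) mulVmx // mul1mx mulmxBr.
  move: (C *m x t) (C *m invmx SB *m xi t) (_ *m xt t) (_ *m xb t) (_ *m u t) => a1 a2 a3 a4 a5.
  by apply/matrixP => i j; rewrite !mxE; ring.
have lex i : locL2 (fun t => ex t i ord0).
  have l1 i' : locL2 (fun t => xh t i' ord0).
    by apply: lbm_locL2; exact: primitive_lbm (pxh i' ord0).
  have l2 i' : locL2 (fun t => xt t i' ord0).
    by apply: lbm_locL2; exact: primitive_lbm (pxt i' ord0).
  have := locL2D (locL2_mulmx (C *m invmx Sx) l1 i)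
    (locL2Z (-1) (locL2_mulmx (red_C mthx Ax Cx) l2 i)).
  by apply: locL2_eq => t _; rewrite /ex mulN1r [RHS]mxE [X in _ = _ + X]mxE.
have leb i : locL2 (fun t => eb t i ord0).
  have [leta _ _] := teta; apply: locL2_mulmx => i'.
  by apply: locL2_eq (locL2D (lxi i') (locL2Z (-1) (leta i'))) => t _; rewrite !mxE mulN1r.
apply: L2norm_le; first exact: addr_ge0.
have -> : (\int[@lebesgue_measure R]_(t in `[0%R, +oo[) (sqn (err t))%:E)%E =
    (\int[@lebesgue_measure R]_(t in `[0%R, +oo[) (sqn (ex t + eb t))%:E)%E.
  by apply: eq_integral => t; rewrite inE /= in_itv /= andbT => t0; rewrite errE.
(* The bound on [0, T] is uniform in T, so it passes to the half-line. *)
apply: half_line_le => [|t _|T T0]; [|exact: sqn_ge0|].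
  apply: locL1_sqn => i.
  by apply: locL2_eq (locL2D (lex i) (leb i)) => t _; rewrite [RHS]mxE.
have expK : expR (gamma ^+ 2 * integral0 (fun t => \sum_k c t k ^+ 2) T) <= E ^+ 2.
  by rewrite EE ler_expR intK.
apply: minkowski_integral0 => //.
  apply: le_trans (hom T T0) _; rewrite /a !exprMn sqr_sqrtr // norm2_sqr.
  by rewrite ler_wpM2l // mulr_ge0 // sqn_ge0.
apply: le_trans (chain T T0) _.
have -> : \sum_(i in [set i0 : 'I_n | (rB <= i0)%N]%SET) sigma ord0 i = sum_sigma.
  by apply: eq_bigl => i; rewrite inE.
rewrite /b ![(_ * E) ^+ 2]exprMn [(_ * Num.sqrt U) ^+ 2]exprMn [Num.sqrt U ^+ 2]sqr_sqrtr //.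
apply: ler_pM => //.
- by rewrite mulr_ge0 ?sqr_ge0 // integral0_ge0 // => t _; exact: sqn_ge0.
- by rewrite ler_wpM2l ?sqr_ge0 // intU.
Qed.
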